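(* Let $q\ge 2$ and $2829\le K\le L\le M$ be integers, and impose periodic boundary conditions. For every $\mathbf{s}\in\mathcal{S}$, $$\lim_{\beta\to\infty}\mathbb{P}_{\mathbf{s}}^{\beta}\Big[\exists\,N\text{ and }0<t_1<\cdots<t_N<\tau_{\breve{\mathbf{s}}}\text{ such that }(\sigma_\beta(t_n))_{n=1}^N\text{ is a transition path between }\mathbf{s}\text{ and }\breve{\mathbf{s}}\Big]=1 .$$
   Context: Model. $\mathbb{T}_N=\mathbb{Z}/N\mathbb{Z}$, $\Lambda=\mathbb{T}_K\times\mathbb{T}_L\times\mathbb{T}_M$, $S=\{1,\dots,q\}$, $\mathcal{X}=S^\Lambda$, $H(\sigma)=\sum_{\{x,y\}\subseteq\Lambda:x\sim y}\mathbf{1}\{\sigma(x)\ne\sigma(y)\}$ ($x\sim y$: nearest neighbours). $\mathbf{s}_a$ is the configuration with all spins $a$, $\mathcal{S}=\{\mathbf{s}_1,\dots,\mathbf{s}_q\}$, $\mathcal{S}(A)=\{\mathbf{s}_a:a\in A\}$ for $A\subseteq S$, and $\breve{\mathbf{s}}=\mathcal{S}\setminus\{\mathbf{s}\}$. $\{\sigma_\beta(t)\}_{t\ge0}$ is the continuous-time Markov chain on $\mathcal{X}$ jumping from $\sigma$ to $\zeta$ at rate $e^{-\beta\max\{H(\zeta)-H(\sigma),0\}}$ if $\sigma,\zeta$ differ at exactly one site (written $\sigma\sim\zeta$), and at rate $0$ otherwise; $\mathbb{P}_\sigma^\beta$ is its law started at $\sigma$; $\tau_{\mathcal{A}}$ is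 the hitting time of $\mathcal{A}$. A path is a sequence $(\omega_t)_{t=0}^T$ in $\mathcal{X}$ with $\omega_t\sim\omega_{t+1}$ (similarly for other configuration spaces); it is a $c$-path if $H(\omega_t)\le c$ for all $t$; it is in a set if all $\omega_t$ are. $\Gamma=2KL+2K+2$ is the energy barrier between ground states. $[\![a,b]\!]=[a,b]\cap\mathbb{Z}$. Pairs $a,b\in S$ are always understood to be distinct. Two-dimensional objects. $\Lambda^{\mathrm{2D}}=\mathbb{T}_K\times\mathbb{T}_L$, $\mathcal{X}^{\mathrm{2D}}=S^{\Lambda^{\mathrm{2D}}}$, $H^{\mathrm{2D}}(\eta)=\sum_{\{x,y\}\subseteq\Lambda^{\mathrm{2D}}:x\sim y}\mathbf{1}\{\eta(x)\ne\eta(y)\}$, $\Gamma^{\mathrm{2D}}=2K+2$, $\mathbf{s}_a^{\mathrm{2D}}$ the constant configuration $a$. $\xi_{\ell,v}^{a,b}$ has spin $b$ on $\mathbb{T}_K\times\{\ell,\ell+1,\dots,\ell+v-1\}$ and $a$ elsewhere. $\xi_{\ell,v;k,h}^{a,b,+}$ (resp. $\xi_{\ell,v;k,h}^{a,b,-}$) is obtained from $\xi_{\ell,v}^{a,b}$ by additionally putting spin $b$ on $\{k,\dots,k+h-1\}\times\{\ell+v\}$ (resp. $\{k,\dots,k+h-1\}\times\{\ell-1\}$). If $K<L$: $\mathcal{R}_v^{a,b,\mathrm{2D}}=\{\xi_{\ell,v}^{a,b}:\ell\in\mathbb{T}_L\}$ and $\mathcal{Q}_v^{a,b,\mathrm{2D}}=\{\xi_{\ell,v;k,h}^{a,b,\pm}:\ell\in\mathbb{T}_L,k\in\mathbb{T}_K,h\in[\![1,K-1]\!]\}$.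 If $K=L$: $\mathcal{R}_v^{a,b,\mathrm{2D}},\mathcal{Q}_v^{a,b,\mathrm{2D}}$ are these sets together with their images under the transpose $(\Theta\eta)(k,\ell)=\eta(\ell,k)$. Set $\mathcal{B}_\Gamma^{a,b,\mathrm{2D}}=\bigcup_{v=2}^{L-3}\mathcal{Q}_v^{a,b,\mathrm{2D}}$, $\mathcal{B}^{a,b,\mathrm{2D}}=\mathcal{B}_\Gamma^{a,b,\mathrm{2D}}\cup\bigcup_{v=2}^{L-2}\mathcal{R}_v^{a,b,\mathrm{2D}}$, $\mathcal{B}_\Gamma^{\mathrm{2D}}=\bigcup_{a,b}\mathcal{B}_\Gamma^{a,b,\mathrm{2D}}$. $\mathcal{Z}^{a,b,\mathrm{2D}}$ is the set of $\eta\in\mathcal{X}^{\mathrm{2D}}$ for which there is a path $(\omega_t)_{t=0}^T$ in $\mathcal{X}^{\mathrm{2D}}\setminus\mathcal{B}_\Gamma^{\mathrm{2D}}$, $T\ge1$, with $\omega_0\in\mathcal{R}_2^{a,b,\mathrm{2D}}$, $\omega_T=\eta$ and $H^{\mathrm{2D}}(\omega_t)=\Gamma^{\mathrm{2D}}$ for all $t\in[\![1,T]\!]$. Finally $\mathcal{G}^{a,b,\mathrm{2D}}=\mathcal{Z}^{a,b,\mathrm{2D}}\cup\mathcal{B}^{a,b,\mathrm{2D}}\cup\mathcal{Z}^{b,a,\mathrm{2D}}$. Three-dimensional objects. $\mathfrak{m}_K=\lfloor K^{2/3}\rfloor$. $\mathfrak{S}_M$ is the collection of connected subsets of $\mathbb{T}_M$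 (including $\emptyset,\mathbb{T}_M$); $P\prec Q$ means $P\subseteq Q$, $|Q|=|P|+1$. For $\sigma\in\mathcal{X}$, $\sigma^{(m)}\in\mathcal{X}^{\mathrm{2D}}$ is $\sigma^{(m)}(k,\ell)=\sigma(k,\ell,m)$. $\sigma_P^{a,b}$ has spin $b$ at $(k,\ell,m)$ if $m\in P$ and $a$ if $m\notin P$. For $\mathcal{A}\subseteq\mathcal{X}$, $\Upsilon(\mathcal{A})$ is the union of the images of $\mathcal{A}$ under all permutations of the three coordinates that only permute coordinates of equal side length (so $\Upsilon(\mathcal{A})=\mathcal{A}$ if $K<L<M$; coordinates 1,2 may be exchanged if $K=L<M$; coordinates 2,3 if $K<L=M$; all six permutations if $K=L=M$). For $P\prec Q$ in $\mathfrak{S}_M$, $\widetilde{\mathcal{G}}_{P,Q}^{a,b}$ is the set of $\sigma$ with $\sigma^{(m)}=\mathbf{s}_b^{\mathrm{2D}}$ for $m\in P$, $\sigma^{(m)}=\mathbf{s}_a^{\mathrm{2D}}$ for $m\notin Q$, $\sigma^{(m)}\in\mathcal{G}^{a,b,\mathrm{2D}}$ for $m\in Q\setminus P$; $\mathcal{G}_{P,Q}^{a,b}=\Upsilon(\widetilde{\mathcal{G}}_{P,Q}^{a,b})$; $\mathcal{G}_i^{a,b}=\bigcup_{P\prec Q,|P|=i}\mathcal{G}_{P,Q}^{a,b}$. $\mathcal{R}_i^{a,b}=\Upsilon(\{\sigma_P^{a,b}:P\in\mathfrak{S}_M,|P|=i\})$. A proper partition $(A,B)$ of $S$ consists of nonempty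 disjoint $A,B$ with $A\cup B=S$; then $\mathcal{R}_i^{A,B}=\bigcup_{a\in A,b\in B}\mathcal{R}_i^{a,b}$, $\mathcal{G}^{A,B}=\bigcup_{a\in A,b\in B}\bigcup_{i=\mathfrak{m}_K-1}^{M-\mathfrak{m}_K}\mathcal{G}_i^{a,b}$. For disjoint $\mathcal{P},\mathcal{Q}\subseteq\mathcal{X}$, $\widehat{\mathcal{N}}(\mathcal{P};\mathcal{Q})$ is the set of $\zeta$ for which there is a $\Gamma$-path in $\mathcal{X}\setminus\mathcal{Q}$ connecting $\zeta$ and some element of $\mathcal{P}$. $\widehat{\mathcal{R}}_i^{A,B}=\widehat{\mathcal{N}}(\mathcal{R}_i^{A,B};\mathcal{G}^{A,B})$ and $\mathcal{H}^{A,B}=\mathcal{G}^{A,B}\cup\bigcup_{i=\mathfrak{m}_K}^{M-\mathfrak{m}_K}\widehat{\mathcal{R}}_i^{A,B}$. A path $(\omega_t)_{t=0}^T$ is a transition path between $\mathcal{S}(A)$ and $\mathcal{S}(B)$ if $\omega_0\in\widehat{\mathcal{N}}(\mathcal{S}(A);\mathcal{G}^{A,B})$, $\omega_T\in\widehat{\mathcal{N}}(\mathcal{S}(B);\mathcal{G}^{A,B})$ and $\omega_t\in\mathcal{H}^{A,B}$ for all $t\in[\![1,T-1]\!]$. A transition path between $\mathbf{s}=\mathbf{s}_a$ and $\breve{\mathbf{s}}$ is one with $A=\{a\}$, $B=S\setminus\{a\}$. *)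

(* Defs.v *)
From HB Require Import structures.
From mathcomp Require Import all_boot all_order all_algebra all_fingroup.
From mathcomp Require Import all_classical all_reals all_analysis.

Set Implicit Arguments.
Unset Strict Implicit.
Unset Printing Implicit Defensive.

Import Order.TTheory GRing.Theory Num.Theory.
Import numFieldNormedType.Exports.

Local Open Scope classical_set_scope.
Local Open Scope ring_scope.

(* ---------- Continuous-time Markov chains on a finite state space ---------- *)

Definition exit_rate (R : realType) (X : finType) (r : X -> X -> R) (x : X) : R :=
  \sum_(y : X) r x y.

(* [is_markov_chain P r x0 s]: under [P], the process [s t], [t >= 0], is the
   continuous-time Markov chain started at [x0] that jumps from [x] to [y] at
   rate [r x y] (jump-chain / holding-time description, see J. Norris, "Markov
   chains", Section 2.6).  [Y] is the jump chain, [S] are the holding times and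
   [J n] is the time of the [n]-th jump.  The rates must satisfy [r x x = 0] and
   [0 < exit_rate r x] for all [x], so that every holding time is finite.
   All trajectories, not only almost all of them, are right-continuous step
   functions with finitely many jumps in bounded time. *)
Definition is_markov_chain (R : realType) (d : measure_display)
    (Omega : measurableType d) (P : probability Omega R) (X : finType)
    (r : X -> X -> R) (x0 : X) (s : R -> Omega -> X) : Prop :=
  exists (Y : nat -> Omega -> X) (S : nat -> Omega -> R),
    let J (n : nat) (w : Omega) : R := \sum_(i < n) S i w in
    [/\ (forall n y, measurable (Y n @^-1` [set y])) /\
        (forall n, measurable_fun [set: Omega] (S n)),
        forall n w, 0 < S n w,
        forall w, J n w @[n --> \oo] --> +oo,
        forall n w t, J n w <= t < J n.+1 w -> s t w = Y n w &
        forall (n : nat) (y : nat -> X) (u : nat -> R), (forall i, 0 <= u i) ->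
          P [set w | forall i, (i <= n)%N -> Y i w = y i /\ u i < S i w] =
          ((y 0%N == x0)%:R *
           \prod_(i < n) (r (y i) (y i.+1) / exit_rate r (y i)) *
           \prod_(i < n.+1) expR (- (exit_rate r (y i) * u i)))%:E].

Definition hitting_time (R : realType) (Omega : Type) (X : Type)
    (s : R -> Omega -> X) (A : set X) (w : Omega) : \bar R :=
  ereal_inf [set t%:E | t in [set t : R | 0 <= t /\ A (s t w)]].

(* ---------- Spin systems on a finite graph ---------- *)

Section SpinSystem.
Variables (V : finType) (q : nat) (e : rel V).
Local Notation config := {ffun V -> 'I_q}.
Implicit Types (s z : config) (w : nat -> config) (A B : set config).

Definition hamiltonian s : nat :=
  #|[set E : {set V} |
      [exists x, exists y, [&& E == [set x; y], e x y & s x != s y]]]%SET|.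

Definition config_adj s z : bool := #|[set x | s x != z x]%SET| == 1%N.

(* The sequence [w 0, ..., w T] is a path; other values of [w] are irrelevant. *)
Definition is_path w (T : nat) : Prop :=
  forall t, (t < T)%N -> config_adj (w t) (w t.+1).

Definition metropolis_rate (R : realType) (beta : R) s z : R :=
  if config_adj s z then
    expR (- (beta * Num.max ((hamiltonian z)%:R - (hamiltonian s)%:R) 0))
  else 0.

(* The set written \hat N(A; B), for the energy level [c]. *)
Definition nbhd_hat (c : nat) A B : set config :=
  [set z | exists (T : nat) (w : nat -> config),
     [/\ is_path w T, w 0%N = z, A (w T) &
         forall t, (t <= T)%N -> (hamiltonian (w t) <= c)%N /\ ~ B (w t)]].

Definition monochromatic (a : 'I_q) : config := [ffun _ => a].
Definition grounds (A : {set 'I_q}) : set config :=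
  [set monochromatic a | a in [set` A]].

End SpinSystem.

(* ---------- Discrete tori; the torus Z/NZ is represented by 'I_N ---------- *)

Definition cycle_adj (N : nat) : rel 'I_N :=
  fun i j => (j == ordS i) || (i == ordS j).

Definition box_adj (V W : finType) (e : rel V) (f : rel W) : rel (V * W) :=
  fun x y => (e x.1 y.1 && (x.2 == y.2)) || ((x.1 == y.1) && f x.2 y.2).

Definition adj2 (K L : nat) : rel ('I_K * 'I_L) :=
  box_adj (@cycle_adj K) (@cycle_adj L).
Definition adj3 (K L M : nat) : rel ('I_K * 'I_L * 'I_M) :=
  box_adj (@adj2 K L) (@cycle_adj M).

(* [shift l n] is l + n modulo N; [arc l n] is {l, l + 1, ..., l + n - 1}. *)
Definition shift (N : nat) (l : 'I_N) (n : nat) : 'I_N := iter n (@ordS N) l.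
Definition arc (N : nat) (l : 'I_N) (n : nat) : {set 'I_N} :=
  [set shift l (i : 'I_n) | i in [set: 'I_n]%SET]%SET.

(* ---------- Two-dimensional configurations ---------- *)

Section TwoDim.
Variables (K L q : nat).
Local Notation config2 := {ffun 'I_K * 'I_L -> 'I_q}.
Implicit Types (a b : 'I_q) (eta : config2).

Definition hamiltonian2 eta : nat := hamiltonian (@adj2 K L) eta.
Definition Gamma2 : nat := (2 * K + 2)%N.

Definition xi a b (l : 'I_L) (v : nat) : config2 :=
  [ffun x => if x.2 \in arc l v then b else a].
Definition xi_plus a b (l : 'I_L) (v : nat) (k : 'I_K) (h : nat) : config2 :=
  [ffun x => if (x.1 \in arc k h) && (x.2 == shift l v) then b
             else xi a b l v x].
Definition xi_minus a b (l : 'I_L) (v : nat) (k : 'I_K) (h : nat) : config2 :=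
  [ffun x => if (x.1 \in arc k h) && (x.2 == ord_pred l) then b
             else xi a b l v x].

(* [eta'] is the transpose of [eta]; only meaningful when [K = L]. *)
Definition transpose_of eta eta' : Prop :=
  forall x y : 'I_K * 'I_L,
    x.1 = y.2 :> nat -> x.2 = y.1 :> nat -> eta' x = eta y.
Definition with_transpose (A : set config2) : set config2 :=
  A `|` [set eta' | K = L /\ exists2 eta, A eta & transpose_of eta eta'].

Definition R2 a b (v : nat) : set config2 :=
  with_transpose [set eta | exists l, eta = xi a b l v].
Definition Q2 a b (v : nat) : set config2 :=
  with_transpose [set eta | exists l k h, (1 <= h <= K - 1)%N /\
    (eta = xi_plus a b l v k h \/ eta = xi_minus a b l v k h)].

Definition BGamma2 a b : set config2 :=
  \bigcup_(v in [set v : nat | (2 <= v <= L - 3)%N]) Q2 a b v.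
Definition B2 a b : set config2 :=
  BGamma2 a b `|` \bigcup_(v in [set v : nat | (2 <= v <= L - 2)%N]) R2 a b v.
Definition BGamma2_all : set config2 :=
  [set eta | exists a b, a != b /\ BGamma2 a b eta].

Definition Z2 a b : set config2 :=
  [set eta | exists (T : nat) (w : nat -> config2),
     [/\ (1 <= T)%N, is_path w T,
         forall t, (t <= T)%N -> ~ BGamma2_all (w t),
         R2 a b 2 (w 0%N) /\ w T = eta &
         forall t, (1 <= t <= T)%N -> hamiltonian2 (w t) = Gamma2]].

Definition G2 a b : set config2 := Z2 a b `|` B2 a b `|` Z2 b a.

End TwoDim.

(* ---------- Three-dimensional configurations ---------- *)

(* The integer part of K^(2/3), see [mKE]. *)
Definition mK (K : nat) : nat := \max_(m < K.+1 | (m ^ 3 <= K ^ 2)%N) m.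

Lemma mKE (R : realType) (K : nat) :
  mK K = Num.truncn ((K%:R : R) `^ (2%:R / 3%:R)).
Proof.
have key m : (m%:R <= (K%:R : R) `^ (2%:R / 3%:R)) = (m ^ 3 <= K ^ 2)%N.
  have -> : ((m ^ 3 <= K ^ 2)%N : bool) = (m%:R ^+ 3 <= K%:R ^+ 2 :> R).
    by rewrite -!natrX ler_nat.
  have -> : K%:R ^+ 2 = ((K%:R : R) `^ (2%:R / 3%:R)) ^+ 3.
    rewrite -[RHS]powR_mulrn ?powR_ge0// -powRrM divfK ?pnatr_eq0//.
    by rewrite powR_mulrn.
  by rewrite ler_pXn2r// nnegrE ?powR_ge0 ?ler0n.
apply/eqP; rewrite eqn_leq; apply/andP; split.
  rewrite truncn_ge_nat ?powR_ge0// key /mK.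
  have h0 : (0 ^ 3 <= K ^ 2)%N by [].
  apply: (@big_ind _ (fun m => m ^ 3 <= K ^ 2)%N) => // m n hm hn.
  by rewrite /maxn; case: ifP.
set t := Num.truncn _.
have ht : (t ^ 3 <= K ^ 2)%N by rewrite -key truncn_le powR_ge0.
have tK : (t < K.+1)%N.
  rewrite ltnS leqNgt; apply/negP => Kt.
  have : (K ^ 3 < K ^ 2)%N by apply: leq_trans ht; rewrite ltn_exp2r.
  apply/negP; rewrite -leqNgt; case: (posnP K) => [->//|K0].
  exact: leq_pexp2l.
exact: (leq_bigmax_cond (Ordinal tK)).
Qed.

Section ThreeDim.
Variables (K L M q : nat).
Local Notation site := ('I_K * 'I_L * 'I_M)%type.
Local Notation config := {ffun site -> 'I_q}.
Implicit Types (a b : 'I_q) (A B : {set 'I_q}) (P Q : {set 'I_M}) (s : config).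

Definition hamiltonian3 s : nat := hamiltonian (@adj3 K L M) s.
Definition Gamma : nat := (2 * K * L + 2 * K + 2)%N.

Definition connected_set P : bool :=
  [forall x in P, forall y in P,
    connect [rel u v | [&& u \in P, v \in P & cycle_adj u v]] x y].
Definition prec P Q : bool := (P \subset Q) && (#|Q| == #|P|.+1).

Definition slice s (m : 'I_M) : {ffun 'I_K * 'I_L -> 'I_q} :=
  [ffun x => s (x, m)].
Definition slab a b P : config := [ffun x => if x.2 \in P then b else a].

Definition coord (x : site) (i : 'I_3) : nat :=
  nth 0%N [:: x.1.1 : nat; x.1.2 : nat; x.2 : nat] i.
Definition side (i : 'I_3) : nat := nth 0%N [:: K; L; M] i.
(* [s'] is the image of [s] under the permutation [p] of the coordinates; when
   [p] preserves [side], every [x] has exactly one corresponding [y]. *)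
Definition permuted (p : 'S_3) s s' : Prop :=
  forall x y : site, (forall i, coord y i = coord x (p i)) -> s' x = s y.
Definition Upsilon (C : set config) : set config :=
  [set s' | exists (p : 'S_3) (s : config),
     [/\ forall i, side (p i) = side i, C s & permuted p s s']].

Definition Gtilde a b P Q : set config :=
  [set s | forall m : 'I_M,
     [/\ m \in P -> slice s m = monochromatic _ b,
         m \notin Q -> slice s m = monochromatic _ a &
         m \in Q :\: P -> G2 a b (slice s m)]].
Definition G3 a b (i : nat) : set config :=
  [set s | exists P Q, [/\ connected_set P && connected_set Q, prec P Q,
     #|P| = i & Upsilon (Gtilde a b P Q) s]].
Definition R3 a b (i : nat) : set config :=
  Upsilon [set s | exists P, [/\ connected_set P, #|P| = i & s = slab a b P]].

(* [(A, B)] is meant to be a proper partition of the set of spins. *)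
Definition RAB A B (i : nat) : set config :=
  [set s | exists a b, [/\ a \in A, b \in B & R3 a b i s]].
Definition GAB A B : set config :=
  [set s | exists a b i, [/\ a \in A, b \in B,
     (mK K - 1 <= i <= M - mK K)%N & G3 a b i s]].
Definition Nhat : set config -> set config -> set config :=
  nbhd_hat (@adj3 K L M) Gamma.
Definition RhatAB A B (i : nat) : set config := Nhat (RAB A B i) (GAB A B).
Definition HAB A B : set config :=
  GAB A B `|`
  \bigcup_(i in [set i : nat | (mK K <= i <= M - mK K)%N]) RhatAB A B i.

Definition transition_path A B (w : nat -> config) (T : nat) : Prop :=
  [/\ is_path w T, Nhat (grounds A) (GAB A B) (w 0%N),
      Nhat (grounds B) (GAB A B) (w T) &
      forall t, (1 <= t <= T - 1)%N -> HAB A B (w t)].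

(* Here n = 0, ..., T corresponds to the times t_1, ..., t_N with N = T + 1. *)
Definition follows_transition_path (R : realType) (Omega : Type)
    (s : R -> Omega -> config) (a : 'I_q) : set Omega :=
  [set w | exists (T : nat) (t : nat -> R),
     [/\ 0 < t 0%N, forall n, (n < T)%N -> t n < t n.+1,
         ((t T)%:E < hitting_time s (grounds [set~ a]%SET) w)%E &
         transition_path [set a]%SET [set~ a]%SET (fun n => s (t n) w) T]].

End ThreeDim.

(* Main.v *)
(** Two independent estimates are combined.

    Energy landscape.  Along a path of energy at most [Gamma] that starts at
    [s_a] and ends in another ground state, every configuration outside the gate
    set [G] lies in the well of [s_a], in the well of the other ground states, or
    in some [R^_i].  Only an exit from [G] needs an argument.  A gate
    configuration is a slab with one special slice [eta], of energy
    [2KL + H2 eta + #(third spins)], so an allowed move changes only [eta] and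
    leads out of the two-dimensional gate set only to a two-spin slice with
    [H2 <= 2K].  A slice of that energy either has a constant row and a constant
    column, and then one of the two spins can be removed site by site without
    raising the energy, or is a strip of width [1] or [L - 1].  This descent keeps
    the energy at most [2KL + 2K], a level at which gate configurations are
    isolated, hence it avoids [G] and ends in a slab; the outermost slabs are
    joined to a ground state by the lexicographic filling path, which avoids [G]
    because of its volume.  The last visit to the first well before the first
    visit to the second one then delimits a transition path.  Nothing requires the
    two wells to be disjoint: if they met, a transition path of length zero would
    do, so no lower bound on the energy barrier is used.

    Probability.  With the symmetric conductances [exp(- beta max(H s, H z))], the
    probability of visiting an energy above [Gamma] before another ground state is
    the flux of a Green function into [{H > Gamma}].  That function is maximal at
    its pole, with value at most the resistance of the filling path, of order
    [exp(beta Gamma)], while every conductance at [{H > Gamma}] is at most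
    [exp(- beta (Gamma + 1))]. *)

(* All energy estimates are sums, over the lines of the torus, of the number [cut] of disagreements
   along a line: a nonconstant line costs at least 2, a line with three spins at least 3, a two-spin
   line an even amount. A gate configuration has energy at least [2KL + 2K], so [Gamma] leaves it a
   margin of 2. A flip in one of its monochromatic slices costs 4, which confines allowed moves to
   the special slice; there parity excludes the energy [2K + 1], so a slice below the top level
   [2K + 2] is already at [2K]. The range of the number of slices matters because [mK K >= 3] leaves
   two full slices of each spin, so every vertical line stays nonconstant after any flip. On the
   probabilistic side the law of the jump chain killed outside a set is tested against nonnegative
   solutions of Dirichlet problems; holding times enter only through the identity, valid on every
   trajectory, between the event in continuous time and an event of the jump chain. *)
Require Import Defs.
From HB Require Import structures.
From mathcomp Require Import all_boot all_order all_algebra all_fingroup.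
From mathcomp Require Import all_classical all_reals all_analysis.
From mathcomp Require Import zify ring lra.

Set Implicit Arguments.
Unset Strict Implicit.
Unset Printing Implicit Defensive.

Import Order.TTheory GRing.Theory Num.Theory.
Import numFieldNormedType.Exports.

Local Open Scope classical_set_scope.
Local Open Scope ring_scope.

(* These names are shadowed by MathComp. *)
Local Notation shift := Defs.shift.
Local Notation arc := Defs.arc.
Local Notation coord := Defs.coord.

(** * Cycles *)

Section CyclicOffset.
Local Open Scope nat_scope.
Variable N : nat.
Implicit Types (l x : 'I_N) (n : nat).

Definition offset l x : nat := (x + N - l) %% N.

Lemma val_shift l n : shift l n = (l + n) %% N :> nat.
Proof.
elim: n => [|n IHn]; first by rewrite addn0 modn_small.
by rewrite /shift iterS /= -/(shift l n) IHn -addn1 modnDml addn1 addnS.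
Qed.

Lemma offset_lt l x : offset l x < N.
Proof. by rewrite ltn_mod (leq_ltn_trans _ (ltn_ord l)). Qed.

Lemma shift_offset l x : shift l (offset l x) = x.
Proof.
apply/val_inj; rewrite /= val_shift /offset modnDmr.
have -> : l + (x + N - l) = x + N by have := ltn_ord l; lia.
by rewrite modnDr modn_small.
Qed.

Lemma offset_shift l n : offset l (shift l n) = n %% N.
Proof.
have l_lt := ltn_ord l.
rewrite /offset val_shift.
have -> : (l + n) %% N + N - l = (l + n) %% N + (N - l) by lia.
rewrite modnDml; have -> : l + n + (N - l) = n + N by lia.
by rewrite modnDr.
Qed.

Lemma shift_inj_mod l n n' : shift l n = shift l n' -> n = n' %[mod N].
Proof. by move=> /(congr1 (offset l)); rewrite !offset_shift. Qed.

Lemma shiftS l n : shift l n.+1 = ordS (shift l n).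
Proof. by []. Qed.

Lemma shift_modulus l : shift l N = l.
Proof.
by apply/val_inj; rewrite /= val_shift modnDr modn_small.
Qed.

Lemma offset_self l : offset l l = 0.
Proof. by rewrite -{2}[l]/(shift l 0) offset_shift mod0n. Qed.

Lemma offset_inj l : injective (offset l).
Proof. by move=> x y exy; rewrite -(shift_offset l x) exy shift_offset. Qed.

Lemma offset_ord_pred l x : x != l -> offset l (ord_pred x) = (offset l x).-1.
Proof.
move=> x_neq_l; have := offset_lt l x.
case E : (offset l x) => [|n] n_lt.
  by case/eqP: x_neq_l; apply: (@offset_inj l); rewrite E offset_self.
rewrite -(shift_offset l x) E shiftS ordSK offset_shift modn_small //.
exact: ltnW.
Qed.

Lemma mem_arc l n x : (x \in arc l n) = (offset l x < n).
Proof.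
apply/imsetP/idP => [[i _ ->]|lt_n].
  by rewrite offset_shift (leq_ltn_trans (leq_mod _ _)).
by exists (Ordinal lt_n); rewrite ?inE // shift_offset.
Qed.

Lemma card_arc l n : n <= N -> #|arc l n| = n.
Proof.
move=> n_le; rewrite card_in_imset ?cardsT ?card_ord // => i j _ _ /shift_inj_mod.
by rewrite !modn_small ?(leq_trans (ltn_ord _)) // => /val_inj.
Qed.

Lemma ordS_neq x : 1 < N -> ordS x != x.
Proof.
move=> N_gt1; apply: contraTneq isT => E; have : shift x 1 = shift x 0 by exact: E.
by move/shift_inj_mod; rewrite mod0n modn_small.
Qed.

End CyclicOffset.

(** * Disagreements along a cycle *)

Section Cut.
Local Open Scope nat_scope.
Variable N : nat.

Definition cut (T : eqType) (f : 'I_N -> T) : nat :=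
  \sum_(i : 'I_N) (f i != f (ordS i)).

Lemma eq_cut (T : eqType) (f g : 'I_N -> T) : f =1 g -> cut f = cut g.
Proof. by move=> efg; apply: eq_bigr => i _; rewrite !efg. Qed.

(** Unrolls the cycle at [l], so that the sum can be split at chosen positions and each piece
    bounded by [cut_interval]. *)
Lemma cut_shift (T : eqType) (f : 'I_N -> T) (l : 'I_N) :
  cut f = \sum_(0 <= j < N) (f (shift l j) != f (shift l j.+1)).
Proof.
rewrite big_mkord /cut (reindex (fun j : 'I_N => shift l j)) //=.
exists (fun x => Ordinal (offset_lt l x)) => [j _|x _].
  by apply/val_inj; rewrite /= offset_shift modn_small.
by rewrite /= shift_offset.
Qed.

Lemma cut_interval (T : eqType) (g : nat -> T) (i k : nat) :
  i <= k -> g i != g k -> 1 <= \sum_(i <= j < k) (g j != g j.+1).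
Proof.
elim: k => [|k IHk]; first by rewrite leqn0 => /eqP ->; rewrite eqxx.
rewrite leq_eqVlt => /predU1P[->|]; first by rewrite eqxx.
rewrite ltnS => le_ik neq; rewrite big_nat_recr //=.
case: (eqVneq (g i) (g k)) => [<-|/(IHk le_ik)]; last by lia.
by rewrite neq; lia.
Qed.

Lemma cut_le_cut (T U : eqType) (f : 'I_N -> T) (h : T -> U) :
  cut (h \o f) <= cut f.
Proof.
apply: leq_sum => i _ /=; case: (eqVneq (f i) (f (ordS i))) => [->|_] //=.
  by rewrite eqxx.
by case: eqP.
Qed.

(** Modulo 2 a disagreement of booleans is the sum of the two values, and around the cycle every
    value is counted twice. *)
Lemma cut_even (f : 'I_N -> bool) : ~~ odd (cut f).
Proof.
suff : odd (cut f) = odd (\sum_i f i + \sum_i f (ordS i)).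
  move=> ->; rewrite -(reindex_inj (@ordS_inj N) (P := xpredT) (F := fun i => nat_of_bool (f i))) /=.
  by rewrite oddD addbb.
rewrite /cut -big_split /=.
apply: (big_ind2 (fun a b => odd a = odd b)) => // [a b c d ea ec|i _].
  by rewrite !oddD ea ec.
by case: (f i); case: (f _).
Qed.

Lemma cut_eq0 (T : eqType) (f : 'I_N -> T) : cut f = 0 -> forall i j, f i = f j.
Proof.
move=> /eqP; rewrite sum_nat_eq0 => /forallP f0.
have fS k : f (ordS k) = f k.
  by have := f0 k; rewrite /= eqb0 negbK => /eqP.
have fs i n : f (shift i n) = f i by elim: n => //= n IHn; rewrite fS.
by move=> i j; rewrite -(shift_offset i j) fs.
Qed.

Lemma cut_constant (T : eqType) (f : 'I_N -> T) c : (forall i, f i = c) -> cut f = 0.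
Proof. by move=> fc; rewrite /cut big1 // => i _; rewrite !fc eqxx. Qed.

Lemma cut_bool_ge2 (f : 'I_N -> bool) i j : f i != f j -> 2 <= cut f.
Proof.
move=> neq; have := cut_even f; case E: (cut f) => [|[|n]] //.
by case/eqP: neq; exact: cut_eq0.
Qed.

Lemma cut_ge2 (T : eqType) (f : 'I_N -> T) i j : f i != f j -> 2 <= cut f.
Proof.
move=> neq; apply: leq_trans (cut_le_cut f (pred1 (f i))).
by apply: (@cut_bool_ge2 _ i j); rewrite /= eqxx eq_sym (negbTE (_ : f j != f i)) 1?eq_sym.
Qed.

(* Every cut edge of [f] is cut by at most two of the three indicator functions. *)
Lemma cut_ge3 (T : finType) (f : 'I_N -> T) i j k :
  f i != f j -> f i != f k -> f j != f k -> 3 <= cut f.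
Proof.
move=> nij nik njk.
have ind (t t' : 'I_N) : f t != f t' -> 2 <= cut (fun u => f u == f t).
  move=> neq; apply: (@cut_bool_ge2 _ t t').
  by rewrite eqxx [f t' == _]eq_sym (negbTE neq).
have one u : (u == f i) + (u == f j) + (u == f k) <= 1.
  case: (eqVneq u (f i)) => [->|_]; first by rewrite (negbTE nij) (negbTE nik).
  by case: (eqVneq u (f j)) => [->|_]; [rewrite (negbTE njk) | case: (_ == _)].
have le_add (a b : bool) : (a != b) <= a + b by case: a; case: b.
have sum3 : cut (fun u => f u == f i) + cut (fun u => f u == f j)
    + cut (fun u => f u == f k) <= cut f + cut f.
  rewrite /cut -!big_split /=; apply: leq_sum => t _.
  case: (eqVneq (f t) (f (ordS t))) => [->|neq]; first by rewrite !eqxx.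
  have := one (f t); have := one (f (ordS t)).
  have := le_add (f t == f i) (f (ordS t) == f i).
  have := le_add (f t == f j) (f (ordS t) == f j).
  have := le_add (f t == f k) (f (ordS t) == f k).
  lia.
have := ind i j nij; have := ind i k nik; have := ind j k njk.
by have := ind k i; rewrite eq_sym => /(_ nik); have := ind j k njk; lia.
Qed.

(** Membership can change only at the edge entering [l] and at the edge leaving the last site
    [shift l n.-1]. *)
Lemma cut_arc l n : cut (fun i : 'I_N => i \in arc l n) <= 2.
Proof.
pose e2 := shift l n.-1.
apply: (@leq_trans (\sum_(i : 'I_N) ((i == ord_pred l) + (i == e2)))).
  apply: leq_sum => i _.
  have [->|neq] := eqVneq i (ord_pred l); first by rewrite (leq_trans (leq_b1 _)).
  have neqS : ordS i != l.
    by apply: contra neq => /eqP <-; rewrite ordSK.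
  have := offset_ord_pred neqS; rewrite ordSK !mem_arc => e.
  have [->|neq2] := eqVneq i e2; first by rewrite addn1 (leq_trans (leq_b1 _)).
  have o1 : offset l (ordS i) != 0.
    by apply: contra neqS => /eqP E; apply/eqP/(@offset_inj _ l); rewrite offset_self.
  have o2 : offset l i != n.-1.
    by apply: contra neq2 => /eqP E; apply/eqP; rewrite /e2 -E shift_offset.
  have -> : (offset l i < n) = (offset l (ordS i) < n) by lia.
  by rewrite eqxx.
rewrite big_split /= (bigD1 (ord_pred l)) //= eqxx big1 => [|i /negbTE ->] //.
by rewrite (bigD1 e2) //= eqxx big1 => [|i /negbTE ->].
Qed.

(** The arc runs from an entry [l] into the true set to the first exit after it; a true site beyond
    that exit would force a third change before the cycle closes at the false site [ord_pred l]. *)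
Lemma cut_le2_arc (f : 'I_N -> bool) i j : f i != f j -> cut f <= 2 ->
  exists (l : 'I_N) (n : nat), 0 < n < N /\ forall x, f x = (x \in arc l n).
Proof.
move=> neq cut2.
have [l fl fpl] : exists2 l, f l & ~~ f (ord_pred l).
  case: (pickP (fun l => f l && ~~ f (ord_pred l))) => [l /andP[? ?]|none]; first by exists l.
  have [k fk] : exists k, f k.
    by case: (boolP (f i)) neq => [|nfi]; [exists i | exists j; move: neq; case: (f j)].
  have all n : f (iter n (@ord_pred N) k).
    elim: n => //= n IHn; have := none (iter n (@ord_pred N) k).
    by rewrite IHn /= => /negbFE.
  have allS x : f x.
    rewrite -(shift_offset x k) in all.
    have := all (offset x k); suff -> : iter (offset x k) (@ord_pred N) (shift x (offset x k)) = x by [].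
    by elim: (offset x k) => //= n IHn; rewrite -iterS iterSr /= ordSK.
  by move: neq; rewrite !allS.
pose g n := f (shift l n).
have N_gt0 : 0 < N by apply: leq_ltn_trans (ltn_ord l).
have gN1 : ~~ g N.-1.
  suff E : ordS (shift l N.-1) = l by rewrite /g -(ordSK (shift l _)) E.
  by rewrite -shiftS (prednK N_gt0) shift_modulus.
have ex0 : exists n, ~~ g n by exists N.-1.
case: (ex_minnP ex0) => n gn n_min.
have n_gt0 : 0 < n by case: n gn {n_min} => //; rewrite /g /= fl.
have n_ltN : n < N by have := n_min _ gN1; lia.
exists l, n; split; first by rewrite n_gt0.
move=> x; rewrite mem_arc -{1}(shift_offset l x) -/(g _).
case: (ltnP (offset l x) n) => [lt|le].
  by apply: contraTT lt => /n_min; rewrite -leqNgt.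
apply/negbTE/negP => gx.
have x_lt : offset l x < N.-1.
  have x_ltN := offset_lt l x.
  have [E|neqN] := eqVneq (offset l x) N.-1; last by lia.
  by move: gx; rewrite E (negbTE gN1).
have cutE : cut f = \sum_(0 <= j < N) (g j != g j.+1) := cut_shift f l.
move: cut2; rewrite cutE.
rewrite (big_cat_nat _ (n := n)) //=; last exact: ltnW.
rewrite (big_cat_nat _ (n := offset l x) (m := n)) //=; last by lia.
rewrite (big_cat_nat _ (n := N.-1) (m := offset l x)) //=; [|lia|lia].
have := @cut_interval _ g 0 n (leq0n _); rewrite {1}/g /= fl eq_sym (negbTE gn) => /(_ isT).
have := @cut_interval _ g n (offset l x) le; rewrite gx (negbTE gn) => /(_ isT).
have := @cut_interval _ g (offset l x) N.-1 (ltnW x_lt); rewrite gx (negbTE gN1) => /(_ isT).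
lia.
Qed.

End Cut.
(** Copying the value of the predecessor removes one disagreement and creates at most one, on the
    other side. *)
Lemma cut_flip_le (N : nat) (T : eqType) (f f' : 'I_N -> T) (i : 'I_N) :
  (forall j, j != i -> f' j = f j) -> f' i = f (ord_pred i) ->
  f i != f (ord_pred i) -> (cut f' <= cut f)%N.
Proof.
move=> f'E f'i neq.
have pi_neq : ord_pred i != i by apply: contraNneq neq => ->.
rewrite /cut (bigD1 (ord_pred i)) //= [leqRHS](bigD1 (ord_pred i)) //=.
rewrite (bigD1 i) 1?eq_sym //= [in leqRHS](bigD1 i) 1?eq_sym //=.
rewrite !ord_predK f'i f'E // eqxx [f (ord_pred i) == f i]eq_sym neq /=.
rewrite !addnA leq_add //; last first.
  rewrite leq_eqVlt; apply/orP; left; apply/eqP; apply: eq_bigr => j /andP[jp ji].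
  rewrite !f'E //; apply: contra jp => /eqP <-; by rewrite ordSK.
by rewrite add0n (leq_trans (leq_b1 _)).
Qed.

(** * The Hamiltonian of a torus *)

Section Hamiltonian.
Local Open Scope nat_scope.
Variables (V : finType) (q : nat) (e : rel V).
Implicit Types s z : {ffun V -> 'I_q}.

(** Doubling turns unordered edges into ordered pairs, over which sums can be reindexed and
    exchanged; the fibre over an edge is [(x, y)] and [(y, x)]. *)
Lemma hamiltonian_double s : symmetric e ->
  (hamiltonian e s).*2 = \sum_x \sum_y (e x y && (s x != s y)).
Proof.
move=> e_sym; rewrite pair_bigA /=.
pose D := [set p : V * V | e p.1 p.2 && (s p.1 != s p.2)]%SET.
pose h (p : V * V) := [set p.1; p.2]%SET.
transitivity (\sum_(p in D) 1); last first.
  by rewrite big_mkcond; apply: eq_bigr => p _; rewrite inE; case: (_ && _).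
pose Es := [set E : {set V} |
      [exists x, exists y, [&& E == [set x; y], e x y & s x != s y]]]%SET.
rewrite (partition_big h (mem Es)) /=; last first.
  move=> [x y]; rewrite !inE /= => xy; apply/existsP; exists x.
  by apply/existsP; exists y; rewrite eqxx.
rewrite -/Es -muln2 -sum_nat_const; apply: eq_bigr => E.
rewrite inE => /existsP[x /existsP[y /and3P[/eqP -> exy sxy]]].
have xy : x != y by apply: contraNneq sxy => ->.
rewrite sum1dep_card.
transitivity #|[set (x, y); (y, x)]%SET|.
  by rewrite cards2 xpair_eqE negb_and xy.
apply: eq_card => -[u v]; rewrite !inE /= !xpair_eqE; apply/idP/idP.
  case/orP => /andP[/eqP -> /eqP ->]; rewrite ?exy ?sxy /= /h /= ?eqxx //.
  by rewrite e_sym exy eq_sym sxy finset.setUC eqxx.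
case/andP => /andP[_ suv] /eqP huv.
have : u \in [set x; y]%SET by rewrite -huv !inE eqxx.
have : v \in [set x; y]%SET by rewrite -huv !inE eqxx orbT.
rewrite !inE.
by move=> /orP[]/eqP ev /orP[]/eqP eu; move: suv; rewrite eu ev ?eqxx ?orbT.
Qed.

Lemma hamiltonian_bij s (g : V -> V) : symmetric e -> injective g ->
  (forall x y, e (g x) (g y) = e x y) ->
  hamiltonian (q := q) e [ffun x => s (g x)] = hamiltonian e s.
Proof.
move=> e_sym g_inj ge; apply: double_inj; rewrite !hamiltonian_double //.
rewrite [RHS](reindex_inj g_inj) /=; apply: eq_bigr => x _.
by rewrite [RHS](reindex_inj g_inj) /=; apply: eq_bigr => y _; rewrite !ffunE ge.
Qed.

Lemma hamiltonian_monochromatic (a : 'I_q) : hamiltonian e (monochromatic V a) = 0.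
Proof.
apply: eq_card0 => E; rewrite inE; apply/existsP => -[x /existsP[y /and3P[_ _]]].
by rewrite !ffunE eqxx.
Qed.

End Hamiltonian.

Section HamiltonianTorus.
Local Open Scope nat_scope.
Variable q : nat.

Lemma cycle_adj_sym N : symmetric (@cycle_adj N).
Proof. by move=> i j; rewrite /cycle_adj orbC. Qed.

Lemma hamiltonian_cycle N (f : {ffun 'I_N -> 'I_q}) : 2 < N ->
  hamiltonian (@cycle_adj N) f = cut f.
Proof.
move=> N_gt2; apply: double_inj; rewrite hamiltonian_double; last exact: cycle_adj_sym.
have cut_pred : cut f = \sum_i (f (ord_pred i) != f i).
  by rewrite /cut (reindex_inj (@ord_pred_inj N)); apply: eq_bigr => i _; rewrite ord_predK.
rewrite -addnn {2}cut_pred /cut -big_split /=; apply: eq_bigr => i _.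
(* With at least three sites the two neighbours of [i] are distinct and contribute two separate
   terms. *)
have neq : ord_pred i != ordS i.
  apply: contraTneq isT => /(congr1 (@ordS N)); rewrite ord_predK => E.
  have : shift i 0 = shift i 2 by rewrite /= -E.
  by move/shift_inj_mod; rewrite mod0n modn_small.
rewrite (bigD1 (ordS i)) //= (bigD1 (ord_pred i)) //= big1 => [|j /andP[j1 j2]].
  by rewrite /cycle_adj eqxx ord_predK eqxx orbT addn0 [f (ord_pred i) == _]eq_sym.
rewrite /cycle_adj (negbTE j1) /=; case: eqP => //= E; case/eqP: j2.
by rewrite E ordSK.
Qed.

Lemma box_adj_sym (V W : finType) (e : rel V) (f : rel W) :
  symmetric e -> symmetric f -> symmetric (box_adj e f).
Proof.
by move=> es fs x y; rewrite /box_adj es fs eq_sym [x.1 == _]eq_sym.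
Qed.

Lemma hamiltonian_box (V W : finType) (e : rel V) (f : rel W)
    (s : {ffun V * W -> 'I_q}) : symmetric e -> symmetric f ->
  hamiltonian (box_adj e f) s = \sum_w hamiltonian (q := q) e [ffun v => s (v, w)]
    + \sum_v hamiltonian (q := q) f [ffun w => s (v, w)].
Proof.
move=> es fs; apply: double_inj; rewrite doubleD -!muln2 !big_distrl /=.
rewrite muln2 hamiltonian_double; last exact: box_adj_sym.
under [X in _ = X + _]eq_bigr do rewrite muln2 (hamiltonian_double _ es).
under [X in _ = _ + X]eq_bigr do rewrite muln2 (hamiltonian_double _ fs).
rewrite [X in _ = X + _]exchange_big /=.
have sum_pair (F : V * W -> nat) : \sum_p F p = \sum_v \sum_w F (v, w).
  by rewrite pair_bigA; apply: eq_bigr => -[].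
rewrite sum_pair -big_split /=; apply: eq_bigr => v _; rewrite -big_split /=.
apply: eq_bigr => w _.
rewrite sum_pair.
transitivity (\sum_v' \sum_w' ((w' == w) * (e v v' && (s (v, w) != s (v', w)))
   + (v' == v) * (f w w' && (s (v, w) != s (v, w'))))).
  apply: eq_bigr => v' _; apply: eq_bigr => w' _; rewrite /box_adj /=.
  by case: (eqVneq w' w) => [->|_]; case: (eqVneq v' v) => [->|_];
    rewrite ?eqxx ?andbF ?andbT ?orbF ?mul1n ?addn0.
under eq_bigr do rewrite big_split /=.
rewrite big_split /=; congr (_ + _).
  apply: eq_bigr => v' _; rewrite (bigD1 w) //= eqxx mul1n big1 ?addn0 ?ffunE //.
  by move=> w' /negbTE ->.
rewrite (bigD1 v) //= [X in _ + X]big1 ?addn0 => [|v' /negbTE ->]; last by rewrite big1.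
by apply: eq_bigr => w' _; rewrite eqxx mul1n !ffunE.
Qed.

End HamiltonianTorus.

(** * Paths in configuration space *)

Section Reach.
Local Open Scope nat_scope.
Variables (V : finType) (q : nat).
Implicit Types (s z : {ffun V -> 'I_q}) (Pr : {ffun V -> 'I_q} -> Prop).

Lemma config_adjP s z :
  reflect (exists2 x, s x != z x & forall y, y != x -> z y = s y) (config_adj s z).
Proof.
apply: (iffP cards1P) => [[x E]|[x neq same]]; exists x.
- by have := finset.set11 x; rewrite -E inE.
- move=> y; apply: contraNeq => neq.
  by have : y \in [set x]%SET by [rewrite -E inE eq_sym]; rewrite inE.
- apply/setP => y; rewrite !inE; have [->|/same ->] := eqVneq y x; first by [].
  by rewrite eqxx.
Qed.

Lemma config_adj_sym s z : config_adj s z = config_adj z s.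
Proof.
by congr (_ == _); apply: eq_card => x; rewrite !inE eq_sym.
Qed.

Lemma config_adj_bij (g : V -> V) s z : injective g ->
  config_adj [ffun x => s (g x)] [ffun x => z (g x)] = config_adj s z.
Proof.
move=> g_inj; have [g' gK g'K] := injF_bij g_inj.
congr (_ == _); rewrite -[RHS](card_imset _ (can_inj g'K)); apply: eq_card => x.
rewrite !inE !ffunE; apply/idP/imsetP => [neq|[y]].
  by exists (g x); rewrite ?inE ?gK.
by rewrite inE => neq ->; rewrite g'K.
Qed.

Lemma card_bij (g : V -> V) s (p : pred 'I_q) : injective g ->
  #|[set x | p ([ffun x => s (g x)] x)]%SET| = #|[set x | p (s x)]%SET|.
Proof.
move=> g_inj; have [g' gK g'K] := injF_bij g_inj.
rewrite -[RHS](card_imset _ (can_inj g'K)); apply: eq_card => x.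
rewrite !inE !ffunE; apply/idP/imsetP => [px|[y]].
  by exists (g x); rewrite ?inE ?gK.
by rewrite inE => py ->; rewrite g'K.
Qed.

(** Path connection inside [Pr], endpoints included. [nbhd_hat] is of this form, and [reach] can be
    composed and mapped between configuration spaces. *)
Definition reach Pr s z : Prop := exists (T : nat) (w : nat -> {ffun V -> 'I_q}),
  [/\ is_path w T, w 0 = s, w T = z & forall t, t <= T -> Pr (w t)].

Lemma reach_refl Pr s : Pr s -> reach Pr s s.
Proof. by move=> Ps; exists 0, (fun=> s). Qed.

Lemma reach_step Pr s z r : Pr s -> config_adj s z -> reach Pr z r -> reach Pr s r.
Proof.
move=> Ps sz [T [w [wP w0 wT PT]]].
exists T.+1, (fun t => if t is t'.+1 then w t' else s); split=> //.
  by case=> [|t] tT //=; [rewrite w0 | apply: wP].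
by case=> [|t] tT //; apply: PT.
Qed.

Lemma reach_ind Pr s z (Q : {ffun V -> 'I_q} -> Prop) :
  Q z -> (forall x y, Pr x -> Pr y -> config_adj x y -> Q y -> Q x) -> reach Pr s z -> Q s.
Proof.
move=> Qz Qstep [T [w [wP <- wT PT]]]; rewrite -wT in Qz.
suff all t : t <= T -> Q (w (T - t)) by have := all T; rewrite subnn; apply.
elim: t => [|t IHt] tT; first by rewrite subn0.
have E : T - t = (T - t.+1).+1 by lia.
apply: (Qstep _ (w (T - t))); [apply: PT; lia|apply: PT; lia| |apply: IHt; lia].
by rewrite E; apply: wP; lia.
Qed.

Lemma reach_trans Pr s z r : reach Pr s z -> reach Pr z r -> reach Pr s r.
Proof.
move=> sz zr; apply: (reach_ind (Q := fun x => reach Pr x r) zr _ sz).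
by move=> x y Px _ xy; apply: reach_step.
Qed.

Lemma reach_sub Pr Pr' s z : (forall x, Pr x -> Pr' x) -> reach Pr s z -> reach Pr' s z.
Proof. by move=> sub [T [w [wP w0 wT PT]]]; exists T, w; split=> // t /PT/sub. Qed.

(** A path could enter [B] only by a step from an allowed point, which the hypothesis forbids. This
    is how low-energy paths miss isolated gate configurations. *)
Lemma reach_avoid Pr (B : {ffun V -> 'I_q} -> Prop) s z :
  (forall x y, Pr x -> Pr y -> config_adj x y -> ~ B y) ->
  ~ B s -> reach Pr s z -> reach (fun x => Pr x /\ ~ B x) s z.
Proof.
move=> iso nBs [T [w [wP w0 wT PT]]]; exists T, w; split=> // t tT.
split; first exact: PT.
case: t tT => [|t] tT; first by rewrite w0.
by apply: (iso (w t)); [apply: PT; apply: ltnW | apply: PT | apply: wP].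
Qed.

End Reach.

Lemma reach_map (V V' : finType) (q q' : nat)
    (F : {ffun V -> 'I_q} -> {ffun V' -> 'I_q'}) Pr Pr' s z :
  (forall x y, config_adj x y -> config_adj (F x) (F y)) ->
  (forall x, Pr x -> Pr' (F x)) -> reach Pr s z -> reach Pr' (F s) (F z).
Proof.
move=> Fadj FP [T [w [wP <- <- PT]]]; exists T, (F \o w); split=> //.
  by move=> t tT; apply/Fadj/wP.
by move=> t tT; apply/FP/PT.
Qed.

Lemma nbhd_hatE (V : finType) (q : nat) (e : rel V) (c : nat)
    (A B : set {ffun V -> 'I_q}) z :
  nbhd_hat e c A B z <->
  exists2 y, A y & reach (fun s => (hamiltonian e s <= c)%N /\ ~ B s) z y.
Proof.
split=> [[T [w [wP w0 AT PT]]]|[y Ay [T [w [wP w0 wT PT]]]]].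
  by exists (w T) => //; exists T, w.
by exists T, w; split=> //; rewrite wT.
Qed.

(** * Two-dimensional configurations *)

Section TwoDim.
Local Open Scope nat_scope.
Variables (K L q : nat).
Hypotheses (K_gt2 : 2 < K) (L_gt2 : 2 < L).
Local Notation config2 := {ffun 'I_K * 'I_L -> 'I_q}.
Implicit Types (a b c : 'I_q) (eta : config2) (k : 'I_K) (l : 'I_L).

Definition col eta k : 'I_L -> 'I_q := fun l => eta (k, l).
Definition row eta l : 'I_K -> 'I_q := fun k => eta (k, l).

Lemma hamiltonian2E eta :
  hamiltonian2 eta = \sum_l cut (row eta l) + \sum_k cut (col eta k).
Proof.
rewrite /hamiltonian2 /adj2 hamiltonian_box; try exact: cycle_adj_sym.
by congr (_ + _); apply: eq_bigr => i _; rewrite hamiltonian_cycle //;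
  apply: eq_cut => j; rewrite ffunE.
Qed.

Definition two_spin a b eta : Prop := forall x, eta x = a \/ eta x = b.
(** Under this condition the columns alone cost [2 * K], the whole energy of a strip. *)
Definition cols_nonconst eta : Prop := forall k, exists l l', eta (k, l) != eta (k, l').
Definition spin_count a eta : nat := #|[set x | eta x == a]%SET|.

Lemma sum_cols_ge eta : cols_nonconst eta -> 2 * K <= \sum_k cut (col eta k).
Proof.
move=> nc; have -> : 2 * K = \sum_(k < K) 2 by rewrite sum_nat_const card_ord mulnC.
by apply: leq_sum => k _; have [l [l' neq]] := nc k; apply: (@cut_ge2 _ _ _ l l').
Qed.

Lemma sum_rows_ge eta k k' l : eta (k, l) != eta (k', l) -> 2 <= \sum_l cut (row eta l).
Proof.
move=> neq; rewrite (bigD1 l) //=; apply: leq_trans (leq_addr _ _).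
exact: (@cut_ge2 _ _ _ k k').
Qed.

Lemma hamiltonian2_ge_cols eta : cols_nonconst eta -> 2 * K <= hamiltonian2 eta.
Proof. by move/sum_cols_ge => le; rewrite hamiltonian2E (leq_trans le) ?leq_addl. Qed.

Lemma hamiltonian2_ge_row eta k k' l : cols_nonconst eta ->
  eta (k, l) != eta (k', l) -> 2 * K + 2 <= hamiltonian2 eta.
Proof.
move=> /sum_cols_ge le /sum_rows_ge le2.
by rewrite hamiltonian2E addnC leq_add.
Qed.

(** Along each line two spins reduce to a boolean function, whose cut is even. *)
Lemma two_spin_even a b eta : two_spin a b eta -> ~~ odd (hamiltonian2 eta).
Proof.
have even N (f : 'I_N -> 'I_q) : (forall i, f i = a \/ f i = b) -> ~~ odd (cut f).
  move=> fab; suff -> : cut f = cut (fun i => f i == a) by exact: cut_even.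
  apply: eq_bigr => i _; case: (fab i) (fab (ordS i)) => -> [] ->; rewrite ?eqxx ?(eq_sym a b) //;
    by case: (b == a).
move=> ab; rewrite hamiltonian2E oddD.
suff odd_sum (I : finType) (F : I -> nat) : (forall i, ~~ odd (F i)) -> ~~ odd (\sum_i F i).
  by rewrite (negbTE (odd_sum _ _ _)) ?(negbTE (odd_sum _ _ _)) // => i; apply: even => j; apply: ab.
by move=> Fe; elim/big_rec: _ => // i n _; rewrite oddD (negbTE (Fe i)).
Qed.

Lemma two_spin_sym a b eta : two_spin a b eta -> two_spin b a eta.
Proof. by move=> ab x; case: (ab x); [right|left]. Qed.

Lemma two_spin_count a b eta : a != b -> two_spin a b eta ->
  spin_count a eta + spin_count b eta = K * L.
Proof.
move=> neq ab.
have -> : K * L = #|{: 'I_K * 'I_L}| by rewrite card_prod !card_ord.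
rewrite -(cardC [set x | eta x == a]%SET); congr (_ + _).
apply: eq_card => x; rewrite !inE.
by case: (ab x) => ->; rewrite ?eqxx ?(negbTE neq) // eq_sym (negbTE neq).
Qed.

Lemma spin_count_xi a b l v : a != b -> v <= L -> spin_count b (xi K a b l v) = v * K.
Proof.
move=> neq v_le; transitivity #|finset.setX [set: 'I_K]%SET (arc l v)|.
  apply: eq_card => -[k l']; rewrite !inE ffunE /=.
  by case: ifP; rewrite ?eqxx // (negbTE neq).
by rewrite cardsX cardsT card_ord card_arc // mulnC.
Qed.

Lemma spin_count_protuberance a b l v (k : 'I_K) h l' eta : a != b -> v <= L -> h <= K ->
  l' \notin arc l v ->
  (forall x, eta x = if (x.1 \in arc k h) && (x.2 == l') then b else xi K a b l v x) ->
  spin_count b eta = v * K + h.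
Proof.
move=> neq v_le h_le l'_out etaE.
rewrite -(spin_count_xi l neq v_le).
have -> : h = #|finset.setX (arc k h) [set l']%SET| by rewrite cardsX cards1 card_arc // muln1.
rewrite -cardsUI [X in _ = _ + X](_ : _ = 0) ?addn0.
  apply: eq_card => -[k' l'']; rewrite !inE etaE /= ffunE /=.
  case: (boolP ((k' \in _) && _)) => [_|_]; first by rewrite eqxx orbT.
  by rewrite orbF.
apply: eq_card0 => -[k' l'']; rewrite !inE ffunE /=.
by case: (eqVneq l'' l') => [->|_]; rewrite ?andbF // (negbTE l'_out) (negbTE neq).
Qed.

End TwoDim.

(** * Two-spin configurations of energy at most 2K + 2 without a constant column *)

Section StripStructure.
Local Open Scope nat_scope.
Variables (K L q : nat).
Hypotheses (K_gt2 : 2 < K) (L_gt2 : 2 < L).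
Local Notation config2 := {ffun 'I_K * 'I_L -> 'I_q}.
Implicit Types (a b c : 'I_q) (eta : config2) (k : 'I_K) (l : 'I_L).

Lemma two_spin_neq a b eta x : two_spin a b eta -> (eta x != b) -> eta x = a.
Proof. by move=> ab; case: (ab x) => [//|->]; rewrite eqxx. Qed.

Lemma two_spin_arc N (f : 'I_N -> 'I_q) a b i j : (forall x, f x = a \/ f x = b) ->
  f i != f j -> cut f <= 2 ->
  exists (l : 'I_N) (n : nat), 0 < n < N /\ forall x, (f x == b) = (x \in arc l n).
Proof.
move=> fab neq cutf.
apply: (@cut_le2_arc _ (fun x => f x == b) i j); last first.
  exact: leq_trans (cut_le_cut f (pred1 b)) cutf.
move: neq; case: (fab i) (fab j) => -> [] ->; rewrite ?eqxx //.
  by move=> /negbTE ->.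
by rewrite eq_sym => /negbTE ->.
Qed.

Lemma cut_neq0 N (T : eqType) (f : 'I_N -> T) : cut f != 0 -> exists i j, f i != f j.
Proof.
rewrite sum_nat_eq0 negb_forall => /existsP[i /=]; rewrite eqb0 negbK => neq.
by exists i, (ordS i).
Qed.

(* Every column costs at least 2, which leaves at most 2 for all the rows: at most one
   row is nonconstant. *)
Lemma strip_structure a b eta : a != b -> two_spin a b eta -> cols_nonconst eta ->
  hamiltonian2 eta <= 2 * K + 2 ->
  (exists (l : 'I_L) (v : nat), 0 < v < L /\ eta = xi K a b l v) \/
  (exists (l : 'I_L) (v : nat) (k : 'I_K) (h : nat),
    [/\ 0 < h < K, 0 < v, v.+1 < L &
        eta = xi_plus a b l v k h \/ eta = xi_minus a b l v k h]).
Proof.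
move=> neq ab nc; rewrite hamiltonian2E // => H_le; have cols_ge := sum_cols_ge nc.
have col_ge2 k : 2 <= cut (col eta k).
  by have [l [l' ne]] := nc k; apply: (@cut_ge2 _ _ _ l l').
have eta_val x (P : bool) : (eta x == b) = P -> eta x = if P then b else a.
  by case: P => [/eqP|/negbT/(two_spin_neq ab)].
case: (pickP (fun l => cut (row eta l) != 0)) => [l0 row0|rows0]; last first.
  have K_gt0 : 0 < K by lia.
  pose k0 := Ordinal K_gt0.
  have same k l : eta (k, l) = eta (k0, l).
    by have /negbFE/eqP/cut_eq0 := rows0 l; exact.
  have [l [l' ne]] := nc k0.
  have cut2 : cut (col eta k0) <= 2.
    move: H_le; rewrite [X in _ + X](eq_bigr (fun=> cut (col eta k0))); last first.
      by move=> k _; apply: eq_cut => l''; apply: same.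
    by rewrite sum_nat_const card_ord; nia.
  have [l1 [v [v_bd E]]] := @two_spin_arc _ _ a b _ _ (fun l => ab (k0, l)) ne cut2.
  left; exists l1, v; split=> //; apply/ffunP => -[k l'']; rewrite ffunE /= same.
  exact/eta_val/E.
have [k1 [k2 ne12]] := cut_neq0 row0.
have row_ge2 : 2 <= cut (row eta l0) by apply: (@cut_ge2 _ _ _ k1 k2).
move: H_le; rewrite (bigD1 l0) //= => H_le.
have H_le' := leq_trans (leq_add (leqnn _) cols_ge) H_le.
have row_le2 : cut (row eta l0) <= 2 by lia.
have rows0 l : l != l0 -> cut (row eta l) = 0.
  move=> l_neq; have : \sum_(l | l != l0) cut (row eta l) == 0.
    rewrite -leqn0 -(leq_add2l (cut (row eta l0))) -(leq_add2r (2 * K)).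
    by apply: leq_trans H_le' _; lia.
  by rewrite sum_nat_eq0 => /forallP/(_ l)/implyP/(_ l_neq)/eqP.
have same k k' l : l != l0 -> eta (k, l) = eta (k', l).
  by move=> /rows0/cut_eq0; apply.
(* The row [l0] and the other [K - 1] columns already use [2 * K] of the budget [2 * K + 2]. *)
have col_le2 k : cut (col eta k) <= 2.
  have : \sum_(k' | k' != k) 2 <= \sum_(k' | k' != k) cut (col eta k').
    by apply: leq_sum => k' _.
  rewrite sum_nat_const cardC1 card_ord.
  move=> others; move: H_le; rewrite [X in _ + X](bigD1 k) //= => H_le.
  have := leq_trans (leq_add (leqnn _) (leq_add (leqnn _) others)) H_le; nia.
have [k0 [h [h_bd rowE]]] := @two_spin_arc _ _ a b _ _ (fun k => ab (k, l0)) ne12 row_le2.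
(* The column [kout], just past the [b]-arc of row [l0], exhibits the strip; the column [k0]
   exhibits the strip together with [l0]. *)
pose kout := shift k0 h.
have kin_in : k0 \in arc k0 h by rewrite mem_arc offset_self; lia.
have kout_out : kout \notin arc k0 h.
  by rewrite mem_arc offset_shift modn_small; lia.
have [l1 [l2 ne_out]] := nc kout.
have [l [v [v_bd colE]]] :=
  @two_spin_arc _ _ a b _ _ (fun l => ab (kout, l)) ne_out (col_le2 kout).
have l0_out : l0 \notin arc l v by rewrite -colE rowE.
have etaE x : eta x = if (x.1 \in arc k0 h) && (x.2 == l0) then b else xi K a b l v x.
  case: x => k l' /=; rewrite ffunE /=; have [->|l'_neq] := eqVneq l' l0.
    rewrite andbT (negbTE l0_out); exact/eta_val/rowE.
  rewrite andbF (same _ kout) //; exact/eta_val/colE.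
have inE' n : (eta (k0, shift l n) == b) = (shift l n == l0) || (n %% L < v).
  rewrite etaE /= kin_in /= ffunE /= mem_arc offset_shift.
  by case: (_ == l0); case: (_ < v); rewrite /= ?eqxx ?(negbTE neq).
pose j := offset l l0.
have j_lt : j < L := offset_lt l l0.
have j_ge : v <= j by move: l0_out; rewrite mem_arc -leqNgt.
have shift_eq n : n < L -> (shift l n == l0) = (n == j).
  move=> n_lt; apply/eqP/eqP => [E|->]; last exact: shift_offset.
  by rewrite /j -E offset_shift modn_small.
(* If the strip left only the row [l0] free, the column [k0] would be entirely [b]. *)
have v_lt : v.+1 < L.
  have [l3 [l4 ne_in]] := nc k0; rewrite ltn_neqAle; apply/andP; split; last by lia.
  apply: contraNneq ne_in => vL.
  have allb l' : eta (k0, l') = b.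
    apply/eqP; rewrite -(shift_offset l l') inE' shift_eq ?offset_lt //.
    by rewrite modn_small ?offset_lt //; have := offset_lt l l'; lia.
  by rewrite !allb.
right; exists l, v, k0, h; split=> //; first by lia.
have [j_v|j_neqv] := eqVneq j v.
  left; apply/ffunP => x; rewrite ffunE [LHS]etaE; congr (if _ && (_ == _) then _ else _).
  by rewrite -j_v shift_offset.
have [j_L|j_neqL] := eqVneq j L.-1.
  right; apply/ffunP => x; rewrite ffunE [LHS]etaE; congr (if _ && (_ == _) then _ else _).
  have : ordS l0 = l; last by move=> <-; rewrite ordSK.
  by rewrite -(shift_offset l l0) -/j -shiftS j_L prednK ?shift_modulus //; lia.
(* Here [l0] touches neither side of the strip, and the column [k0] changes spin at least three
   times. *)
exfalso; clearbody j.
pose g n := eta (k0, shift l n) == b.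
have cutg : \sum_(0 <= n < L) (g n != g n.+1) <= 2.
  have E : cut (fun l => eta (k0, l) == b) = \sum_(0 <= n < L) (g n != g n.+1).
    exact: cut_shift.
  by rewrite -E; apply: leq_trans (cut_le_cut (col eta k0) (pred1 b)) (col_le2 k0).
have g0 : g 0 by rewrite /g inE' mod0n; lia.
have v_lt' : v < L by lia.
have gv : g v = false by rewrite /g inE' shift_eq // modn_small // eq_sym (negbTE j_neqv) ltnn.
have gj : g j by rewrite /g inE' shift_eq // eqxx.
have j1_lt : j.+1 < L by lia.
have gj1 : g j.+1 = false.
  by rewrite /g inE' shift_eq // modn_small // gtn_eqF //= ltnNge ltnW.
move: cutg; rewrite (big_cat_nat _ (n := v)) //=; last by lia.
rewrite (big_cat_nat _ (n := j) (m := v)) //=; last by lia.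
rewrite (big_cat_nat _ (n := j.+1) (m := j)) //=.
have := @cut_interval _ g 0 v (leq0n _); rewrite g0 gv => /(_ isT).
have := @cut_interval _ g v j j_ge; rewrite gj gv => /(_ isT).
have := @cut_interval _ g j j.+1 (leqnSn _); rewrite gj gj1 => /(_ isT).
lia.
Qed.

End StripStructure.

Arguments Defs.shift : simpl never.

(** * Strips, with or without a partial row attached *)

Section Bands.
Local Open Scope nat_scope.
Variables (K L q : nat).
Hypotheses (K_gt2 : 2 < K) (L_gt5 : 5 < L).
Local Notation config2 := {ffun 'I_K * 'I_L -> 'I_q}.
Implicit Types (a b c : 'I_q) (eta : config2) (k : 'I_K) (l : 'I_L).

Let L_gt2 : 2 < L. Proof. exact: leq_trans L_gt5. Qed.

Definition bandR a b v eta : Prop := exists l, eta = xi K a b l v.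
Definition bandQ a b v eta : Prop := exists l k h, 1 <= h <= K - 1 /\
  (eta = xi_plus a b l v k h \/ eta = xi_minus a b l v k h).
(** [B2] without the transposes: arguments are given for strips along the first coordinate and
    carried over by [tr] when [K = L]. *)
Definition band a b eta : Prop :=
  (exists2 v, 2 <= v <= L - 2 & bandR a b v eta) \/
  (exists2 v, 2 <= v <= L - 3 & bandQ a b v eta).

(** A robust form of [cols_nonconst]: no single flip can make a column constant. The width bounds of
    [band] provide it. *)
Definition fat a b eta : Prop := forall k,
  (exists l l', [/\ l != l', eta (k, l) = a & eta (k, l') = a]) /\
  (exists l l', [/\ l != l', eta (k, l) = b & eta (k, l') = b]).

Definition third a b eta : nat := #|[set x | (eta x != a) && (eta x != b)]%SET|.

Lemma shift_neq l m n : m < n < L -> shift l m != shift l n.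
Proof.
move=> mn; apply: contraTneq isT => /shift_inj_mod; rewrite !modn_small; lia.
Qed.

Lemma bandR_two_spin a b v eta : bandR a b v eta -> two_spin a b eta.
Proof. by case=> l -> x; rewrite ffunE; case: ifP; [right|left]. Qed.

Lemma bandQ_two_spin a b v eta : bandQ a b v eta -> two_spin a b eta.
Proof.
case=> l [k [h [_ [] -> x]]]; rewrite !ffunE;
  by case: ifP => _; [right | case: ifP; [right|left]].
Qed.

Lemma band_two_spin a b eta : band a b eta -> two_spin a b eta.
Proof. by case=> -[v _]; [apply: bandR_two_spin | apply: bandQ_two_spin]. Qed.

Lemma bandR_fat a b v eta : 2 <= v <= L - 2 -> bandR a b v eta -> fat a b eta.
Proof.
move=> v_bd [l ->] k; split.
  exists (shift l v), (shift l v.+1); rewrite shift_neq; last by lia.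
  by rewrite !ffunE /= !mem_arc !offset_shift !modn_small ?ifF; try (by split); lia.
exists (shift l 0), (shift l 1); rewrite shift_neq; last by lia.
by rewrite !ffunE /= !mem_arc (@offset_shift _ l 0) (@offset_shift _ l 1) !modn_small ?ifT; try (by split); lia.
Qed.

Lemma ord_predE l : ord_pred l = shift l L.-1.
Proof.
apply: ordS_inj; rewrite ord_predK -shiftS prednK ?shift_modulus //.
by lia.
Qed.

Lemma shift_eqE l m n : m < L -> n < L -> (shift l m == shift l n) = (m == n).
Proof.
move=> m_lt n_lt; apply/eqP/eqP => [/shift_inj_mod|-> //].
by rewrite !modn_small.
Qed.

Lemma bandQ_fat a b v eta : 2 <= v <= L - 3 -> bandQ a b v eta -> fat a b eta.
Proof.
have arcE l n m : n < L -> (shift l n \in arc l m) = (n < m).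
  by move=> n_lt; rewrite mem_arc offset_shift modn_small.
move=> v_bd [l [k0 [h [_ [] ->]]]] k; split.
- exists (shift l v.+1), (shift l v.+2); rewrite shift_neq; last by lia.
  by rewrite !ffunE /= !arcE ?shift_eqE ?ifF; try (by split); lia.
- exists (shift l 0), (shift l 1); rewrite shift_neq; last by lia.
  by rewrite !ffunE /= !(@arcE l 0) ?(@arcE l 1); (try lia);
    rewrite !(ifT _ _ (_ : _ < v)); [split; rewrite // if_same|lia|lia].
- exists (shift l v), (shift l v.+1); rewrite shift_neq; last by lia.
  by rewrite !ffunE /= ord_predE !arcE ?shift_eqE ?ifF; try (by split); lia.
- exists (shift l 0), (shift l 1); rewrite shift_neq; last by lia.
  by rewrite !ffunE /= !(@arcE l 0) ?(@arcE l 1); (try lia);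
    rewrite !(ifT _ _ (_ : _ < v)); [split; rewrite // if_same|lia|lia].
Qed.

Lemma band_fat a b eta : band a b eta -> fat a b eta.
Proof. by case=> -[v v_bd]; [apply: bandR_fat | apply: bandQ_fat]. Qed.

Lemma fat_nonconst a b eta : a != b -> fat a b eta -> cols_nonconst eta.
Proof.
move=> neq f k; have [[l [_ [_ la _]]] [l' [_ [_ lb _]]]] := f k.
by exists l, l'; rewrite la lb.
Qed.

Lemma fat_adj_nonconst a b eta eta' : a != b -> fat a b eta -> config_adj eta eta' ->
  cols_nonconst eta'.
Proof.
move=> neq f /config_adjP[x _ same] k.
have survive c : (exists l l', [/\ l != l', eta (k, l) = c & eta (k, l') = c]) ->
    exists l, eta' (k, l) = c.
  move=> [l [l' [ll' lc l'c]]].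
  have [E|ne] := eqVneq (k, l) x; last by exists l; rewrite same.
  exists l'; rewrite same // -E xpair_eqE eqxx /= eq_sym; exact: ll'.
have [/survive[l la] /survive[l' lb]] := f k.
by exists l, l'; rewrite la lb.
Qed.

Lemma spin_count_bandR a b v eta : a != b -> v <= L -> bandR a b v eta ->
  spin_count b eta = v * K.
Proof. by move=> neq v_le [l ->]; exact: spin_count_xi. Qed.

Lemma spin_count_bandQ a b v eta : a != b -> v < L -> bandQ a b v eta ->
  v * K < spin_count b eta < v.+1 * K.
Proof.
move=> neq v_lt [l [k [h [h_bd etaE]]]].
suff -> : spin_count b eta = v * K + h by rewrite mulSn; lia.
case: etaE => ->.
  apply: (@spin_count_protuberance _ _ _ a b l v k h (shift l v)) => //; try lia.
    by rewrite mem_arc offset_shift modn_small // ltnn.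
  by move=> x; rewrite ffunE.
apply: (@spin_count_protuberance _ _ _ a b l v k h (ord_pred l)) => //; try lia.
  by rewrite ord_predE mem_arc offset_shift modn_small; lia.
by move=> x; rewrite ffunE.
Qed.

Lemma spin_count_adj c eta eta' : config_adj eta eta' ->
  spin_count c eta' <= (spin_count c eta).+1.
Proof.
move=> /config_adjP[x _ same].
apply: (@leq_trans #|(x |: [set y | eta y == c])%SET|).
  apply/subset_leq_card/fintype.subsetP => y; rewrite !inE.
  by have [//|/same ->] := eqVneq y x.
by rewrite cardsU1; case: (_ \notin _).
Qed.

Lemma hamiltonian2_bandR a b v eta : bandR a b v eta -> hamiltonian2 eta <= 2 * K.
Proof.
move=> [l ->]; rewrite hamiltonian2E // big1 => [|l' _].
  have -> : 2 * K = \sum_(k < K) 2 by rewrite sum_nat_const card_ord mulnC.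
  rewrite add0n.
  apply: leq_sum => k _; apply: leq_trans (cut_arc l v).
  rewrite (eq_cut (g := (fun t : bool => if t then b else a) \o (fun l' => l' \in arc l v))).
    exact: cut_le_cut.
  by move=> l'; rewrite /col ffunE.
by rewrite /cut big1 // => k _; rewrite /row !ffunE eqxx.
Qed.

Lemma hamiltonian2_bandQ a b v eta : a != b -> v.+1 < L -> cols_nonconst eta ->
  bandQ a b v eta -> 2 * K + 2 <= hamiltonian2 eta.
Proof.
move=> neq v_bd nc Q; have [l [k [h [h_bd etaE]]]] := Q.
have k_in : k \in arc k h by rewrite mem_arc offset_self; lia.
have k_out : shift k h \notin arc k h by rewrite mem_arc offset_shift modn_small; lia.
case: etaE => etaE.
  apply: (@hamiltonian2_ge_row _ _ _ _ _ _ k (shift k h) (shift l v)) => //.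
  rewrite etaE !ffunE /= k_in (negbTE k_out) eqxx /= mem_arc offset_shift modn_small; last by lia.
  by rewrite ltnn eq_sym.
apply: (@hamiltonian2_ge_row _ _ _ _ _ _ k (shift k h) (ord_pred l)) => //.
rewrite etaE !ffunE /= k_in (negbTE k_out) eqxx /= ord_predE mem_arc offset_shift modn_small; last by lia.
by rewrite ifF 1?eq_sym //; lia.
Qed.

(** The number of [b] spins controls the width: its bounds rule out strips of width 1 and [L - 1],
    and protuberances on strips of width 1 and [L - 2]. *)
Lemma band_structure a b eta : a != b -> two_spin a b eta -> cols_nonconst eta ->
  hamiltonian2 eta <= 2 * K + 2 -> 2 * K <= spin_count b eta <= (L - 2) * K ->
  band a b eta.
Proof.
move=> neq ab nc H_le cnt.
case: (strip_structure K_gt2 L_gt2 neq ab nc H_le).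
  move=> [l [v [v_bd etaE]]]; left; exists v; last by exists l.
  by move: cnt; rewrite etaE spin_count_xi ?leq_mul2r; lia.
move=> [l [v [k [h [h_bd v_gt v_lt etaE]]]]].
have Q : bandQ a b v eta by exists l, k, h; split=> //; lia.
right; exists v => //.
have /andP[c1 c2] := spin_count_bandQ neq (ltnW v_lt) Q.
have : 2 * K < v.+1 * K by lia.
have : v * K < (L - 2) * K by lia.
by rewrite !ltn_mul2r; lia.
Qed.

(** [strip_structure] with the spins exchanged replaces a computation with complements of arcs; the
    spin count, a multiple of [K], excludes a protuberance. *)
Lemma bandR_swap a b v eta : a != b -> 0 < v < L -> cols_nonconst eta ->
  bandR a b v eta -> bandR b a (L - v) eta.
Proof.
move=> neq v_bd nc R; have ab := bandR_two_spin R.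
have cnt : spin_count a eta = (L - v) * K.
  have := two_spin_count neq ab; rewrite (spin_count_bandR neq _ R); last by lia.
  by rewrite mulnBl; lia.
have H_le : hamiltonian2 eta <= 2 * K + 2 by have := hamiltonian2_bandR R; lia.
rewrite eq_sym in neq.
case: (strip_structure K_gt2 L_gt2 neq (two_spin_sym ab) nc H_le).
  move=> [l [v' [v'_bd etaE]]]; exists l.
  suff -> : L - v = v' by [].
  have : (L - v) * K = v' * K by rewrite -cnt etaE spin_count_xi //; lia.
  by move/eqP; rewrite eqn_pmul2r; [move/eqP | lia].
move=> [l [v' [k [h [h_bd v'_gt v'_lt etaE]]]]].
have Q : bandQ b a v' eta by exists l, k, h; split=> //; lia.
have := spin_count_bandQ neq (ltnW v'_lt) Q.
by rewrite cnt !ltn_mul2r; lia.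
Qed.

Lemma third_eq0 a b eta : third a b eta = 0 -> two_spin a b eta.
Proof.
move=> E x; have := card0_eq E x; rewrite !inE.
by case: (eqVneq (eta x) a) => [|_]; [left | case: (eqVneq (eta x) b) => [|]; [right|]].
Qed.

Lemma two_spin_third a b eta : two_spin a b eta -> third a b eta = 0.
Proof.
by move=> ab; apply: eq_card0 => x; rewrite !inE; case: (ab x) => ->; rewrite eqxx ?andbF.
Qed.

Lemma third_neq0 a b eta : third a b eta != 0 -> exists2 x, eta x != a & eta x != b.
Proof.
by rewrite -lt0n => /card_gt0P[x]; rewrite inE => /andP[? ?]; exists x.
Qed.

End Bands.

Lemma hamiltonian_le (V : finType) (q : nat) (e : rel V) (s z : {ffun V -> 'I_q}) :
  (forall x y, s x != s y -> z x != z y) -> (hamiltonian e s <= hamiltonian e z)%N.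
Proof.
move=> le; apply/subset_leq_card/fintype.subsetP => E; rewrite !inE.
case/existsP => x /existsP[y /and3P[E_eq exy sxy]]; apply/existsP; exists x.
by apply/existsP; exists y; rewrite E_eq exy le.
Qed.

(** * Transposition of square configurations *)

Section Transpose.
Local Open Scope nat_scope.
Variables (K q : nat).
Local Notation config2 := {ffun 'I_K * 'I_K -> 'I_q}.
Implicit Types (a b c : 'I_q) (eta : config2).

Definition flip2 (x : 'I_K * 'I_K) : 'I_K * 'I_K := (x.2, x.1).
Definition tr eta : config2 := [ffun x => eta (flip2 x)].

Lemma flip2K : involutive flip2. Proof. by case. Qed.

Lemma trK : involutive tr.
Proof. by move=> eta; apply/ffunP => x; rewrite !ffunE flip2K. Qed.

Lemma transpose_ofE eta eta' : transpose_of eta eta' <-> eta' = tr eta.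
Proof.
split=> [H|-> [k l] [k' l'] /= /val_inj -> /val_inj ->]; last by rewrite ffunE.
by apply/ffunP => x; rewrite ffunE; apply: H.
Qed.

Lemma hamiltonian2_tr eta : hamiltonian2 (tr eta) = hamiltonian2 eta.
Proof.
apply: hamiltonian_bij; last 1 first.
- move=> [k l] [k' l']; rewrite /adj2 /box_adj /= orbC.
  by rewrite [_ && (l == l')]andbC [(k == k') && _]andbC.
- by apply: box_adj_sym; apply: cycle_adj_sym.
- exact: inv_inj flip2K.
Qed.

Lemma config_adj_tr eta eta' : config_adj (tr eta) (tr eta') = config_adj eta eta'.
Proof. exact: (config_adj_bij _ _ (inv_inj flip2K)). Qed.

Lemma two_spin_tr a b eta : two_spin a b eta -> two_spin a b (tr eta).
Proof. by move=> ab x; rewrite ffunE. Qed.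

Lemma third_tr a b eta : third a b (tr eta) = third a b eta.
Proof. exact: (card_bij _ (fun c => (c != a) && (c != b)) (inv_inj flip2K)). Qed.

Lemma with_transposeE (A : set config2) eta :
  with_transpose A eta <-> A eta \/ A (tr eta).
Proof.
split=> [[?|[_ [eta0 A0 /transpose_ofE ->]]]|[?|A']].
- by left.
- by right; rewrite trK.
- by left.
- by right; split=> //; exists (tr eta) => //; apply/transpose_ofE; rewrite trK.
Qed.

Lemma with_transpose_tr (A : set config2) eta :
  with_transpose A eta -> with_transpose A (tr eta).
Proof. by rewrite !with_transposeE trK => -[]; [right|left]. Qed.

Lemma BGamma2_tr a b eta : BGamma2 a b eta -> BGamma2 a b (tr eta).
Proof. by move=> [v v_bd Q]; exists v => //; apply: with_transpose_tr. Qed.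

Lemma BGamma2_all_tr eta : BGamma2_all eta -> BGamma2_all (tr eta).
Proof. by move=> [a [b [neq B]]]; exists a, b; split=> //; apply: BGamma2_tr. Qed.

Lemma G2_tr a b eta : G2 a b eta -> G2 a b (tr eta).
Proof.
have Z2_tr c d : Z2 c d eta -> Z2 c d (tr eta).
  move=> [T [w [T_gt wP nB [R0 wT] HT]]]; exists T, (tr \o w); split=> //.
  - by move=> t tT; rewrite /= config_adj_tr; apply: wP.
  - by move=> t /nB nBt /BGamma2_all_tr; rewrite trK.
  - by split; [apply: with_transpose_tr | rewrite /= wT].
  - by move=> t /HT <-; rewrite /= hamiltonian2_tr.
move=> [[Z|[B|[v v_bd R]]]|Z].
- by left; left; apply: Z2_tr.
- by left; right; left; apply: BGamma2_tr.
- by left; right; right; exists v => //; apply: with_transpose_tr.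
- by right; apply: Z2_tr.
Qed.

End Transpose.

(** * Leaving the two-dimensional gate set *)

Section GateExit.
Local Open Scope nat_scope.
Variables (K L q : nat).
Hypotheses (K_gt2 : 2 < K) (L_gt5 : 5 < L).
Local Notation config2 := {ffun 'I_K * 'I_L -> 'I_q}.
Implicit Types (a b c : 'I_q) (eta : config2).

Let L_gt2 : 2 < L. Proof. exact: leq_trans L_gt5. Qed.

Lemma band_B2 a b eta : band a b eta -> B2 a b eta.
Proof. by case=> -[v v_bd bnd]; [right|left]; exists v => //; left. Qed.

(** Reduces a property of [B2] to plain strips. The transposed case keeps [K = L] as a hypothesis
    because [tr] is typed only after [L] has been replaced by [K]. *)
Lemma B2_inv (Pr : config2 -> Prop) a b :
  (forall eta, band a b eta -> Pr eta) ->
  (forall eta eta', K = L -> transpose_of eta eta' -> band a b eta -> Pr eta -> Pr eta') ->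
  forall eta, B2 a b eta -> Pr eta.
Proof.
move=> Pband Ptr eta [[v v_bd [Q|[KL [eta0 Q tr0]]]]|[v v_bd [R|[KL [eta0 R tr0]]]]].
- by apply: Pband; right; exists v.
- have bnd : band a b eta0 by right; exists v.
  exact: Ptr tr0 bnd (Pband _ bnd).
- by apply: Pband; left; exists v.
- have bnd : band a b eta0 by left; exists v.
  exact: Ptr tr0 bnd (Pband _ bnd).
Qed.

(** Paths of [Z2] avoid the strips of every pair of spins. When only [a] and [b] occur, the pair is
    [(a, b)] or [(b, a)], and in the second case the spin count gives back [B2 a b] through
    [band_structure]. *)
Lemma BGamma2_all_gate a b eta : a != b -> two_spin a b eta -> BGamma2_all eta ->
  hamiltonian2 eta <= 2 * K + 2 -> B2 a b eta.
Proof.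
have plain a' b' eta' v : a != b -> two_spin a b eta' -> a' != b' -> 2 <= v <= L - 3 ->
    bandQ a' b' v eta' -> hamiltonian2 eta' <= 2 * K + 2 -> band a b eta'.
  move=> neq ab neq' v_bd Q H_le; have f := bandQ_fat K_gt2 L_gt5 v_bd Q.
  have k0 : 'I_K by apply: (Ordinal (n := K) (m := 0)); lia.
  have [[l1 [_ [_ e1 _]]] [l2 [_ [_ e2 _]]]] := f k0.
  have := ab (k0, l1); have := ab (k0, l2); rewrite e1 e2 => eb ea.
  have [ea'|ne] := eqVneq a' a.
    have eb' : b' = b by case: eb => // eb; rewrite ea' eb eqxx in neq'.
    by rewrite -ea' -eb'; right; exists v.
  have ea' : a' = b by case: ea => // ea; rewrite ea eqxx in ne.
  have eb' : b' = a by case: eb => // eb; rewrite ea' eb eqxx in neq'.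
  rewrite ea' eb' in Q neq' f; apply: band_structure => //; first exact: fat_nonconst f.
  have v_lt : v < L by lia.
  have := spin_count_bandQ K_gt2 L_gt5 neq' v_lt Q; have := two_spin_count neq ab.
  (* Products with the variable width are expanded so that the bounds on the counts become
     linear. *)
  have E : L * K = (L - v - 3) * K + v.+1 * K + 2 * K by rewrite -!mulnDl; congr (_ * _); lia.
  have E2 : (L - 2) * K = (L - v - 3) * K + v.+1 * K by rewrite -mulnDl; congr (_ * _); lia.
  have E3 : v * K = (v - 2) * K + 2 * K by rewrite -mulnDl; congr (_ * _); lia.
  have E4 : v.+1 * K = K + v * K by rewrite mulSn.
  rewrite (mulnC K L).
  have := leq0n ((L - v - 3) * K); have := leq0n ((v - 2) * K).
  by move: E E2 E3 E4; lia.
move=> neq ab [a' [b' [neq' [v /= v_bd [Q|[KL [eta0 Q tr0]]]]]]] H_le.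
  by apply: band_B2; apply: plain neq' v_bd Q H_le.
subst L; move/transpose_ofE in tr0; subst eta; rewrite hamiltonian2_tr in H_le.
have bnd : band a b eta0.
  by apply: plain neq' v_bd Q H_le => //; rewrite -[eta0]trK; apply: two_spin_tr.
by case: bnd => -[w w_bd bnd]; [right|left]; exists w => //; right; split=> //;
  exists eta0 => //; apply/transpose_ofE.
Qed.

Definition settled a b eta : Prop :=
  two_spin a b eta /\ hamiltonian2 eta <= 2 * K \/ G2 a b eta.

(** Parity excludes the energy [2 * K + 1]. *)
Lemma two_spin_settled a b eta : two_spin a b eta -> hamiltonian2 eta <= 2 * K + 2 ->
  (hamiltonian2 eta = 2 * K + 2 -> G2 a b eta) -> settled a b eta.
Proof.
move=> ab H_le top; have [E|ne] := eqVneq (hamiltonian2 eta) (2 * K + 2).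
  by right; apply: top.
by left; split=> //; have := two_spin_even K_gt2 L_gt2 ab; lia.
Qed.

Lemma BGamma2_all_ge eta : BGamma2_all eta -> 2 * K + 2 <= hamiltonian2 eta.
Proof.
move=> [a [b [neq [v /= v_bd [Q|[KL [eta0 Q tr0]]]]]]].
  apply: (hamiltonian2_bandQ _ _ _ _ _ Q) => //; first by lia.
  exact: fat_nonconst neq (bandQ_fat K_gt2 L_gt5 v_bd Q).
subst L; move/transpose_ofE in tr0; subst eta; rewrite hamiltonian2_tr.
apply: (hamiltonian2_bandQ _ _ _ _ _ Q) => //; first by lia.
exact: fat_nonconst neq (bandQ_fat K_gt2 L_gt5 v_bd Q).
Qed.

(** One flip changes the number of [b] spins by at most one. At the top level this keeps the count
    in the range of [band_structure], except next to strips of width 2 and [L - 2], which are the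
    starting points of [Z2 a b] and [Z2 b a]. *)
Lemma band_exit a b eta eta' : a != b -> band a b eta -> config_adj eta eta' ->
  hamiltonian2 eta' + third a b eta' <= 2 * K + 2 -> settled a b eta'.
Proof.
move=> neq bnd adj H_le.
have nc := fat_adj_nonconst neq (band_fat K_gt2 L_gt5 bnd) adj.
have ab := band_two_spin bnd.
(* A third spin makes its row nonconstant while all columns are nonconstant: energy [2 * K + 2], and
   [third] exceeds the bound. *)
have ab' : two_spin a b eta'.
  apply: third_eq0; apply/eqP; apply: contraTT H_le => t_neq0.
  have [[k l] xa xb] := third_neq0 t_neq0.
  have [y _ same] := config_adjP _ _ adj.
  have Ey : (k, l) = y.
    apply/eqP; apply: contraTT isT => /same E.
    by case: (ab (k, l)) xa xb => <-; rewrite E eqxx.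
  have neqS : ordS k != k by rewrite ordS_neq //; lia.
  have : 2 * K + 2 <= hamiltonian2 eta'.
    apply: (@hamiltonian2_ge_row _ _ _ _ _ _ k (ordS k) l) => //.
    rewrite [eta' (ordS k, l)]same -?Ey ?xpair_eqE ?eqxx ?andbT //.
    by case: (ab (ordS k, l)) => ->.
  by rewrite -ltnNge; lia.
rewrite two_spin_third // addn0 in H_le.
apply: two_spin_settled => // H_eq.
have cnt1 := spin_count_adj b adj.
have cnt2 := spin_count_adj b (etrans (config_adj_sym _ _) adj).
have by_count m : 2 <= m -> m.+1 <= L - 2 -> m * K <= spin_count b eta' <= m.+1 * K -> G2 a b eta'.
  move=> m_ge m_le m_bd; left; right; apply: band_B2; apply: band_structure => //.
  have : 2 * K <= m * K by rewrite leq_mul2r m_ge orbT.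
  have : m.+1 * K <= (L - 2) * K by rewrite leq_mul2r m_le orbT.
  lia.
case: bnd => -[v v_bd bnd]; last first.
  apply: (by_count v); [lia|lia|].
  have v_lt : v < L by lia.
  have := spin_count_bandQ K_gt2 L_gt5 neq v_lt bnd; lia.
have R_H := hamiltonian2_bandR K_gt2 L_gt5 bnd.
(* A single step from a strip of width 2 up to energy [2 * K + 2] is already a path as required by
   [Z2]. *)
have start c d : bandR c d 2 eta -> Z2 c d eta' \/ B2 a b eta'.
  move=> R2cd; have [all'|nall'] := pselect (BGamma2_all eta').
    by right; apply: BGamma2_all_gate all' _; rewrite // H_eq.
  left; exists 1, (fun t => if t is 0 then eta else eta'); split=> //.
  - by case.
  - case=> [_ /BGamma2_all_ge|t _ //]; first by lia.
  - by split=> //; left.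
  - by case.
have [v2|v_neq2] := eqVneq v 2.
  by subst v; case: (start _ _ bnd) => [Z|B]; left; [left|right].
have [vL|v_neqL] := eqVneq v (L - 2).
  have nc0 := fat_nonconst neq (bandR_fat K_gt2 L_gt5 v_bd bnd).
  have v_bd' : 0 < v < L by lia.
  have := bandR_swap K_gt2 L_gt5 neq v_bd' nc0 bnd; rewrite vL subKn; last by lia.
  by case/start => [Z|B]; [right|left; right].
have cnt : spin_count b eta = v * K by apply: spin_count_bandR bnd; rewrite //; lia.
have Ev : v * K = K + v.-1 * K by rewrite -mulSn; congr (_ * _); lia.
have [le|gt] := leqP (spin_count b eta') (v * K).
  by apply: (by_count v.-1); rewrite ?prednK; lia.
by apply: (by_count v); rewrite ?mulSn; lia.
Qed.

Lemma Z2_exit a b eta eta' : a != b -> Z2 a b eta -> two_spin a b eta ->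
  config_adj eta eta' -> hamiltonian2 eta' + third a b eta' <= 2 * K + 2 ->
  [/\ two_spin a b eta', hamiltonian2 eta' <= 2 * K + 2 &
      hamiltonian2 eta' = 2 * K + 2 -> BGamma2_all eta' \/ Z2 a b eta'].
Proof.
move=> neq [T [w [T_gt wP nB [R0 wT] HT]]] ab adj H_le.
have H_eta : hamiltonian2 eta = 2 * K + 2.
  by rewrite -wT HT ?T_gt ?leqnn // /Gamma2.
(* A third spin at the flipped site disagrees with all its neighbours, so the energy stays at least
   [2 * K + 2] and [third] exceeds the bound. *)
have ab' : two_spin a b eta'.
  apply: third_eq0; apply/eqP; apply: contraTT H_le => t_neq0.
  have [x xa xb] := third_neq0 t_neq0.
  have [y _ same] := config_adjP _ _ adj.
  have Ey : x = y.
    apply/eqP; apply: contraTT isT => /same E.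
    by case: (ab x) xa xb => <-; rewrite E eqxx.
  suff : hamiltonian2 eta <= hamiltonian2 eta' by rewrite -ltnNge H_eta; lia.
  apply: hamiltonian_le => u v uv; subst y.
  have [ux|/same eu] := eqVneq u x; have [vx|/same ev] := eqVneq v x.
  - by rewrite ux vx eqxx in uv.
  - by rewrite ux ev; case: (ab v) => ->.
  - by rewrite vx eu eq_sym; case: (ab u) => ->.
  - by rewrite eu ev.
rewrite two_spin_third // addn0 in H_le; split=> // H_eq.
have [all'|nall'] := pselect (BGamma2_all eta'); [by left|right].
exists T.+1, (fun t => if t <= T then w t else eta'); split=> //.
- move=> t; rewrite ltnS => tT; rewrite tT; case: ltnP => [lt|ge]; first exact: wP.
  have -> : t = T by lia.
  by rewrite wT.
- by move=> t tT; case: ifP => [/nB|].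
- by split; [rewrite leq0n | rewrite ltnn].
- by move=> t t_bd; case: ifP => [tT|_]; [apply: HT; lia | rewrite H_eq].
Qed.

End GateExit.

Section GateExitTransposed.
Local Open Scope nat_scope.
Variables (K L q : nat).
Hypotheses (K_gt2 : 2 < K) (L_gt5 : 5 < L).
Local Notation config2 := {ffun 'I_K * 'I_L -> 'I_q}.
Implicit Types (a b c : 'I_q) (eta : config2).

Let L_gt2 : 2 < L. Proof. exact: leq_trans L_gt5. Qed.

(** The sum [hamiltonian2 + third] is the share of the three-dimensional energy that falls to the
    special slice. Transposed strips and [Z2 b a] reduce to [band_exit] and [Z2_exit] by
    symmetry. *)
Lemma gate_exit a b eta eta' : a != b -> G2 a b eta -> config_adj eta eta' ->
  hamiltonian2 eta + third a b eta <= 2 * K + 2 ->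
  hamiltonian2 eta' + third a b eta' <= 2 * K + 2 -> settled a b eta'.
Proof.
have Z_two c d : Z2 c d eta -> hamiltonian2 eta + third a b eta <= 2 * K + 2 -> two_spin a b eta.
  move=> [T [w [T_gt _ _ [_ wT] HT]]].
  have -> : hamiltonian2 eta = 2 * K + 2 by rewrite -wT HT ?T_gt ?leqnn.
  by move=> le; apply: third_eq0; lia.
have gate : a != b -> two_spin a b eta' -> hamiltonian2 eta' = 2 * K + 2 -> BGamma2_all eta' -> G2 a b eta'.
  by move=> neq ab H_eq all'; left; right; apply: BGamma2_all_gate => //; rewrite H_eq.
move=> neq [[Z|B]|Z] adj H_le H_le'.
- have [ab' le top] := Z2_exit K_gt2 L_gt5 neq Z (Z_two _ _ Z H_le) adj H_le'.
  apply: two_spin_settled => // H_eq; case: (top H_eq) => [|Z']; first exact: gate.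
  by left; left.
- pose Pr (e : config2) := forall e', config_adj e e' ->
    hamiltonian2 e' + third a b e' <= 2 * K + 2 -> settled a b e'.
  suff : Pr eta by apply.
  apply: (B2_inv (Pr := Pr) _ _ B) => [e bnd e' adj' H'|].
    exact: (band_exit K_gt2 L_gt5 neq bnd adj' H').
  move=> {eta eta' Z_two gate B adj H_le H_le'} e e1 KL; move: e e1; subst L => e e1 /transpose_ofE -> bnd _ e' adj H_le'.
  suff : settled a b (tr e').
    case=> [[ab H]|G]; last by right; rewrite -[e']trK; apply: G2_tr.
    by left; split; [rewrite -[e']trK; apply: two_spin_tr | rewrite -hamiltonian2_tr].
  apply: (band_exit K_gt2 L_gt5 neq bnd); first by rewrite -[e]trK config_adj_tr.
  by rewrite hamiltonian2_tr third_tr.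
- have neq' : b != a by rewrite eq_sym.
  have third_sym : third a b eta' = third b a eta'.
    by apply: eq_card => x; rewrite !inE andbC.
  rewrite third_sym in H_le'.
  have [/two_spin_sym ab' le top] := Z2_exit K_gt2 L_gt5 neq' Z (two_spin_sym (Z_two _ _ Z H_le)) adj H_le'.
  apply: two_spin_settled => // H_eq; case: (top H_eq) => [|Z']; first exact: gate.
  by right.
Qed.

Lemma B2_nonconst_ge a b eta : a != b -> B2 a b eta -> 2 * K <= hamiltonian2 eta.
Proof.
move=> neq; apply: (B2_inv (Pr := fun e => 2 * K <= hamiltonian2 e)).
  by move=> e /(band_fat K_gt2 L_gt5)/(fat_nonconst neq)/(hamiltonian2_ge_cols K_gt2 L_gt2).
by move=> e e' KL; move: e e'; subst L => e e' /transpose_ofE -> _; rewrite hamiltonian2_tr.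
Qed.

Lemma G2_ge a b eta : a != b -> G2 a b eta -> 2 * K <= hamiltonian2 eta.
Proof.
have Z_ge c d : Z2 c d eta -> 2 * K <= hamiltonian2 eta.
  move=> [T [w [T_gt _ _ [_ wT] HT]]].
  by rewrite -wT HT ?T_gt ?leqnn // /Gamma2; lia.
by move=> neq [[/Z_ge//|/(B2_nonconst_ge neq)//]|/Z_ge//].
Qed.

(** At energy [2 * K] only strips and their transposes remain; a flip in a strip makes one row
    nonconstant while all columns stay nonconstant. *)
Lemma G2_isolated a b eta eta' : a != b -> G2 a b eta -> hamiltonian2 eta <= 2 * K ->
  config_adj eta eta' -> 2 * K + 2 <= hamiltonian2 eta'.
Proof.
have Z_ge c d : Z2 c d eta -> hamiltonian2 eta <= 2 * K -> False.
  move=> [T [w [T_gt _ _ [_ wT] HT]]].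
  by rewrite -wT HT ?T_gt ?leqnn // /Gamma2; lia.
move=> neq [[Z|B]|Z] H_le; try by [case: (Z_ge _ _ Z H_le)].
move: B eta' H_le {Z_ge}.
apply: (B2_inv (Pr := fun e => forall e', hamiltonian2 e <= 2 * K ->
  config_adj e e' -> 2 * K + 2 <= hamiltonian2 e')) => [e bnd e' H_le adj|]; last first.
  move=> {eta} e e1 KL; move: e e1; subst L => e e1 /transpose_ofE -> _ IH e'.
  rewrite hamiltonian2_tr -(hamiltonian2_tr e') => H_le adj.
  by apply: IH => //; rewrite -[e]trK config_adj_tr.
have nc := fat_adj_nonconst neq (band_fat K_gt2 L_gt5 bnd) adj.
case: bnd => -[v v_bd bnd]; last first.
  suff : 2 * K + 2 <= hamiltonian2 e by lia.
  apply: (hamiltonian2_bandQ _ _ _ _ _ bnd) => //; first by lia.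
  exact: fat_nonconst neq (bandQ_fat K_gt2 L_gt5 v_bd bnd).
have [[k l] x_neq same] := config_adjP _ _ adj.
have neqS : ordS k != k by rewrite ordS_neq //; lia.
apply: (@hamiltonian2_ge_row _ _ _ _ _ _ k (ordS k) l) => //.
rewrite [e' (ordS k, l)]same ?xpair_eqE ?(negbTE neqS) //.
have -> : e (ordS k, l) = e (k, l) by case: bnd => l0 ->; rewrite !ffunE.
by rewrite eq_sym.
Qed.

End GateExitTransposed.

(** * Lowering a slice to a monochromatic configuration *)

Section Descent.
Local Open Scope nat_scope.
Variables (K L q : nat).
Hypotheses (K_gt2 : 2 < K) (L_gt5 : 5 < L).
Local Notation config2 := {ffun 'I_K * 'I_L -> 'I_q}.
Implicit Types (a b c : 'I_q) (eta : config2).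

Let L_gt2 : 2 < L. Proof. exact: leq_trans L_gt5. Qed.

Definition low a b h eta : Prop := two_spin a b eta /\ hamiltonian2 eta <= h.

Lemma low_sym a b h eta : low a b h eta -> low b a h eta.
Proof. by case=> /two_spin_sym. Qed.

Definition set_site eta x c : config2 := [ffun y => if y == x then c else eta y].

Lemma set_site_adj eta x c : eta x != c -> config_adj eta (set_site eta x c).
Proof.
move=> neq; apply/config_adjP; exists x; first by rewrite ffunE eqxx.
by move=> y /negbTE y_neq; rewrite ffunE y_neq.
Qed.

(* Spins [b] are removed in the lexicographic order that starts at the all-[a]
   cross: the first one has two neighbours of spin [a], so the energy does not
   increase. *)
Lemma cross_descent a b h eta k0 l0 : a != b ->
  (forall l, eta (k0, l) = a) -> (forall k, eta (k, l0) = a) -> low a b h eta ->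
  reach (low a b h) eta (monochromatic _ a).
Proof.
move=> neq; move: {2}(spin_count b eta) (leqnn (spin_count b eta)) => n.
elim: n eta => [|n IHn] eta cnt col_a row_a [ab H_le].
  suff -> : eta = monochromatic _ a by apply: reach_refl; split; [move=> x; rewrite ffunE; left|
    rewrite /hamiltonian2 hamiltonian_monochromatic].
  apply/ffunP => x; rewrite ffunE; case: (ab x) => // xb.
  move: cnt; rewrite leqn0 => /eqP/card0_eq/(_ x); by rewrite !inE xb eqxx.
case: (pickP (fun x => eta x == b)) => [x0 x0b|nob]; last first.
  apply: IHn => //; rewrite /spin_count eq_card0 // => x; by rewrite inE nob.
pose M (x : 'I_K * 'I_L) := offset k0 x.1 * L + offset l0 x.2.
case: (@arg_minnP _ x0 (fun x => eta x == b) M x0b) => -[k l] /eqP kl_b kl_min.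
have not_b y : M y < M (k, l) -> eta y = a.
  move=> lt; case: (ab y) => // /eqP/kl_min; lia.
have k_neq : k != k0 by apply: contraNneq neq => E; rewrite -(col_a l) -kl_b E.
have l_neq : l != l0 by apply: contraNneq neq => E; rewrite -(row_a k) -kl_b E.
have offset_pos N (i j : 'I_N) : j != i -> 0 < offset i j.
  move=> ne; rewrite lt0n; apply: contra ne => /eqP E; apply/eqP.
  by apply: (@offset_inj _ i); rewrite E offset_self.
have k_pred : eta (ord_pred k, l) = a.
  apply: not_b; rewrite /M /= offset_ord_pred // ltn_add2r ltn_mul2r ltn_predL.
  by rewrite offset_pos //; lia.
have l_pred : eta (k, ord_pred l) = a.
  apply: not_b; rewrite /M /= offset_ord_pred // ltn_add2l ltn_predL.
  exact: offset_pos.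
pose eta1 := set_site eta (k, l) a.
have b_neq_a : b != a by rewrite eq_sym.
apply: (@reach_step _ _ _ _ eta1) => //; first by apply: set_site_adj; rewrite kl_b.
have eta1E y : y != (k, l) -> eta1 y = eta y by move=> /negbTE y_neq; rewrite ffunE y_neq.
have eta1kl : eta1 (k, l) = a by rewrite ffunE eqxx.
apply: IHn.
- rewrite -ltnS; apply: leq_trans cnt; apply: proper_card; apply/properP; split.
    apply/fintype.subsetP => y; rewrite !inE.
    by have [->|/eta1E ->] := eqVneq y (k, l); rewrite ?eta1kl ?(negbTE neq).
  by exists (k, l); rewrite !inE ?kl_b ?eta1kl.
- by move=> l'; rewrite eta1E // xpair_eqE negb_and eq_sym k_neq.
- by move=> k'; rewrite eta1E // xpair_eqE negb_and [l0 == l]eq_sym l_neq orbT.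
- split=> [y|]; first by have [->|/eta1E ->] := eqVneq y (k, l); [left|].
  apply: leq_trans H_le; rewrite !hamiltonian2E //; apply: leq_add; apply: leq_sum.
    move=> l' _; have [->|ne] := eqVneq l' l.
      apply: (@cut_flip_le _ _ _ _ k); rewrite /row ?eta1kl ?k_pred ?kl_b // => k' ne.
      by rewrite eta1E // xpair_eqE (negbTE ne).
    rewrite (eq_cut (g := row eta l')) // => k'.
    by rewrite /row eta1E // xpair_eqE (negbTE ne) andbF.
  move=> k' _; have [->|ne] := eqVneq k' k.
    apply: (@cut_flip_le _ _ _ _ l); rewrite /col ?eta1kl ?l_pred ?kl_b // => l' ne.
    by rewrite eta1E // xpair_eqE (negbTE ne) andbF.
  rewrite (eq_cut (g := col eta k')) // => l'.
  by rewrite /col eta1E // xpair_eqE (negbTE ne).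
Qed.

(** A strip of width 1 leaves no constant column. Removing one of its sites creates one at no cost,
    the column losing 2 and the row of the strip gaining 2; [cross_descent] does the rest. *)
Lemma bandR1_descent a b eta : a != b -> bandR a b 1 eta ->
  reach (low a b (2 * K)) eta (monochromatic _ a).
Proof.
move=> neq R; have [l etaE] := R.
have k0 : 'I_K by apply: (Ordinal (n := K) (m := 0)); lia.
have etaV k l' : eta (k, l') = if l' == l then b else a.
  rewrite etaE ffunE mem_arc /=; congr (if _ then _ else _).
  rewrite ltnS leqn0; apply/eqP/eqP => [E|->]; last exact: offset_self.
  by apply: (@offset_inj _ l); rewrite E offset_self.
pose eta1 := set_site eta (k0, l) a.
have ab := bandR_two_spin R.
have eta1V k l' : eta1 (k, l') = if (l' == l) && (k != k0) then b else a.
  by rewrite ffunE xpair_eqE etaV andbC; case: (l' == l); case: (k == k0).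
apply: (@reach_step _ _ _ _ eta1).
- by split=> //; apply: hamiltonian2_bandR R.
- by apply: set_site_adj; rewrite etaV eqxx eq_sym.
have neqS : ordS l != l by rewrite ordS_neq //; lia.
apply: (@cross_descent _ _ _ _ k0 (ordS l)) => //.
- by move=> l'; rewrite eta1V eqxx andbF.
- by move=> k; rewrite eta1V (negbTE neqS).
split=> [[k l']|]; first by rewrite eta1V; case: ifP; [right|left].
rewrite hamiltonian2E // (bigD1 l) //= big1 ?addn0 => [|l' /negbTE l'_neq]; last first.
  by apply: (@cut_constant _ _ _ a) => k; rewrite /row eta1V l'_neq.
rewrite (bigD1 k0) //= (@cut_constant _ _ (col eta1 k0) a) ?add0n => [|l']; last first.
  by rewrite /col eta1V eqxx andbF.
have row_le : cut (row eta1 l) <= 2.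
  apply: leq_trans (cut_arc k0 1).
  rewrite (eq_cut (g := (fun t : bool => if t then a else b) \o (fun k => k \in arc k0 1))).
    exact: cut_le_cut.
  move=> k; rewrite /row eta1V eqxx /= mem_arc ltnS leqn0.
  suff -> : (offset k0 k == 0) = (k == k0) by case: (k == k0).
  apply/eqP/eqP => [E|->]; last exact: offset_self.
  by apply: (@offset_inj _ k0); rewrite E offset_self.
have cols_le : \sum_(k | k != k0) cut (col eta1 k) <= \sum_(k | k != k0) 2.
  apply: leq_sum => k k_neq; apply: leq_trans (cut_arc l 1).
  rewrite (eq_cut (g := (fun t : bool => if t then b else a) \o (fun l' => l' \in arc l 1))).
    exact: cut_le_cut.
  move=> l'; rewrite /col eta1V k_neq andbT /= mem_arc ltnS leqn0.
  suff -> : (offset l l' == 0) = (l' == l) by [].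
  apply/eqP/eqP => [E|->]; last exact: offset_self.
  by apply: (@offset_inj _ l); rewrite E offset_self.
apply: leq_trans (leq_add row_le cols_le) _.
by rewrite sum_nat_const cardC1 card_ord; nia.
Qed.

Lemma strip_descent a b eta : a != b -> low a b (2 * K) eta -> cols_nonconst eta ->
  ~ G2 a b eta -> reach (low a b (2 * K)) eta (monochromatic _ a) \/
                  reach (low a b (2 * K)) eta (monochromatic _ b).
Proof.
move=> neq [ab H_le] nc nG.
have H_le' : hamiltonian2 eta <= 2 * K + 2 by apply: leq_trans H_le (leq_addr _ _).
case: (strip_structure K_gt2 L_gt2 neq ab nc H_le').
  move=> [l [v [v_bd etaE]]]; have R : bandR a b v eta by exists l.
  have [v1|v_neq1] := eqVneq v 1; first by left; apply: bandR1_descent; rewrite -?v1.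
  have [vL|v_neqL] := eqVneq v L.-1.
    right; apply: (reach_sub (Pr := low b a (2 * K))) => [x|]; first exact: low_sym.
    apply: bandR1_descent; first by rewrite eq_sym.
    have := bandR_swap K_gt2 L_gt5 neq v_bd nc R; suff -> : L - v = 1 by [].
    by lia.
  case: nG; left; right; right; exists v; [rewrite /=; lia|left; exact: R].
move=> [l [v [k [h [h_bd v_gt v_lt etaE]]]]].
have Q : bandQ a b v eta by exists l, k, h; split=> //; lia.
by have := hamiltonian2_bandQ K_gt2 L_gt5 neq v_lt nc Q; lia.
Qed.

End Descent.

Section DescentTransposed.
Local Open Scope nat_scope.
Variables (K L q : nat).
Hypotheses (K_gt2 : 2 < K) (L_gt5 : 5 < L) (K_le_L : K <= L).
Implicit Types (a b : 'I_q) (eta : {ffun 'I_K * 'I_L -> 'I_q}).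

Lemma descent a b eta : a != b -> low a b (2 * K) eta -> ~ G2 a b eta ->
  reach (low a b (2 * K)) eta (monochromatic _ a) \/
  reach (low a b (2 * K)) eta (monochromatic _ b).
Proof.
have L_gt2 : 2 < L by apply: leq_trans L_gt5.
move=> neq lo nG; have [nc|cols] := pselect (cols_nonconst eta).
  exact: strip_descent.
have [k0 k0_const] : exists k0, forall l l', eta (k0, l) = eta (k0, l').
  apply: contrapT => none; apply: cols => k; apply: contrapT => const.
  apply: none; exists k => l l'; apply/eqP; apply: contrapT => /negP ne.
  by apply: const; exists l, l'.
have [rows|rows] := pselect (forall l, exists k k', eta (k, l) != eta (k', l)).
  (* Nonconstant rows cost [2 * L], which fits into [2 * K] only on a square; the transpose then has
     nonconstant columns. *)
  have KL : K = L.
    have : \sum_(l < L) 2 <= \sum_l cut (row eta l).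
      by apply: leq_sum => l _; have [k [k' ne]] := rows l; apply: (@cut_ge2 _ _ _ k k').
    rewrite sum_nat_const card_ord => le; have := lo.2; rewrite hamiltonian2E // => le2.
    have := leq_trans (leq_trans le (leq_addr _ _)) le2; lia.
  move: eta neq lo nG cols rows {k0 k0_const}; subst L => eta neq lo nG _ rows.
  have lo' : low a b (2 * K) (tr eta).
    by split; [apply: two_spin_tr; case: lo | rewrite hamiltonian2_tr; case: lo].
  have back c : reach (low a b (2 * K)) (tr eta) (monochromatic _ c) ->
      reach (low a b (2 * K)) eta (monochromatic _ c).
    have mono_tr : tr (monochromatic _ c) = monochromatic _ c :> {ffun 'I_K * 'I_K -> 'I_q}.
      by apply/ffunP => x; rewrite !ffunE.
    rewrite -{2}[eta]trK -{2}mono_tr; apply: reach_map.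
      by move=> x y; rewrite config_adj_tr.
    by move=> x [x1 x2]; split; [apply: two_spin_tr | rewrite hamiltonian2_tr].
  case: (@strip_descent _ _ _ K_gt2 L_gt5 a b (tr eta) neq lo') => [|/G2_tr||].
  - by move=> k; have [k1 [k2 ne]] := rows k; exists k1, k2; rewrite !ffunE.
  - by rewrite trK.
  - by move/back; left.
  - by move/back; right.
have [l0 l0_const] : exists l0, forall k k', eta (k, l0) = eta (k', l0).
  apply: contrapT => none; apply: rows => l; apply: contrapT => const.
  apply: none; exists l => k k'; apply/eqP; apply: contrapT => /negP ne.
  by apply: const; exists k, k'.
case: (lo.1 (k0, l0)) => c.
  left; apply: (@cross_descent _ _ _ K_gt2 L_gt5 _ _ _ _ k0 l0) => //.
    by move=> l; rewrite (k0_const _ l0).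
  by move=> k; rewrite (l0_const _ k0).
right; apply: (reach_sub (Pr := low b a (2 * K))) => [x|]; first exact: low_sym.
apply: (@cross_descent _ _ _ K_gt2 L_gt5 _ _ _ _ k0 l0); last exact: low_sym.
- by rewrite eq_sym.
- by move=> l; rewrite (k0_const _ l0).
- by move=> k; rewrite (l0_const _ k0).
Qed.

End DescentTransposed.

(** * Three-dimensional configurations *)

Section ConnectedArc.
Local Open Scope nat_scope.
Variable M : nat.

(** From a site [l] of [P] whose predecessor is outside, the arc up to the first exit is closed
    under adjacency within [P], so connectivity makes it all of [P]. *)
Lemma connected_arc (P : {set 'I_M}) : connected_set P -> 0 < #|P| < M ->
  exists l, P = arc l #|P|.
Proof.
move=> conn /andP[P_gt0 P_lt].
have [x0 x0P] := card_gt0P P_gt0.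
have [y0 y0P] : exists y, y \notin P.
  apply/existsP; apply: contraTT P_lt; rewrite negb_exists => /forallP all; rewrite -leqNgt.
  rewrite -{1}[M]card_ord; apply/subset_leq_card/fintype.subsetP => x _.
  by have := all x; rewrite negbK.
have [l lP lpP] : exists2 l, l \in P & ord_pred l \notin P.
  case: (pickP (fun l => (l \in P) && (ord_pred l \notin P))) => [l /andP[? ?]|none]; first by exists l.
  have all n : iter n (@ord_pred M) x0 \in P.
    elim: n => //= n IHn; have := none (iter n (@ord_pred M) x0).
    by rewrite IHn /= => /negbFE.
  case/negP: y0P; rewrite -(shift_offset y0 x0) in all.
  have := all (offset y0 x0); suff -> : iter (offset y0 x0) (@ord_pred M) (shift y0 (offset y0 x0)) = y0 by [].
  by elim: (offset y0 x0) => //= n IHn; rewrite -iterS iterSr shiftS ordSK.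
have ex0 : exists n, shift l n \notin P.
  by exists (offset l (ord_pred l)); rewrite shift_offset.
case: (ex_minnP ex0) => n n_out n_min.
have n_lt : n < M.
  by apply: leq_ltn_trans (n_min _ _) (offset_lt l (ord_pred l)); rewrite shift_offset.
have sub x : x \in arc l n -> x \in P.
  rewrite mem_arc => lt; apply: contraTT lt; rewrite -{1}(shift_offset l x) => /n_min.
  by rewrite -leqNgt.
have step u v : v \in P -> cycle_adj u v -> u \in arc l n -> v \in arc l n.
  rewrite !mem_arc => vP /orP[]/eqP E lt_n.
    have [u_last|u_neq] := eqVneq (offset l u).+1 n.
      by case/negP: n_out; rewrite -u_last shiftS shift_offset -E.
    by rewrite E -(shift_offset l u) -shiftS offset_shift modn_small; lia.
  have u_neq : u != l by apply: contraNneq lpP => <-; rewrite E ordSK.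
  have := offset_ord_pred u_neq; rewrite {1}E ordSK; lia.
have l_in : l \in arc l n.
  by rewrite mem_arc offset_self lt0n; apply: contraNneq n_out => ->.
pose e := [rel u v | [&& u \in P, v \in P & cycle_adj u v]].
have walk p : forall u, u \in arc l n -> path e u p -> last u p \in arc l n.
  elim: p => [//|v p IHp] u u_in /= /andP[/and3P[_ vP adj] pP].
  by apply: IHp pP; apply: step adj u_in.
have sup x : x \in P -> x \in arc l n.
  move=> xP; move: conn => /forall_inP/(_ l lP)/forall_inP/(_ x xP)/connectP[p pP ->].
  exact: walk.
have E : P = arc l n by apply/setP => x; apply/idP/idP; [apply: sup | apply: sub].
by exists l; rewrite {2}E card_arc // ltnW.
Qed.

Lemma cut_connected (P : {set 'I_M}) : connected_set P ->
  cut (fun m => m \in P) <= 2.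
Proof.
move=> conn; have [/eqP P0|] := posnP #|P|.
  by rewrite (@cut_constant _ _ _ false) // => i; rewrite (cards0_eq (eqP P0)) inE.
have [PM _|P_lt P_gt0] := leqP M #|P|; last first.
  have [|l E] := connected_arc conn; first by rewrite P_gt0.
  by rewrite E cut_arc.
have /eqP E : P == [set: 'I_M]%SET.
  by rewrite eqEcard finset.subsetT cardsT card_ord.
by rewrite (@cut_constant _ _ _ true) // => i; rewrite E inE.
Qed.

(** A decreasing predicate of the offset is the indicator of an initial arc. *)
Lemma cut_initial (l : 'I_M) (g : nat -> bool) :
  (forall m n, m <= n -> g n -> g m) -> cut (fun x => g (offset l x)) <= 2.
Proof.
move=> g_anti.
have [n nE] : exists n, forall o, o < M -> g o = (o < n).
  elim: M => [|N [n nE]]; first by exists 0.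
  have [gN|gN] := boolP (g N).
    by exists N.+1 => o lt; rewrite lt (g_anti _ _ _ gN).
  exists (minn n N) => o; rewrite ltnS leq_eqVlt => /predU1P[->|lt].
    by rewrite (negbTE gN) leq_min ltnn andbF.
  by rewrite leq_min lt andbT nE.
rewrite (eq_cut (g := fun x => x \in arc l n)) ?cut_arc // => x.
by rewrite mem_arc nE ?offset_lt.
Qed.

End ConnectedArc.

(** * Slabs with one special slice *)

Section Lift.
Local Open Scope nat_scope.
Variables (K L M q : nat).
Local Notation config := {ffun 'I_K * 'I_L * 'I_M -> 'I_q}.
Local Notation config2 := {ffun 'I_K * 'I_L -> 'I_q}.
Implicit Types (a b c : 'I_q) (s z : config) (eta : config2) (P Q : {set 'I_M}).

Definition lift a b P (m0 : 'I_M) eta : config :=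
  [ffun x => if x.2 == m0 then eta x.1 else if x.2 \in P then b else a].

Lemma slice_lift a b P m0 eta : slice (lift a b P m0 eta) m0 = eta.
Proof. by apply/ffunP => y; rewrite !ffunE eqxx. Qed.

(** Normal form of a gate configuration: [Q] exceeds [P] by one slice, and all the others are
    prescribed. *)
Lemma Gtilde_lift a b P Q s : prec P Q -> Gtilde a b P Q s ->
  exists m0, [/\ m0 \notin P, Q = m0 |: P, s = lift a b P m0 (slice s m0) &
                 G2 a b (slice s m0)].
Proof.
case/andP => PQ /eqP cQ sG.
have : #|Q :\: P|%SET == 1.
  rewrite cardsD (finset.setIidPr PQ) cQ; lia.
case/cards1P => m0 QP.
have : m0 \in (Q :\: P)%SET by rewrite QP finset.set11.
rewrite inE => /andP[m0P m0Q].
have QE : Q = m0 |: P.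
  apply/setP => m; rewrite !inE; have := congr1 (fun A : {set 'I_M} => m \in A) QP.
  rewrite !inE; case: (boolP (m \in P)) => [mP _|_ /= ->]; last by rewrite orbF.
  by rewrite orbT (fintype.subsetP PQ).
exists m0; split=> //; last by have [_ _] := sG m0; apply; rewrite !inE m0P.
apply/ffunP => -[y m]; rewrite !ffunE /=; have [->//|m_neq] := eqVneq m m0.
have [inP outQ _] := sG m; case: ifP => mP.
  by have := congr1 (fun e : config2 => e y) (inP mP); rewrite !ffunE.
have mQ : m \notin Q by rewrite QE !inE (negbTE m_neq) mP.
by have := congr1 (fun e : config2 => e y) (outQ mQ); rewrite !ffunE.
Qed.

Lemma lift_Gtilde a b P m0 eta : m0 \notin P -> G2 a b eta ->
  Gtilde a b P (m0 |: P) (lift a b P m0 eta).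
Proof.
move=> m0P G m; split.
- move=> mP; have m_neq : m != m0 by apply: contraTneq mP => ->.
  by apply/ffunP => y; rewrite !ffunE /= (negbTE m_neq) mP.
- rewrite !inE negb_or => /andP[m_neq mP].
  by apply/ffunP => y; rewrite !ffunE /= (negbTE m_neq) (negbTE mP).
- by rewrite !inE => /andP[/negbTE -> /orP[/eqP ->|//]]; rewrite slice_lift.
Qed.

Lemma outside_nonempty P m0 n : n + #|P| + 1 < M -> m0 \notin P ->
  n < #|~: (m0 |: P)|%SET.
Proof. by move=> lt m0P; rewrite cardsCs finset.setCK cardsU1 m0P card_ord; lia. Qed.

Lemma sum_const2 : \sum_(y : 'I_K * 'I_L) 2 = 2 * K * L.
Proof. by rewrite sum_nat_const card_prod !card_ord mulnC mulnA. Qed.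

End Lift.

Section ThreeDim.
Local Open Scope nat_scope.
Variables (K L M q : nat).
Hypotheses (K_gt2 : 2 < K) (L_gt5 : 5 < L) (M_gt2 : 2 < M).
Local Notation site := ('I_K * 'I_L * 'I_M)%type.
Local Notation config := {ffun site -> 'I_q}.
Local Notation config2 := {ffun 'I_K * 'I_L -> 'I_q}.
Implicit Types (a b c : 'I_q) (s z : config) (eta : config2) (P Q : {set 'I_M}).

Let L_gt2 : 2 < L. Proof. exact: leq_trans L_gt5. Qed.

Lemma hamiltonian3E s : hamiltonian3 s =
  \sum_m hamiltonian2 (slice s m) + \sum_y cut (fun m => s (y, m)).
Proof.
rewrite /hamiltonian3 /adj3 hamiltonian_box; last exact: cycle_adj_sym.
  congr (_ + _); apply: eq_bigr => y _; rewrite hamiltonian_cycle //.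
  by apply: eq_cut => m; rewrite ffunE.
by apply: box_adj_sym; apply: cycle_adj_sym.
Qed.

(** Each vertical line meets a slice of [P] and one outside [m0 |: P], which costs 2, and costs 3
    when a third spin sits in the special slice. *)
Lemma lift_ge a b P m0 eta : a != b -> m0 \notin P -> 0 < #|P| -> #|P| + 1 < M ->
  2 * K * L + hamiltonian2 eta + third a b eta <= hamiltonian3 (lift a b P m0 eta).
Proof.
move=> neq m0P P_gt0 P_lt.
have [m1 m1P] := card_gt0P P_gt0.
have [m2] : exists m, m \in ~: (m0 |: P).
  by apply/card_gt0P/outside_nonempty => //; rewrite add0n.
rewrite !inE negb_or => /andP[m2_neq m2P].
have m1_neq : m1 != m0 by apply: contraTneq m1P => ->.
rewrite hamiltonian3E (bigD1 m0) //= slice_lift [2 * K * L + _]addnC -!addnA leq_add2l.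
apply: leq_trans (leq_addl _ _).
have -> : third a b eta = \sum_y ((eta y != a) && (eta y != b)).
  rewrite /third -sum1_card big_mkcond; apply: eq_bigr => y _; rewrite inE.
  by case: (_ && _).
rewrite -sum_const2 -big_split /=; apply: leq_sum => y _.
pose f m := lift a b P m0 eta (y, m).
have f1 : f m1 = b by rewrite /f ffunE /= (negbTE m1_neq) m1P.
have f2 : f m2 = a by rewrite /f ffunE /= (negbTE m2_neq) (negbTE m2P).
have f0 : f m0 = eta y by rewrite /f ffunE /= eqxx.
case: (boolP (_ && _)) => [/andP[ya yb]|_].
  by apply: (@cut_ge3 _ _ f m1 m2 m0); rewrite ?f1 ?f2 ?f0 // eq_sym.
by rewrite addn0; apply: (@cut_ge2 _ _ f m1 m2); rewrite f1 f2 eq_sym.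
Qed.

(** With two spins a vertical line is the indicator of [P] or of [m0 |: P], both connected, hence
    costs at most 2. *)
Lemma lift_le a b P m0 eta : m0 \notin P ->
  connected_set P -> connected_set (m0 |: P) -> two_spin a b eta ->
  hamiltonian3 (lift a b P m0 eta) <= 2 * K * L + hamiltonian2 eta.
Proof.
move=> m0P conP conQ ab; rewrite hamiltonian3E (bigD1 m0) //= slice_lift big1 => [|m m_neq].
  rewrite addn0 addnC leq_add2r -sum_const2; apply: leq_sum => y _.
  pose h (t : bool) := if t then b else a.
  case: (ab y) => eta_y; [apply: leq_trans (cut_connected conP)|apply: leq_trans (cut_connected conQ)].
    rewrite (eq_cut (g := h \o (fun m => m \in P))) ?cut_le_cut // => m.
    by rewrite ffunE /=; have [->|_] := eqVneq m m0; rewrite ?(negbTE m0P) ?eta_y.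
  rewrite (eq_cut (g := h \o (fun m => m \in m0 |: P))) ?cut_le_cut // => m.
  by rewrite ffunE /= !inE; have [->|_] := eqVneq m m0; rewrite ?eta_y.
rewrite (_ : slice _ m = monochromatic _ (if m \in P then b else a)).
  by rewrite /hamiltonian2 hamiltonian_monochromatic.
by apply/ffunP => y; rewrite !ffunE /= (negbTE m_neq).
Qed.

Lemma hamiltonian2_flip c eta y : (forall y', y' != y -> eta y' = c) -> eta y != c ->
  4 <= hamiltonian2 eta.
Proof.
move=> same neq; case: y same neq => k l same neq.
have kS : eta (ordS k, l) = c by apply: same; rewrite xpair_eqE negb_and ordS_neq //; lia.
have lS : eta (k, ordS l) = c by apply: same; rewrite xpair_eqE negb_and ordS_neq ?orbT //; lia.
rewrite hamiltonian2E // (@leq_add 2 2) //.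
  by apply: (@sum_rows_ge _ _ _ _ k (ordS k) l); rewrite kS.
rewrite (bigD1 k) //=; apply: leq_trans (leq_addr _ _).
by apply: (@cut_ge2 _ _ _ l (ordS l)); rewrite /col lS.
Qed.

(** A flip in a monochromatic slice creates an isolated site, of energy at least 4 in that slice.
    The bounds on [#|P|] leave a slice of each spin untouched, so the vertical cost [2 * K * L]
    remains. *)
Lemma lift_flip_outside a b P m0 eta z y m : a != b -> m0 \notin P -> 1 < #|P| ->
  #|P| + 2 < M -> m != m0 -> z (y, m) != lift a b P m0 eta (y, m) ->
  (forall x, x != (y, m) -> z x = lift a b P m0 eta x) ->
  2 * K * L + hamiltonian2 eta + 4 <= hamiltonian3 z.
Proof.
move=> neq m0P P_gt P_lt m_neq z_neq same.
have [m1 m1P m1_neq] : exists2 m1, m1 \in P & m1 != m.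
  have : 0 < #|P :\ m|%SET by move: P_gt; rewrite (cardsD1 m P); case: (m \in P) => /=; lia.
  by case/card_gt0P => m1; rewrite !inE => /andP[? ?]; exists m1.
have [m2 m2P m2_neq] : exists2 m2, m2 \in ~: (m0 |: P) & m2 != m.
  have := @outside_nonempty _ P m0 1; rewrite addnAC addnC => /(_ P_lt m0P) gt1.
  have : 0 < #|~: (m0 |: P) :\ m|%SET.
    by move: gt1; rewrite (cardsD1 m); case: (m \in _) => /=; lia.
  by case/card_gt0P => m2; rewrite in_setD1 => /andP[? ?]; exists m2.
move: m2P; rewrite !inE negb_or => /andP[m2_neq0 m2P].
have m1_neq0 : m1 != m0 by apply: contraTneq m1P => ->.
rewrite hamiltonian3E (bigD1 m0) //= (bigD1 m) //=.
have -> : slice z m0 = eta.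
  apply/ffunP => y'; rewrite ffunE same ?ffunE /= ?eqxx //.
  by rewrite xpair_eqE negb_and [m0 == m]eq_sym m_neq orbT.
have H4 : 4 <= hamiltonian2 (slice z m).
  apply: (@hamiltonian2_flip (if m \in P then b else a) _ y) => [y' y'_neq|].
    by rewrite ffunE same ?ffunE /= ?(negbTE m_neq) // xpair_eqE negb_and y'_neq.
  by rewrite ffunE; move: z_neq; rewrite ffunE /= (negbTE m_neq).
have vert : 2 * K * L <= \sum_y cut (fun m => z (y, m)).
  rewrite -sum_const2; apply: leq_sum => y' _; apply: (@cut_ge2 _ _ _ m1 m2).
  have pair_neq m' : m' != m -> (y', m') != (y, m).
    by move=> ne; rewrite xpair_eqE negb_and ne orbT.
  rewrite !same ?pair_neq // !ffunE /= (negbTE m1_neq0) m1P (negbTE m2_neq0) (negbTE m2P).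
  by rewrite eq_sym.
rewrite -!addnA [2 * K * L + _]addnC -!addnA leq_add2l; apply: leq_add => //.
by apply: leq_trans vert (leq_addl _ _).
Qed.

End ThreeDim.

(** * Permutations of coordinates *)

Section CoordinateSymmetry.
Local Open Scope nat_scope.
Variables (K L M q : nat).
Local Notation site := ('I_K * 'I_L * 'I_M)%type.
Local Notation config := {ffun site -> 'I_q}.
Implicit Types (x y : site) (s z : config) (p : 'S_3).

Lemma coord_lt x i : coord x i < side K L M i.
Proof. by case: i => -[|[|[|m]]] lt //; apply: ltn_ord. Qed.

Lemma ord3P (Pr : 'I_3 -> Prop) : Pr (Ordinal (isT : 0 < 3)) -> Pr (Ordinal (isT : 1 < 3)) ->
  Pr (Ordinal (isT : 2 < 3)) -> forall i, Pr i.
Proof.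
by move=> P0 P1 P2 [[|[|[|//]]] lt]; rewrite (bool_irrelevance lt isT).
Qed.

Definition site_of (f : 'I_3 -> nat) (f_lt : forall i, f i < side K L M i) : site :=
  (Ordinal (f_lt (Ordinal (isT : 0 < 3))), Ordinal (f_lt (Ordinal (isT : 1 < 3))),
   Ordinal (f_lt (Ordinal (isT : 2 < 3)))).

Lemma coord_site_of f f_lt i : coord (@site_of f f_lt) i = f i.
Proof. by elim/ord3P: i. Qed.

Lemma coord_inj x y : (forall i, coord x i = coord y i) -> x = y.
Proof.
case: x y => [[k l] m] [[k' l'] m'] E.
have /val_inj -> : k = k' :> nat := E (Ordinal (isT : 0 < 3)).
have /val_inj -> : l = l' :> nat := E (Ordinal (isT : 1 < 3)).
by have /val_inj -> : m = m' :> nat := E (Ordinal (isT : 2 < 3)).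
Qed.

Definition side_preserving p : Prop := forall i, side K L M (p i) = side K L M i.

Lemma permute_lt p (hp : side_preserving p) x i : coord x (p i) < side K L M i.
Proof. by rewrite -hp coord_lt. Qed.

(** Ordinals are rebuilt from natural numbers and the bound [permute_lt], so equal sides need not be
    convertible. *)
Definition permute_site p (hp : side_preserving p) x : site := site_of (permute_lt hp x).

Lemma coord_permute p (hp : side_preserving p) x i : coord (permute_site hp x) i = coord x (p i).
Proof. exact: coord_site_of. Qed.

Definition permute p (hp : side_preserving p) s : config :=
  [ffun x => s (permute_site hp x)].

Lemma permutedE p (hp : side_preserving p) s s' : permuted p s s' <-> s' = permute hp s.
Proof.
split=> [H|-> x y E]; first by apply/ffunP => x; rewrite ffunE; apply: H => i; rewrite coord_permute.
by rewrite ffunE; congr (s _); apply: coord_inj => i; rewrite coord_permute E.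
Qed.

Lemma side_preserving_mul p p' : side_preserving p -> side_preserving p' ->
  side_preserving (p * p')%g.
Proof. by move=> hp hp' i; rewrite permM hp' hp. Qed.

Lemma side_preserving_inv p : side_preserving p -> side_preserving p^-1%g.
Proof. by move=> hp i; rewrite -hp permKV. Qed.

Lemma side_preserving_one : side_preserving 1%g.
Proof. by move=> i; rewrite perm1. Qed.

Lemma permute_permute p p' (hp : side_preserving p) (hp' : side_preserving p') h s :
  permute hp' (permute hp s) = permute (p := (p * p')%g) h s.
Proof.
apply/ffunP => x; rewrite !ffunE; congr (s _); apply: coord_inj => i.
by rewrite !coord_permute permM.
Qed.

Lemma permute_id p (hp : side_preserving p) s : p = 1%g -> permute hp s = s.
Proof.
move=> E; apply/ffunP => x; rewrite ffunE; congr (s _).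
by apply: coord_inj => i; rewrite coord_permute E perm1.
Qed.

Lemma permuteK p (hp : side_preserving p) (hV : side_preserving p^-1%g) :
  cancel (permute hp) (permute hV).
Proof.
move=> s; rewrite (permute_permute hp hV (side_preserving_mul hp hV)) permute_id //.
exact: mulgV.
Qed.

Lemma permuteVK p (hp : side_preserving p) (hV : side_preserving p^-1%g) :
  cancel (permute hV) (permute hp).
Proof.
move=> s; rewrite (permute_permute hV hp (side_preserving_mul hV hp)) permute_id //.
exact: mulVg.
Qed.

Lemma permute_site_inj p (hp : side_preserving p) : injective (permute_site hp).
Proof.
move=> x y E; apply: coord_inj => i.
by rewrite -(permKV p i) -!(coord_permute hp) E.
Qed.

Definition cycle_adj_nat N m n := (n == m.+1 %% N) || (m == n.+1 %% N).

(** The nested products in [adj3] hide the symmetry of the three directions; in coordinates it is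
    visible, which gives [adj3_permute]. *)
Lemma adj3_coord x y : adj3 x y =
  [exists i, cycle_adj_nat (side K L M i) (coord x i) (coord y i) &&
             [forall j, (j != i) ==> (coord x j == coord y j)]].
Proof.
have all3 (F : pred 'I_3) : [forall j, F j] =
    [&& F (Ordinal (isT : 0 < 3)), F (Ordinal (isT : 1 < 3)) & F (Ordinal (isT : 2 < 3))].
  apply/forallP/and3P => [H|[H0 H1 H2]]; first by split; apply: H.
  exact: ord3P.
have ex3 (F : pred 'I_3) : [exists j, F j] =
    [|| F (Ordinal (isT : 0 < 3)), F (Ordinal (isT : 1 < 3)) | F (Ordinal (isT : 2 < 3))].
  apply/existsP/or3P => [[i]|]; last by case=> H; eexists; exact: H.
  by elim/ord3P: i => H; [constructor 1|constructor 2|constructor 3].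
rewrite ex3 !all3; case: x y => [[k l] m] [[k' l'] m'].
rewrite /adj3 /adj2 /box_adj /coord /side /= /cycle_adj !xpair_eqE.
rewrite -!(inj_eq val_inj) /= /cycle_adj_nat.
case: (nat_of_ord k == k'); case: (nat_of_ord l == l'); case: (nat_of_ord m == m');
  by rewrite ?andbT ?andbF ?orbF /= ?orbF ?orbA.
Qed.

Lemma adj3_permute p (hp : side_preserving p) x y :
  adj3 (permute_site hp x) (permute_site hp y) = adj3 x y.
Proof.
rewrite !adj3_coord; apply/existsP/existsP => [[i /andP[adj /forallP same]]|[i /andP[adj /forallP same]]].
  exists (p i); rewrite hp -!(coord_permute hp) adj; apply/forallP => j.
  have := same (p^-1%g j); rewrite !coord_permute permKV.
  by rewrite (can2_eq (permKV p) (permK p)).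
exists (p^-1%g i); rewrite !coord_permute permKV (side_preserving_inv hp) adj.
apply/forallP => j; rewrite !coord_permute; have := same (p j).
by rewrite (can2_eq (permK p) (permKV p)).
Qed.

Lemma adj3_sym : symmetric (@adj3 K L M).
Proof.
apply: box_adj_sym; last exact: cycle_adj_sym.
by apply: box_adj_sym; apply: cycle_adj_sym.
Qed.

Lemma hamiltonian3_permute p (hp : side_preserving p) s :
  hamiltonian3 (permute hp s) = hamiltonian3 s.
Proof.
apply: hamiltonian_bij; [exact: adj3_sym|exact: permute_site_inj|exact: adj3_permute].
Qed.

Lemma config_adj_permute p (hp : side_preserving p) s z :
  config_adj (permute hp s) (permute hp z) = config_adj s z.
Proof. exact: (config_adj_bij _ _ (permute_site_inj (hp := hp))). Qed.

Lemma card_permute p (hp : side_preserving p) s (f : pred 'I_q) :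
  #|[set x | f (permute hp s x)]%SET| = #|[set x | f (s x)]%SET|.
Proof. exact: (card_bij _ _ (permute_site_inj (hp := hp))). Qed.

Lemma monochromatic_permute p (hp : side_preserving p) a :
  permute hp (monochromatic _ a) = monochromatic _ a.
Proof. by apply/ffunP => x; rewrite !ffunE. Qed.

Lemma UpsilonE (C : set config) s : Upsilon C s <->
  exists p (hp : side_preserving p) s0, C s0 /\ s = permute hp s0.
Proof.
split=> [[p [s0 [hp Cs perm]]]|[p [hp [s0 [Cs ->]]]]].
  by exists p, hp, s0; split=> //; apply/permutedE.
by exists p, s0; split=> //; apply/permutedE.
Qed.

Lemma Upsilon_permute (C : set config) p (hp : side_preserving p) s :
  Upsilon C s -> Upsilon C (permute hp s).
Proof.
rewrite !UpsilonE => -[p' [hp' [s0 [Cs ->]]]].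
exists (p' * p)%g, (side_preserving_mul hp' hp), s0; split=> //.
exact: permute_permute.
Qed.

Lemma Upsilon_sub (C : set config) s : C s -> Upsilon C s.
Proof.
move=> Cs; apply/UpsilonE; exists 1%g, side_preserving_one, s.
by rewrite permute_id.
Qed.

Lemma G3_permute a b i p (hp : side_preserving p) s : G3 a b i s -> G3 a b i (permute hp s).
Proof.
by move=> [P [Q [con PQ cP U]]]; exists P, Q; split=> //; apply: Upsilon_permute.
Qed.

Lemma GAB_permute (A B : {set 'I_q}) p (hp : side_preserving p) s :
  GAB A B s -> GAB A B (permute hp s).
Proof.
move=> [a [b [i [aA bB i_bd G]]]]; exists a, b, i; split=> //; exact: G3_permute.
Qed.

Lemma RAB_permute (A B : {set 'I_q}) i p (hp : side_preserving p) s :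
  RAB A B i s -> RAB A B i (permute hp s).
Proof.
by move=> [a [b [aA bB R]]]; exists a, b; split=> //; apply: Upsilon_permute.
Qed.

Lemma Nhat_permute (A B : set config) p (hp : side_preserving p) s :
  (forall z, A z -> A (permute hp z)) ->
  (forall z, B (permute hp z) -> B z) -> Nhat A B s -> Nhat A B (permute hp s).
Proof.
move=> A_perm B_perm /nbhd_hatE[y Ay r]; apply/nbhd_hatE; exists (permute hp y).
  exact: A_perm.
apply: reach_map r => [x x'|x [H_le nB]]; first by rewrite config_adj_permute.
by split; [rewrite -/(hamiltonian3 _) hamiltonian3_permute | move/B_perm].
Qed.

End CoordinateSymmetry.

(** * The lexicographic filling path *)

Section Fill.
Local Open Scope nat_scope.
Variables (K L M q : nat).
Hypotheses (K_gt2 : 2 < K) (L_gt2 : 2 < L) (M_gt2 : 2 < M).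
Local Notation site := ('I_K * 'I_L * 'I_M)%type.
Local Notation config := {ffun site -> 'I_q}.
Implicit Types (a b c : 'I_q) (s z : config) (x y : site) (l : 'I_M).

(** Lexicographic rank: slices in cyclic order from [l], then rows, then sites of a row. Multiples
    of [K * L] thus correspond to slabs. *)
Definition site_rank l x : nat := (offset l x.2 * L + x.1.2) * K + x.1.1.

Definition fill a b l (n : nat) : config := [ffun x => if site_rank l x < n then b else a].

Lemma site_rank_inj l : injective (site_rank l).
Proof.
move=> [[k r] m] [[k' r'] m']; rewrite /site_rank /= => E.
have Ek : k = k'.
  by apply: val_inj; have := congr1 (modn^~ K) E; rewrite /= !modnMDl !modn_small.
have {}E : offset l m * L + r = offset l m' * L + r'.
  have := congr1 (divn^~ K) E; rewrite /= !divnMDl; [|lia|lia].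
  by rewrite !divn_small // !addn0.
have Er : r = r'.
  by apply: val_inj; have := congr1 (modn^~ L) E; rewrite /= !modnMDl !modn_small.
have {}E : offset l m = offset l m'.
  have := congr1 (divn^~ L) E; rewrite /= !divnMDl; [|lia|lia].
  by rewrite !divn_small // !addn0.
by rewrite Ek Er (offset_inj E).
Qed.

Lemma mul_add_lt m n o p : m < p -> n < o -> m * o + n < p * o.
Proof.
move=> mp no; apply: (@leq_trans (m.+1 * o)); last by rewrite leq_mul2r mp orbT.
by rewrite mulSn addnC ltn_add2r.
Qed.

Lemma site_rank_lt l x : site_rank l x < K * L * M.
Proof.
rewrite (_ : K * L * M = M * L * K); last by lia.
by apply: mul_add_lt => //; apply: mul_add_lt => //; apply: offset_lt.
Qed.

Lemma site_rank_surj l n : n < K * L * M -> exists x, site_rank l x = n.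
Proof.
rewrite (_ : K * L * M = M * L * K); last by lia.
move=> n_lt; have K_gt0 : 0 < K by lia.
have L_gt0 : 0 < L by lia.
have k_lt : n %% K < K by rewrite ltn_mod.
have r_lt : n %/ K %% L < L by rewrite ltn_mod.
have o_lt : n %/ K %/ L < M by rewrite !ltn_divLR.
exists (Ordinal k_lt, Ordinal r_lt, shift l (n %/ K %/ L)).
by rewrite /site_rank /= offset_shift (modn_small o_lt) -!divn_eq.
Qed.

Lemma fill_adj a b l n : a != b -> n < K * L * M -> config_adj (fill a b l n) (fill a b l n.+1).
Proof.
move=> neq /(site_rank_surj l)[x xn]; apply/config_adjP; exists x.
  by rewrite !ffunE xn ltnn ltnSn.
move=> y y_neq; rewrite !ffunE ltnS leq_eqVlt -{1}xn.
by rewrite (inj_eq (@site_rank_inj l)) (negbTE y_neq).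
Qed.

Lemma fill0 a b l : fill a b l 0 = monochromatic _ a.
Proof. by apply/ffunP => x; rewrite !ffunE. Qed.

Lemma fill_full a b l : fill a b l (K * L * M) = monochromatic _ b.
Proof. by apply/ffunP => x; rewrite !ffunE site_rank_lt. Qed.

Lemma slab_fill a b l n : slab _ _ a b (arc l n) = fill a b l (K * L * n).
Proof.
apply/ffunP => -[[k r] m]; rewrite !ffunE /= mem_arc; congr (if _ then _ else _).
rewrite /site_rank /= (_ : K * L * n = n * L * K); last by lia.
case: (ltnP (offset l m) n) => [lt|ge].
  by apply/esym; apply: mul_add_lt => //; apply: mul_add_lt.
apply/esym/negbTE; rewrite -leqNgt; apply: leq_trans (leq_addr _ _).
rewrite leq_mul2r; apply/orP; right; apply: leq_trans (leq_addr _ _).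
by rewrite leq_mul2r ge orbT.
Qed.

Lemma card_rank (A : {set site}) l m n : (forall x, x \in A -> m <= site_rank l x < m + n) ->
  #|A| <= n.
Proof.
move=> A_rank; rewrite cardE -(size_map (site_rank l)) -(size_iota m n).
apply: uniq_leq_size; first by rewrite map_inj_uniq ?enum_uniq //; apply: site_rank_inj.
by move=> _ /mapP[x xA ->]; rewrite mem_iota A_rank // -mem_enum.
Qed.

Lemma fill_count_neq a b l n : #|[set x | fill a b l n x != a]%SET| <= n.
Proof.
apply: (@card_rank _ l 0) => x; rewrite inE ffunE leq0n add0n.
by case: (_ < _) => //; rewrite eqxx.
Qed.

Lemma fill_count_eq a b l n : a != b -> n <= K * L * M ->
  #|[set x | fill a b l n x == a]%SET| <= K * L * M - n.
Proof.
move=> neq n_le; apply: (@card_rank _ l n) => x.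
rewrite subnKC // site_rank_lt inE ffunE andbT.
by case: ltnP => // _; rewrite eq_sym (negbTE neq).
Qed.

Lemma cut_initial_if N (T : eqType) (u v : T) (g : nat -> bool) :
  (forall m n, m <= n -> g n -> g m) -> cut (fun i : 'I_N => if g i then u else v) <= 2.
Proof.
case: N => [|N]; first by rewrite /cut big_ord0.
move=> g_anti; apply: leq_trans (@cut_initial N.+1 ord0 g g_anti).
rewrite (eq_cut (g := (fun t : bool => if t then u else v) \o (fun i => g (offset (@ord0 N) i)))).
  exact: cut_le_cut.
by move=> i; rewrite /= /offset subn0 modnDr modn_small.
Qed.

(** Each column is an initial segment and costs at most 2; only the row being filled can be
    nonconstant. *)
Lemma hamiltonian2_fill a b (eta : {ffun 'I_K * 'I_L -> 'I_q}) (n : nat) :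
  (forall y : 'I_K * 'I_L, eta y = if y.2 * K + y.1 < n then b else a) ->
  hamiltonian2 eta <= 2 * K + 2.
Proof.
move=> etaE; rewrite hamiltonian2E // addnC leq_add //.
  rewrite (_ : 2 * K = \sum_(k < K) 2); last by rewrite sum_nat_const card_ord mulnC.
  apply: leq_sum => k _; rewrite (eq_cut (g := fun r : 'I_L => if r * K + k < n then b else a)).
    apply: (@cut_initial_if L _ b a (fun r => r * K + k < n)) => i j ij.
    by apply: leq_ltn_trans; rewrite leq_add2r leq_mul2r ij orbT.
  by move=> r; rewrite /col etaE.
have row_le r : cut (row eta r) <= 2 * (nat_of_ord r == n %/ K).
  have K_gt0 : 0 < K by lia.
  have n_eq := divn_eq n K; have n_mod := ltn_pmod n K_gt0.
  case: eqP => [E|/eqP r_neq].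
    rewrite muln1 (eq_cut (g := fun k : 'I_K => if r * K + k < n then b else a)).
      apply: (@cut_initial_if K _ b a (fun k => r * K + k < n)) => i j ij.
      by apply: leq_ltn_trans; rewrite leq_add2l.
    by move=> k; rewrite /row etaE.
  rewrite muln0 leqn0; apply/eqP.
  case: (ltngtP r (n %/ K)) r_neq => // [lt|gt] _.
    apply: (@cut_constant _ _ _ b) => k; rewrite /row etaE /= ifT //.
    have := mul_add_lt lt (ltn_ord k); lia.
  apply: (@cut_constant _ _ _ a) => k; rewrite /row etaE /= ifF //.
  by have := mul_add_lt gt n_mod; lia.
apply: (@leq_trans (\sum_(r < L) 2 * (nat_of_ord r == n %/ K))); first exact: leq_sum.
case: (ltnP (n %/ K) L) => [lt|ge].
  rewrite (bigD1 (Ordinal lt)) //= eqxx muln1 big1 // => r.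
  by rewrite -(inj_eq val_inj) /= => /negbTE ->.
by rewrite big1 // => r _; rewrite ltn_eqF ?muln0 // (leq_trans (ltn_ord r)).
Qed.

(** The three terms of [Gamma] pay for the vertical lines, the columns of the slice being filled and
    its partial row; all other slices are monochromatic. *)
Lemma hamiltonian3_fill a b l n : hamiltonian3 (fill a b l n) <= Gamma K L.
Proof.
have KL_gt0 : 0 < L * K by rewrite muln_gt0; lia.
rewrite hamiltonian3E // /Gamma -addnA addnC leq_add //.
  rewrite -(@sum_const2 K L); apply: leq_sum => -[k r] _.
  pose g o := (o * L + r) * K + k < n.
  rewrite (eq_cut (g := (fun t : bool => if t then b else a) \o (fun m => g (offset l m)))).
    apply: leq_trans (cut_le_cut _ _) (cut_initial _ _) => i j ij.
    by apply: leq_ltn_trans; rewrite leq_add2r leq_mul2r leq_add2r leq_mul2r ij !orbT.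
  by move=> m; rewrite ffunE.
have slice_le m : hamiltonian2 (slice (fill a b l n) m) <= (2 * K + 2) * (offset l m == n %/ (L * K)).
  have n_eq := divn_eq n (L * K); have n_mod := ltn_pmod n KL_gt0.
  have rankE (y : 'I_K * 'I_L) : site_rank l (y, m) = offset l m * (L * K) + (y.2 * K + y.1).
    by rewrite /site_rank /=; lia.
  have y_lt (y : 'I_K * 'I_L) : y.2 * K + y.1 < L * K by apply: mul_add_lt.
  case: eqP => [E|/eqP o_neq].
    rewrite muln1; apply: (@hamiltonian2_fill a b _ (n - offset l m * (L * K))) => y.
    by rewrite !ffunE rankE ltn_subRL.
  rewrite muln0 leqn0; apply/eqP.
  case: (ltngtP (offset l m) (n %/ (L * K))) o_neq => // [lt|gt] _.
    rewrite (_ : slice _ m = monochromatic _ b) ?[hamiltonian2 _]hamiltonian_monochromatic //.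
    apply/ffunP => y; rewrite !ffunE rankE ifT //.
    by have := mul_add_lt lt (y_lt y); lia.
  rewrite (_ : slice _ m = monochromatic _ a) ?[hamiltonian2 _]hamiltonian_monochromatic //.
  apply/ffunP => y; rewrite !ffunE rankE ifF //.
  by have := mul_add_lt gt n_mod; lia.
apply: (@leq_trans (\sum_(m < M) (2 * K + 2) * (offset l m == n %/ (L * K)))).
  by apply: leq_sum => m _; apply: slice_le.
case: (ltnP (n %/ (L * K)) M) => [lt|ge].
  rewrite (bigD1 (shift l (n %/ (L * K)))) //= offset_shift (modn_small lt) eqxx muln1 big1.
    by rewrite addn0.
  move=> m m_neq; suff -> : (offset l m == n %/ (L * K)) = false by rewrite muln0.
  apply: contraNF m_neq => /eqP <-; by rewrite shift_offset.
by rewrite big1 // => m _; rewrite ltn_eqF ?muln0 // (leq_trans (offset_lt l m)).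
Qed.

Lemma reach_fill_down (Pr : config -> Prop) a b l n : a != b -> n <= K * L * M ->
  (forall j, j <= n -> Pr (fill a b l j)) -> reach Pr (fill a b l n) (monochromatic _ a).
Proof.
move=> neq; elim: n => [|n IHn] n_le PrF; first by rewrite fill0; apply: reach_refl; rewrite -(fill0 a b l); apply: PrF.
apply: (@reach_step _ _ _ _ (fill a b l n)); first exact: PrF.
  by rewrite config_adj_sym; apply: fill_adj.
by apply: IHn => [|j j_le]; [apply: ltnW | apply: PrF; apply: leqW].
Qed.

Lemma reach_fill_up (Pr : config -> Prop) a b l n : a != b -> n <= K * L * M ->
  (forall j, n <= j <= K * L * M -> Pr (fill a b l j)) ->
  reach Pr (fill a b l n) (monochromatic _ b).
Proof.
move=> neq n_le; rewrite -(subKn n_le); elim: (K * L * M - n) => [|m IHm] PrF.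
  by rewrite subn0 in PrF *; rewrite fill_full; apply: reach_refl; rewrite -(fill_full a b l);
    apply: PrF; rewrite !leqnn.
have [m_lt|m_ge] := ltnP m (K * L * M); last first.
  by move: PrF IHm; rewrite (_ : _ - m.+1 = K * L * M - m); [move=> PrF; apply|lia].
apply: (@reach_step _ _ _ _ (fill a b l (K * L * M - m))).
- by apply: PrF; lia.
- by rewrite (_ : K * L * M - m = (K * L * M - m.+1).+1); [apply: fill_adj => //; lia|lia].
by apply: IHm => j j_bd; apply: PrF; lia.
Qed.

End Fill.

(** Paths of [Z2] end at energy exactly [2 * K + 2], which leaves no room for a third spin. *)
Lemma G2_two_spin (K L q : nat) (a b : 'I_q) (eta : {ffun 'I_K * 'I_L -> 'I_q}) :
  G2 a b eta -> (hamiltonian2 eta + third a b eta <= 2 * K + 2)%N -> two_spin a b eta.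
Proof.
have Z_two c d : Z2 c d eta -> (hamiltonian2 eta + third a b eta <= 2 * K + 2)%N -> two_spin a b eta.
  move=> [T [w [T_gt _ _ [_ wT] HT]]].
  have -> : hamiltonian2 eta = (2 * K + 2)%N by rewrite -wT HT ?T_gt ?leqnn.
  by move=> le; apply: third_eq0; lia.
move=> [[/Z_two//|B]|/Z_two//] _.
apply: (B2_inv (Pr := two_spin a b) _ _ B) => [e|]; first exact: band_two_spin.
by move=> e e' KL; move: e e'; subst L => e e' /transpose_ofE -> _; apply: two_spin_tr.
Qed.

(** * Leaving the set of gate configurations *)

Section GateExit3.
Local Open Scope nat_scope.
Variables (K L M q : nat).
Hypotheses (K_gt5 : 5 < K) (K_le_L : K <= L) (L_le_M : L <= M).
Variable a : 'I_q.
Local Notation site := ('I_K * 'I_L * 'I_M)%type.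
Local Notation config := {ffun site -> 'I_q}.
Implicit Types (b c : 'I_q) (s z : config) (P : {set 'I_M}).
Implicit Type eta : {ffun 'I_K * 'I_L -> 'I_q}.

Let K_gt2 : 2 < K. Proof. exact: leq_trans K_gt5. Qed.
Let L_gt5 : 5 < L. Proof. exact: leq_trans K_le_L. Qed.
Let L_gt2 : 2 < L. Proof. exact: leq_trans L_gt5. Qed.
Let M_gt2 : 2 < M. Proof. exact: leq_trans L_le_M. Qed.

Local Notation gate := (@GAB K L M q [set a]%SET [set~ a]%SET).
Local Notation well c := (@Nhat K L M q (grounds c) gate).

Lemma GammaE : Gamma K L = 2 * K * L + (2 * K + 2).
Proof. by rewrite /Gamma addnA. Qed.

(** From [3 ^ 3 <= 6 ^ 2]. The value 3 is what [gate_card_bounds] rests on. *)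
Lemma mK_ge3 : 3 <= mK K.
Proof.
have lt : 3 < K.+1 by lia.
apply: (@leq_bigmax_cond _ _ _ (Ordinal lt)) => /=.
by apply: (@leq_trans (6 ^ 2)) => //; rewrite leq_exp2r.
Qed.

Lemma gateP s : gate s -> exists b P m0 p (hp : side_preserving K L M p) eta,
  [/\ a != b, m0 \notin P, connected_set P /\ connected_set (m0 |: P) &
      [/\ mK K - 1 <= #|P| <= M - mK K, G2 a b eta & s = permute hp (lift a b P m0 eta)]].
Proof.
move=> [a' [b [i [/set1P -> ]]]]; rewrite !inE => ba i_bd.
move=> [P [Q [/andP[conP conQ] PQ cP /UpsilonE[p [hp [s0 [Gs ->]]]]]]].
have [m0 [m0P QE sE G]] := Gtilde_lift PQ Gs.
exists b, P, m0, p, hp, (slice s0 m0); rewrite eq_sym ba -QE -sE cP.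
by split.
Qed.

Lemma gate_lift b P m0 eta : a != b -> m0 \notin P -> connected_set P ->
  connected_set (m0 |: P) -> mK K - 1 <= #|P| <= M - mK K -> G2 a b eta ->
  gate (lift a b P m0 eta).
Proof.
move=> neq m0P conP conQ P_bd G; exists a, b, #|P|; rewrite !inE eqxx eq_sym neq; split=> //.
exists P, (m0 |: P); split=> //; first by rewrite conP.
  by rewrite /prec finset.subsetUr cardsU1 m0P add1n eqxx.
by apply: Upsilon_sub; apply: lift_Gtilde.
Qed.

Lemma gate_card_bounds P : mK K - 1 <= #|P| <= M - mK K ->
  [/\ 0 < #|P|, 1 < #|P|, #|P| + 1 < M & #|P| + 2 < M].
Proof. by have := mK_ge3; split; lia. Qed.

Lemma gate_ge s : gate s -> 2 * K * L + 2 * K <= hamiltonian3 s.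
Proof.
move=> /gateP[b [P [m0 [p [hp [eta [neq m0P _ [P_bd G ->]]]]]]]].
have [P_gt0 _ P_lt _] := gate_card_bounds P_bd.
rewrite hamiltonian3_permute; apply: leq_trans (lift_ge M_gt2 eta neq m0P P_gt0 P_lt).
by rewrite -addnA leq_add2l; apply: leq_trans (G2_ge K_gt2 L_gt5 neq G) (leq_addr _ _).
Qed.

(** A flip outside the special slice would raise the energy to at least [2 * K * L + 2 * K + 4],
    above [Gamma]. *)
Lemma lift_adj b P m0 eta z : a != b -> m0 \notin P -> mK K - 1 <= #|P| <= M - mK K ->
  G2 a b eta -> config_adj (lift a b P m0 eta) z -> hamiltonian3 z <= Gamma K L ->
  z = lift a b P m0 (slice z m0) /\ config_adj eta (slice z m0).
Proof.
move=> neq m0P P_bd G adj H_le; have [_ P_gt _ P_lt] := gate_card_bounds P_bd.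
have [[y m] z_neq same] := config_adjP _ _ adj.
have [m_eq|m_neq] := eqVneq m m0; last first.
  rewrite eq_sym in z_neq.
  have := lift_flip_outside K_gt2 L_gt5 M_gt2 neq m0P P_gt P_lt m_neq z_neq same.
  have := G2_ge K_gt2 L_gt5 neq G; move: H_le; rewrite /Gamma; lia.
subst m; have sliceE y' : y' != y -> slice z m0 y' = eta y'.
  by move=> y'_neq; rewrite ffunE same ?ffunE /= ?eqxx // xpair_eqE (negbTE y'_neq).
split.
  apply/ffunP => -[y' m]; rewrite !ffunE /=; have [->//|m_neq] := eqVneq m m0.
  by rewrite same ?ffunE /= ?(negbTE m_neq) // xpair_eqE (negbTE m_neq) andbF.
apply/config_adjP; exists y => [|y' y'_neq]; last exact: sliceE.
by move: z_neq; rewrite !ffunE /= eqxx.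
Qed.

(** Hands the energy budget to the special slice: [h = 2 * K + 2] at the level [Gamma], [h = 2 * K]
    at the level of [gate_isolated]. *)
Lemma lift_H_le b P m0 eta h : a != b -> m0 \notin P -> mK K - 1 <= #|P| <= M - mK K ->
  hamiltonian3 (lift a b P m0 eta) <= 2 * K * L + h -> hamiltonian2 eta + third a b eta <= h.
Proof.
move=> neq m0P P_bd H_le; have [P_gt0 _ P_lt _] := gate_card_bounds P_bd.
have := leq_trans (lift_ge M_gt2 eta neq m0P P_gt0 P_lt) H_le.
by rewrite -addnA leq_add2l.
Qed.

Lemma gate_isolated s z : gate s -> hamiltonian3 s <= 2 * K * L + 2 * K ->
  config_adj s z -> 2 * K * L + 2 * K < hamiltonian3 z.
Proof.
move=> /gateP[b [P [m0 [p [hp [eta [neq m0P _ [P_bd G ->]]]]]]]].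
pose hV := side_preserving_inv hp.
rewrite hamiltonian3_permute -{1}(permuteVK hp hV z) config_adj_permute => H_le adj.
rewrite ltnNge -(hamiltonian3_permute hV z); apply/negP => Hz_le.
set z' := permute hV z in adj Hz_le.
have [|zE adj2] := lift_adj neq m0P P_bd G adj.
  by apply: leq_trans Hz_le _; rewrite /Gamma; lia.
have H2 := lift_H_le neq m0P P_bd H_le.
rewrite zE in Hz_le; have H2z := lift_H_le neq m0P P_bd Hz_le.
have := G2_isolated K_gt2 L_gt5 neq G (leq_trans (leq_addr _ _) H2) adj2; lia.
Qed.

(** The special slice has positive energy, so it is not monochromatic and adds a site to the full
    slices of either kind. Strictness separates gates from fillings of exactly [mK K - 1] slices. *)
Lemma gate_counts s : gate s -> hamiltonian3 s <= Gamma K L ->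
  (mK K - 1) * (K * L) < #|[set x | s x != a]%SET| /\
  (mK K - 1) * (K * L) < #|[set x | s x == a]%SET|.
Proof.
move=> /gateP[b [P [m0 [p [hp [eta [neq m0P _ [P_bd G ->]]]]]]]].
rewrite hamiltonian3_permute (card_permute hp _ (predC1 a)) (card_permute hp _ (pred1 a)) GammaE => H_le.
have H2_le := lift_H_le neq m0P P_bd H_le.
have two := G2_two_spin G H2_le; have H2_ge := G2_ge K_gt2 L_gt5 neq G.
have nonconst c : exists y, eta y != c.
  case: (pickP (fun y => eta y != c)) => [y ?|none]; first by exists y.
  move: H2_ge; rewrite (_ : eta = monochromatic _ c).
    by rewrite /hamiltonian2 hamiltonian_monochromatic; lia.
  by apply/ffunP => y; rewrite ffunE; apply/eqP; have /negbFE := none y.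
have [y1 y1a] := nonconst a; have [y2 y2b] := nonconst b.
have y2a : eta y2 = a by apply: two_spin_neq two y2b.
have card_sub (A : {set site}) (S : {set 'I_M}) y : m0 \notin S -> (y, m0) \in A ->
    (forall y' m, m \in S -> (y', m) \in A) -> #|S| * (K * L) < #|A|.
  move=> m0S yA SA; rewrite mulnC.
  have -> : K * L * #|S| = #|finset.setX [set: 'I_K * 'I_L]%SET S|.
    by rewrite cardsX cardsT card_prod !card_ord.
  apply: proper_card; apply/properP; split.
    by apply/fintype.subsetP => -[y' m]; rewrite !inE /= => /SA.
  by exists (y, m0); rewrite // !inE /=.
split.
  apply: (@leq_ltn_trans (#|P| * (K * L))); first by rewrite leq_mul2r; lia.
  apply: (card_sub _ _ y1) => //; first by rewrite !inE ffunE /= eqxx.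
  move=> y' m mP; rewrite !inE ffunE /= mP.
  by have [E|_] := eqVneq m m0; [rewrite E (negbTE m0P) in mP | rewrite eq_sym].
apply: (@leq_ltn_trans (#|~: (m0 |: P)|%SET * (K * L))).
  rewrite leq_mul2r; apply/orP; right; rewrite cardsCs finset.setCK cardsU1 m0P card_ord.
  by have := mK_ge3; lia.
apply: (card_sub _ _ y2) => [||y' m]; first by rewrite !inE eqxx.
  by rewrite !inE ffunE /= eqxx y2a.
by rewrite !inE negb_or ffunE /= => /andP[/negbTE -> /negbTE ->].
Qed.

(** The constraint along the paths of [Nhat] for this gate. *)
Definition free s : Prop := hamiltonian3 s <= Gamma K L /\ ~ gate s.

Lemma wellP (c : {set 'I_q}) b s : b \in c -> reach free s (monochromatic _ b) -> well c s.
Proof. by move=> bc r; apply/nbhd_hatE; exists (monochromatic _ b) => //; exists b. Qed.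

Lemma RhatP b i P s : a != b -> connected_set P -> #|P| = i ->
  reach free s (slab K L a b P) -> RhatAB [set a]%SET [set~ a]%SET i s.
Proof.
move=> neq conP cP r; apply/nbhd_hatE; exists (slab K L a b P) => //.
exists a, b; split; rewrite ?inE ?eqxx // 1?eq_sym //.
by apply: Upsilon_sub; exists P.
Qed.

(** The sizes [mK K - 1] and [M - mK K + 1], beyond the indices of [HAB], arise when the special
    slice is emptied in the thinnest gate or filled in the thickest. *)
Lemma slab_exit b P s : a != b -> connected_set P -> mK K - 1 <= #|P| <= M - mK K + 1 ->
  reach free s (slab K L a b P) ->
  [\/ well [set a]%SET s, well [set~ a]%SET s |
      exists2 i, mK K <= i <= M - mK K & RhatAB [set a]%SET [set~ a]%SET i s].
Proof.
move=> neq conP P_bd r; have m3 := mK_ge3.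
have P_bd' : 0 < #|P| < M by lia.
have [l PE] := connected_arc conP P_bd'.
have slabE : slab K L a b P = fill K L a b l (K * L * #|P|) by rewrite {1}PE slab_fill.
have n_le : K * L * #|P| <= K * L * M by rewrite leq_mul2l; lia.
have [low|P_ge] := ltnP #|P| (mK K).
  constructor 1; apply: (@wellP _ a); first by rewrite inE.
  apply: reach_trans r _; rewrite slabE; apply: reach_fill_down => // j j_le.
  split; first exact: hamiltonian3_fill.
  move=> g; have [] := gate_counts g (hamiltonian3_fill K_gt2 L_gt2 M_gt2 a b l j).
  suff : #|[set x | fill K L a b l j x != a]%SET| <= (mK K - 1) * (K * L) by lia.
  apply: leq_trans (fill_count_neq K_gt2 L_gt2 M_gt2 a b l j) (leq_trans j_le _).
  by rewrite mulnC leq_mul2r; lia.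
have [high|P_le] := ltnP (M - mK K) #|P|; last first.
  by constructor 3; exists #|P|; [lia | exact: RhatP r].
constructor 2; apply: (@wellP _ b); first by rewrite !inE eq_sym.
apply: reach_trans r _; rewrite slabE; apply: reach_fill_up => // j /andP[j_ge j_le].
split; first exact: hamiltonian3_fill.
move=> g; have [_] := gate_counts g (hamiltonian3_fill K_gt2 L_gt2 M_gt2 a b l j).
suff : #|[set x | fill K L a b l j x == a]%SET| <= (mK K - 1) * (K * L) by lia.
apply: leq_trans (fill_count_eq K_gt2 L_gt2 M_gt2 l neq j_le) _.
have -> : (mK K - 1) * (K * L) = K * L * M - K * L * #|P|.
  by rewrite -mulnBr mulnC; congr (_ * _); lia.
exact: leq_sub2l.
Qed.

Lemma gate_lift_exit b P m0 eta z : a != b -> m0 \notin P -> connected_set P ->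
  connected_set (m0 |: P) -> mK K - 1 <= #|P| <= M - mK K -> G2 a b eta ->
  config_adj (lift a b P m0 eta) z ->
  hamiltonian3 (lift a b P m0 eta) <= Gamma K L -> free z ->
  [\/ well [set a]%SET z, well [set~ a]%SET z |
      exists2 i, mK K <= i <= M - mK K & RhatAB [set a]%SET [set~ a]%SET i z].
Proof.
move=> neq m0P conP conQ P_bd G adj H_le [Hz_le nGz].
have [zE adj2] := lift_adj neq m0P P_bd G adj Hz_le.
rewrite GammaE in H_le Hz_le; have H2_le := lift_H_le neq m0P P_bd H_le.
rewrite zE in Hz_le; have H2z_le := lift_H_le neq m0P P_bd Hz_le.
set eta' := slice z m0 in zE adj2 H2z_le *.
have nG : ~ G2 a b eta' by move=> G'; apply: nGz; rewrite zE; apply: gate_lift.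
case: (gate_exit K_gt2 L_gt5 neq G adj2 H2_le H2z_le) => [lo|//].
(* The descent in the slice lifts to energy at most [2 * K * L + 2 * K], where by [gate_isolated] no
   step leads into a gate. *)
have lift_reach c : reach (low a b (2 * K)) eta' (monochromatic _ c) ->
    reach free z (lift a b P m0 (monochromatic _ c)).
  move=> r; rewrite zE; apply: (reach_sub (Pr := fun s => hamiltonian3 s <= 2 * K * L + 2 * K /\ ~ gate s)).
    by move=> s [s_le ns]; split=> //; apply: leq_trans s_le _; rewrite /Gamma; lia.
  apply: reach_avoid.
  - move=> s s' Hs Hs' ss' gs'; rewrite config_adj_sym in ss'.
    by have := gate_isolated gs' Hs' ss'; rewrite ltnNge Hs.
  - by rewrite -zE.
  apply: reach_map r => [e e' /config_adjP[y y_neq same]|e [two H_e]].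
    apply/config_adjP; exists (y, m0); first by rewrite !ffunE /= eqxx.
    move=> [y' m]; rewrite !ffunE xpair_eqE negb_and /=.
    by have [_|//] := eqVneq m m0; rewrite orbF => /same.
  by apply: leq_trans (lift_le M_gt2 m0P conP conQ two) _; rewrite leq_add2l.
have m3 := mK_ge3.
case: (descent K_gt2 L_gt5 K_le_L neq lo nG) => /lift_reach r.
  apply: (@slab_exit b P) => //; first by lia.
  rewrite (_ : slab _ _ _ _ _ = lift a b P m0 (monochromatic _ a)) //.
  apply/ffunP => -[y m]; rewrite !ffunE /=.
  by have [->|//] := eqVneq m m0; rewrite (negbTE m0P).
apply: (@slab_exit b (m0 |: P)) => //; first by rewrite cardsU1 m0P; lia.
rewrite (_ : slab _ _ _ _ _ = lift a b P m0 (monochromatic _ b)) //.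
apply/ffunP => -[y m]; rewrite !ffunE /= !inE.
by have [->|//] := eqVneq m m0.
Qed.

Lemma grounds_permute (c : {set 'I_q}) p (hp : side_preserving K L M p) s :
  grounds c s -> grounds c (permute hp s).
Proof. by move=> [b bc <-]; exists b => //; rewrite monochromatic_permute. Qed.

Lemma gate_exit3 s z : gate s -> hamiltonian3 s <= Gamma K L -> config_adj s z -> free z ->
  [\/ well [set a]%SET z, well [set~ a]%SET z |
      exists2 i, mK K <= i <= M - mK K & RhatAB [set a]%SET [set~ a]%SET i z].
Proof.
move=> /gateP[b [P [m0 [p [hp [eta [neq m0P [conP conQ] [P_bd G ->]]]]]]]].
pose hV := side_preserving_inv hp.
rewrite hamiltonian3_permute -(permuteVK hp hV z) config_adj_permute => H_le adj [Hz_le nGz].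
set z' := permute hV z in adj Hz_le nGz *.
rewrite hamiltonian3_permute in Hz_le.
have back (A : set config) : (forall y, A y -> A (permute hp y)) -> Nhat A gate z' ->
    Nhat A gate (permute hp z').
  move=> A_perm; apply: Nhat_permute => // y g.
  by rewrite -(permuteK hp hV y); apply: GAB_permute.
have nGz' : ~ gate z' by move=> g; apply: nGz; apply: GAB_permute.
case: (gate_lift_exit neq m0P conP conQ P_bd G adj H_le (conj Hz_le nGz')) => [W|W|[i i_bd Rh]].
- by constructor 1; apply: back W => y; apply: grounds_permute.
- by constructor 2; apply: back W => y; apply: grounds_permute.
- by constructor 3; exists i => //; apply: back Rh => y; apply: RAB_permute.
Qed.

Definition covered s : Prop :=
  [\/ well [set a]%SET s, well [set~ a]%SET s | HAB [set a]%SET [set~ a]%SET s].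

Lemma Nhat_step (A : set config) s z : free z -> config_adj s z -> Nhat A gate s -> Nhat A gate z.
Proof.
move=> fz adj /nbhd_hatE[y Ay r]; apply/nbhd_hatE; exists y => //.
by apply: reach_step r => //; rewrite config_adj_sym.
Qed.

Lemma covered_step s z : hamiltonian3 s <= Gamma K L -> hamiltonian3 z <= Gamma K L ->
  config_adj s z -> covered s -> covered z.
Proof.
move=> Hs Hz adj cov; have [gz|ngz] := pselect (gate z).
  by constructor 3; left.
have fz : free z by [].
case: cov => [W|W|[gs|[i /= i_bd Rh]]].
- by constructor 1; apply: Nhat_step W.
- by constructor 2; apply: Nhat_step W.
- case: (gate_exit3 gs Hs adj fz) => [W|W|[i i_bd Rh]]; [by constructor 1|by constructor 2|].
  by constructor 3; right; exists i.
- by constructor 3; right; exists i => //; apply: Nhat_step Rh.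
Qed.

Lemma low_free s : hamiltonian3 s < 2 * K * L + 2 * K -> free s.
Proof.
move=> H_lt; split; first by rewrite /Gamma; lia.
by move/gate_ge; rewrite leqNgt H_lt.
Qed.

(** A transition path has to end strictly before another ground state is hit, so the configuration
    just before the hit must already lie in the well. It has at most one spin [a], too few for a
    gate. *)
Lemma ground_neighbour b s : a != b -> config_adj s (monochromatic _ b) ->
  hamiltonian3 s <= Gamma K L -> well [set~ a]%SET s.
Proof.
move=> neq adj H_le; apply: (@wellP _ b); first by rewrite !inE eq_sym.
have m3 := mK_ge3; have KL_gt : 1 < K * L by rewrite (@ltn_mul 1 1) //; lia.
apply: (@reach_step _ _ _ _ (monochromatic _ b)) => //.
  split=> // g; have [_] := gate_counts g H_le; have [x _ same] := config_adjP _ _ adj.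
  suff : #|[set y | s y == a]%SET| <= 1.
    move=> le1 lt; have := leq_trans lt le1; rewrite ltnS leqn0 muln_eq0; lia.
  rewrite -(cards1 x); apply/subset_leq_card/fintype.subsetP => y; rewrite !inE.
  apply: contraTT => /same; rewrite ffunE => <-; by rewrite eq_sym.
apply: reach_refl; apply: low_free; rewrite /hamiltonian3 hamiltonian_monochromatic.
by lia.
Qed.

Lemma exists_transition_path (y : nat -> config) (b : 'I_q) (N : nat) : a != b ->
  y 0 = monochromatic _ a -> y N = monochromatic _ b ->
  (forall i, i <= N -> hamiltonian3 (y i) <= Gamma K L) ->
  is_path y N ->
  exists i j, [/\ i <= j, j < N &
    transition_path [set a]%SET [set~ a]%SET (fun n => y (i + n)) (j - i)].
Proof.
move=> neq y0 yN H_le y_path.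
have N_gt0 : 0 < N.
  have x0 : 'I_K * 'I_L * 'I_M by split; [split|]; apply: (Ordinal (m := 0)); lia.
  case: N yN {H_le y_path} => // yN; case/eqP: neq.
  by have := congr1 (fun s : config => s x0) yN; rewrite y0 !ffunE.
have well0 : well [set a]%SET (y 0).
  apply: (@wellP _ a); rewrite ?inE // y0; apply: reach_refl; apply: low_free.
  by rewrite /hamiltonian3 hamiltonian_monochromatic; lia.
have cov i : i < N -> covered (y i).
  elim: i => [|i IHi] lt; first by constructor 1.
  by apply: covered_step (IHi (ltnW lt)); [apply: H_le; lia|apply: H_le; lia|apply: y_path; lia].
have wellN : well [set~ a]%SET (y N.-1).
  apply: (@ground_neighbour b) => //; last by apply: H_le; lia.
  by rewrite -yN -{2}(prednK N_gt0); apply: y_path; rewrite prednK.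
have exj : exists j, `[< well [set~ a]%SET (y j) >] by exists N.-1; apply/asboolP.
case: (ex_minnP exj) => j /asboolP well_j j_min.
have j_lt : j < N by have /j_min := asboolT wellN; lia.
have exi : exists i, (i <= j) && `[< well [set a]%SET (y i) >].
  by exists 0; rewrite leq0n; apply/asboolP.
have i_bd i : (i <= j) && `[< well [set a]%SET (y i) >] -> i <= j by case/andP.
case: (ex_maxnP exi i_bd) => i /andP[ij /asboolP well_i] i_max.
exists i, j; split=> //; split.
- by move=> t lt; rewrite addnS; apply: y_path; lia.
- by rewrite addn0.
- by rewrite subnKC.
(* Strictly between [i] and [j] the two wells are excluded by the extremality of [i] and [j], so
   [covered] leaves only [HAB]. *)
move=> t t_bd; case: (cov (i + t)); [lia|move=> W|move=> W|by []].
  have : (i + t <= j) && `[< well [set a]%SET (y (i + t)) >].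
    by apply/andP; split; [lia | apply/asboolP].
  by move/i_max; lia.
by have /j_min := asboolT W; lia.
Qed.

End GateExit3.

(** * Potential theory on a finite network *)

Section Network.
Variables (R : realType) (X : finType) (c : X -> X -> R).
Hypotheses (c_sym : forall x y, c x y = c y x) (c_ge0 : forall x y, 0 <= c x y).
(** Connectivity, stated for functions because it is applied to one of vanishing Dirichlet
    energy. *)
Hypothesis c_conn : forall f : X -> R,
  (forall x y, 0 < c x y -> f x = f y) -> forall x y, f x = f y.
Implicit Types (f g : X -> R) (D : {set X}).

Definition laplacian f x : R := \sum_y c x y * (f x - f y).

(** Green's identity: symmetrize the double sum under the exchange of [x] and [y]. *)
Lemma dirichlet_form f g : (\sum_x f x * laplacian g x) *+ 2 =
  \sum_x \sum_y c x y * ((f x - f y) * (g x - g y)).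
Proof.
have E : \sum_x f x * laplacian g x = \sum_x \sum_y c x y * (f x * (g x - g y)).
  by apply: eq_bigr => x _; rewrite /laplacian mulr_sumr; apply: eq_bigr => y _; ring.
rewrite mulr2n {1}E E [X in _ + X]exchange_big /= -big_split /=.
apply: eq_bigr => x _; rewrite -big_split /=; apply: eq_bigr => y _.
by rewrite [c y x]c_sym; ring.
Qed.

Lemma laplacian_sym f g : \sum_x f x * laplacian g x = \sum_x g x * laplacian f x.
Proof.
have two_neq0 : 2%:R != 0 :> R by rewrite pnatr_eq0.
apply: (mulIf two_neq0); rewrite !mulr_natr !dirichlet_form.
by apply: eq_bigr => x _; apply: eq_bigr => y _; rewrite [X in _ * X]mulrC.
Qed.

(** Minimum principle. Pairing [laplacian f] with the negative part [k] of [f] shows that [k] has no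
    Dirichlet energy, so it is constant, and it vanishes at [x1]. *)
Lemma comparison D f x1 : x1 \notin D ->
  (forall x, x \in D -> 0 <= laplacian f x) -> (forall x, x \notin D -> 0 <= f x) ->
  forall x, 0 <= f x.
Proof.
move=> x1D Lf fD; pose k x := Num.max (- f x) 0.
have k_ge0 x : 0 <= k x by rewrite le_max lexx orbT.
have kf_ge0 : 0 <= \sum_x k x * laplacian f x.
  apply: sumr_ge0 => x _; have [xD|xD] := boolP (x \in D).
    by rewrite mulr_ge0 ?Lf.
  by rewrite /k max_r ?mul0r // oppr_le0 fD.
have k_contract x y : (k x - k y) * (f x - f y) <= - (k x - k y) ^+ 2.
  by rewrite /k; case: (leP (- f x) 0) => fx; case: (leP (- f y) 0) => fy; nra.
have energy0 : \sum_x \sum_y c x y * (k x - k y) ^+ 2 <= 0.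
  have : 0 <= \sum_x \sum_y c x y * ((k x - k y) * (f x - f y)).
    by rewrite -dirichlet_form mulrn_wge0.
  suff : \sum_x \sum_y c x y * ((k x - k y) * (f x - f y)) <=
         - \sum_x \sum_y c x y * (k x - k y) ^+ 2 by lra.
  rewrite -sumrN; apply: ler_sum => x _; rewrite -sumrN; apply: ler_sum => y _.
  by rewrite -mulrN ler_wpM2l.
have k_same x y : 0 < c x y -> k x = k y.
  move=> cxy; have term_ge0 u v : 0 <= c u v * (k u - k v) ^+ 2.
    by rewrite mulr_ge0 ?sqr_ge0.
  have term_le : c x y * (k x - k y) ^+ 2 <= 0.
    apply: le_trans energy0; rewrite (bigD1 x) //= (bigD1 y) //= -addrA lerDl addr_ge0 //.
      by apply: sumr_ge0.
    by apply: sumr_ge0 => u _; apply: sumr_ge0.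
  have /eqP : c x y * (k x - k y) ^+ 2 = 0 by apply/le_anti; rewrite term_le term_ge0.
  by rewrite mulf_eq0 gt_eqF //= sqrf_eq0 subr_eq0 => /eqP.
move=> x; have : k x = 0.
  by rewrite (c_conn k_same x x1) /k max_r // oppr_le0 fD.
by rewrite /k => kx; have := k_ge0 x; have : - f x <= k x by [rewrite /k le_max lexx]; rewrite /k kx; lra.
Qed.

(** A square linear system: [comparison], applied to a homogeneous solution and to its negative,
    gives uniqueness, hence existence. One function [phi] encodes the sources inside [D] and the
    values outside. *)
Lemma dirichlet_problem D x1 (phi : X -> R) : x1 \notin D ->
  exists g, (forall x, x \notin D -> g x = phi x) /\
            (forall x, x \in D -> laplacian g x = phi x).
Proof.
move=> x1D.
pose op g x := if x \in D then laplacian g x else g x.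
suff [g gE] : exists g, forall x, op g x = phi x.
  exists g; split=> x xD; have := gE x; rewrite /op ?xD //.
  by rewrite (negbTE xD).
have op_inj g : (forall x, op g x = 0) -> forall x, g x = 0.
  move=> g0; have half g' : (forall x, op g' x = 0) -> forall x, 0 <= g' x.
    move=> g'0; apply: (comparison x1D) => x xD; have := g'0 x; rewrite /op ?xD.
      by move=> ->.
    by rewrite (negbTE xD) => ->.
  have opN x : op (fun y => - g y) x = 0.
    have := g0 x; rewrite /op; case: ifP => _; last by move=> ->; rewrite oppr0.
    move=> E; transitivity (- laplacian g x); last by rewrite E oppr0.
    by rewrite /laplacian -sumrN; apply: eq_bigr => y _; ring.
  by move=> x; apply/le_anti; rewrite (half g) // andbT -oppr_ge0 (half _ opN).
pose n := #|X|.
(* The matrix acts on row vectors from the right, so column [j] holds the equation at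
   [enum_val j]. *)
pose A : 'M[R]_n := \matrix_(i, j) let x := enum_val i in let y := enum_val j in
  if y \in D then (x == y)%:R * (\sum_z c y z) - c y x else (x == y)%:R.
pose fn (u : 'rV[R]_n) x := u 0 (enum_rank x).
have sum_delta g y : \sum_x g x * (x == y)%:R = g y.
  rewrite (bigD1 y) //= eqxx mulr1 big1 ?addr0 // => x /negbTE ->; exact: mulr0.
have opE u j : (u *m A) 0 j = op (fn u) (enum_val j).
  rewrite !mxE (reindex_onto enum_rank enum_val) /=; last by move=> i _; rewrite enum_valK.
  rewrite (eq_bigl xpredT) => [|x]; last by rewrite enum_rankK eqxx.
  rewrite /op; case: ifP => yD; last first.
    by rewrite -[RHS]sum_delta; apply: eq_bigr => x _; rewrite !mxE /= enum_rankK yD.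
  under eq_bigr do rewrite !mxE /= enum_rankK yD mulrBr mulrA.
  rewrite sumrB -mulr_suml sum_delta /laplacian.
  rewrite mulr_sumr -sumrB; apply: eq_bigr => x _; rewrite /fn; ring.
have A_unit : A \in unitmx.
  rewrite -row_free_unit -kermx_eq0; apply/rowV0P => v /sub_kermxP vA.
  apply/rowP => i; rewrite mxE -[i]enum_valK; apply: (op_inj (fn v)) => x.
  by rewrite -[x]enum_rankK -opE vA mxE.
exists (fn ((\row_j phi (enum_val j)) *m invmx A)) => x.
by rewrite -[x]enum_rankK -opE mulmxKV // mxE.
Qed.

(* [g], the Green function of [D] with pole [s] normalized to unit flux, has energy
   [g s]; Cauchy-Schwarz along the path bounds [g s] by the path resistance, and
   reciprocity expresses [h s] as the flux of [g] into [B]. *)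
Lemma hitting_bound D (B : {set X}) s h (w : nat -> X) (T : nat) (gam eps : R) :
  s \in D -> (forall x, x \in D -> x \notin B) ->
  (forall x, x \in D -> laplacian h x = 0) -> (forall x, x \notin D -> h x = (x \in B)%:R) ->
  w 0%N = s -> w T \notin D -> 0 < gam ->
  (forall i, (i < T)%N -> gam <= c (w i) (w i.+1)) ->
  \sum_(x in B) \sum_y c x y <= eps ->
  h s <= 2 * T%:R ^+ 2 / gam * eps.
Proof.
move=> sD DB Lh hD w0 wT gam_gt0 c_w B_le.
have [g [g_out g_in]] := @dirichlet_problem D (w T) (fun x => (x == s)%:R) wT.
have g0 x : x \notin D -> g x = 0.
  by move=> xD; rewrite g_out //; case: eqP => // E; rewrite E sD in xD.
have g_ge0 x : 0 <= g x.
  by apply: (@comparison D g (w T)) => // [y yD|y yD]; rewrite ?g_in ?g0 ?ler0n.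
have g_le x : g x <= g s.
  rewrite -subr_ge0; apply: (@comparison (D :\ s)%SET (fun x => g s - g x) s).
  - by rewrite !inE eqxx.
  - move=> y; rewrite !inE => /andP[y_neq yD].
    have E : laplacian (fun x => g s - g x) y = - laplacian g y.
      by rewrite /laplacian -sumrN; apply: eq_bigr => z _; ring.
    by rewrite E g_in // (negbTE y_neq) oppr0.
  move=> y; rewrite !inE negb_and negbK => /orP[/eqP ->|yD]; first by rewrite subrr.
  by rewrite (g0 y) // subr0.
(* In the symmetry of the Laplacian for [h] and [g], only the unit source at [s] survives inside
   [D], and only the values 1 of [h] on [B] outside. *)
have flux : h s = \sum_(x in B) \sum_y c x y * g y.
  have := laplacian_sym h g.
  rewrite [RHS]big1 => [|x _]; last first.
    by have [xD|xD] := boolP (x \in D); [rewrite Lh // mulr0 | rewrite g0 // mul0r].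
  rewrite (bigID (mem D)) /= (bigD1 s) //= g_in // eqxx mulr1.
  rewrite big1 ?addr0 => [|x /andP[xD x_neq]]; last by rewrite g_in // (negbTE x_neq) mulr0.
  move=> E; have {}E : h s = - \sum_(x | x \notin D) h x * laplacian g x by lra.
  rewrite E -sumrN [RHS]big_mkcond [LHS]big_mkcond; apply: eq_bigr => x _.
  have [xD|xD] := boolP (x \in D).
    by rewrite (negbTE (DB x xD)).
  rewrite hD //=; case: (x \in B); rewrite ?mul1r ?mul0r ?oppr0 //.
  rewrite /laplacian -sumrN; apply: eq_bigr => y _; rewrite (g0 x) //; ring.
have g_energy : \sum_x \sum_y c x y * (g x - g y) ^+ 2 = g s *+ 2.
  have <- : \sum_x g x * laplacian g x = g s.
    rewrite (bigD1 s) //= g_in // eqxx mulr1 big1 ?addr0 // => x x_neq.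
    have [xD|xD] := boolP (x \in D); last by rewrite g0 // mul0r.
    by rewrite g_in // (negbTE x_neq) mulr0.
  by rewrite dirichlet_form.
have drop_le i : (i < T)%N -> gam * (g (w i) - g (w i.+1)) ^+ 2 <= g s *+ 2.
  move=> iT; apply: (@le_trans _ _ (c (w i) (w i.+1) * (g (w i) - g (w i.+1)) ^+ 2)).
    by apply: ler_wpM2r; rewrite ?sqr_ge0 ?c_w.
  rewrite -g_energy (bigD1 (w i)) //= (bigD1 (w i.+1)) //= -addrA lerDl addr_ge0 //.
    by apply: sumr_ge0 => y _; rewrite mulr_ge0 ?sqr_ge0.
  by apply: sumr_ge0 => x _; apply: sumr_ge0 => y _; rewrite mulr_ge0 ?sqr_ge0.
have g_s : g s = \sum_(i < T) (g (w i) - g (w i.+1)).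
  transitivity (- \sum_(0 <= i < T) (g (w i.+1) - g (w i))).
    by rewrite (@telescope_sumr _ 0 T (g \o w)) //= w0 (g0 _ wT) sub0r opprK.
  by rewrite big_mkord -sumrN; apply: eq_bigr => i _; rewrite opprB.
have resistance : g s <= 2 * T%:R ^+ 2 / gam.
  rewrite leNgt; apply/negP => gt.
  have T_gt0 : (0 < T)%N.
    case: (T) wT w0 => // wT' w0'; by rewrite w0' sD in wT'.
  (* Cauchy-Schwarz in pigeonhole form: some step drops by at least the average [g s / T], and the
     energy of that edge alone is at most [2 * g s]. *)
  have [i drop] : exists i : 'I_T, g s / T%:R <= g (w i) - g (w i.+1).
    apply/existsP; apply/contraT; rewrite negb_exists => /forallP none.
    have : \sum_(i < T) (g (w i) - g (w i.+1)) < \sum_(i < T) g s / T%:R.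
      apply: ltr_sum => [|i _]; first by apply/hasP; exists (Ordinal T_gt0); rewrite ?mem_index_enum.
      by have := none i; rewrite -ltNge.
    rewrite -g_s sumr_const card_ord -[ltRHS]mulr_natr divfK ?ltxx //.
    by rewrite pnatr_eq0 -lt0n.
  have gs_gt0 : 0 < g s.
    by apply: le_lt_trans gt; rewrite divr_ge0 ?mulr_ge0 ?sqr_ge0 ?ler0n // ltW.
  have T_gt0' : 0 < T%:R :> R by rewrite ltr0n.
  have : gam * (g s / T%:R) ^+ 2 <= g s *+ 2.
    apply: le_trans (drop_le i (ltn_ord i)); rewrite ler_pM2l //.
    by rewrite ler_sqr ?nnegrE //; [rewrite divr_ge0 ?ltW | apply: le_trans drop; rewrite divr_ge0 ?ltW].
  rewrite expr_div_n mulrA ler_pdivrMr ?exprn_gt0 // => le.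
  move: gt; rewrite ltr_pdivrMr // => gt.
  have : g s * (g s * gam) <= g s * (2 * T%:R ^+ 2) by lra.
  by rewrite ler_pM2l // leNgt gt.
rewrite flux; apply: (@le_trans _ _ (\sum_(x in B) \sum_y c x y * g s)).
  by apply: ler_sum => x _; apply: ler_sum => y _; apply: ler_wpM2l.
under eq_bigr do rewrite -mulr_suml.
rewrite -mulr_suml mulrC; apply: ler_pM => //.
by apply: sumr_ge0 => x _; apply: sumr_ge0.
Qed.

End Network.

(** * Jump chains *)

Section JumpChain.
Variables (R : realType) (d : measure_display) (Omega : measurableType d).
Variables (P : probability Omega R) (X : finType) (Y : nat -> Omega -> X).
Hypothesis Y_meas : forall n y, measurable (Y n @^-1` [set y]).
Implicit Types (y : nat -> X) (Q : (nat -> X) -> Prop) (E F : set Omega).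

Definition pr E : R := fine (P E).

Lemma prE E : measurable E -> P E = (pr E)%:E.
Proof. by move=> mE; rewrite /pr fineK // fin_num_measure. Qed.

Lemma pr_ge0 E : 0 <= pr E.
Proof. exact: fine_ge0. Qed.

Lemma pr_le E F : measurable E -> measurable F -> E `<=` F -> pr E <= pr F.
Proof.
move=> mE mF EF; rewrite -lee_fin -!prE //.
by apply: le_measure => //; rewrite inE.
Qed.

Lemma pr_le1 E : measurable E -> pr E <= 1.
Proof. by move=> mE; rewrite -lee_fin -prE // probability_le1. Qed.

Lemma pr_setU E F : measurable E -> measurable F -> pr (E `|` F) <= pr E + pr F.
Proof.
move=> mE mF; rewrite -lee_fin EFinD -!prE //; last exact: measurableU.
exact: measureU2.
Qed.

Lemma pr_set0 : pr set0 = 0.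
Proof. by rewrite /pr measure0. Qed.

Lemma pr_setC E : measurable E -> pr (~` E) = 1 - pr E.
Proof.
move=> mE; have := probability_setC P mE; rewrite prE ?prE //; last exact: measurableC.
by rewrite -EFinB => -[].
Qed.

Lemma pr_total E k : measurable E -> pr E = \sum_(v : X) pr (E `&` Y k @^-1` [set v]).
Proof.
move=> mE; apply: EFin_inj; rewrite -prE // -sumEFin.
transitivity (P (\bigcup_(v in [set` index_enum X]) (E `&` Y k @^-1` [set v]))).
  congr (P _); apply/seteqP; split=> w; first by move=> Ew; exists (Y k w); rewrite //= mem_index_enum.
  by case=> v _ [].
rewrite measure_fin_bigcup //; last 2 first.
- by move=> u v _ _ [w [[_ <-] [_ <-]]].
- by move=> v _; apply: measurableI.
rewrite -fsbig_seq ?index_enum_uniq //; apply: eq_bigr => v _.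
exact: (prE (measurableI _ _ mE (Y_meas k v))).
Qed.

Definition event Q : set Omega := [set w | Q (fun i => Y i w)].
Definition finitary n Q : Prop :=
  forall y y', (forall i, (i <= n)%N -> y i = y' i) -> Q y -> Q y'.
Definition cylinder k y : set Omega := [set w | forall i, (i < k)%N -> Y i w = y i].
Definition update y k v : nat -> X := fun i => if i == k then v else y i.

Lemma cylinderS k y v : cylinder k.+1 (update y k v) = cylinder k y `&` Y k @^-1` [set v].
Proof.
apply/seteqP; split=> w.
  move=> C; split=> [i ik|]; last by have := C k (ltnSn k); rewrite /update eqxx.
  by rewrite C ?ltnS 1?ltnW // /update ltn_eqF.
move=> [C /= Yk] i; rewrite ltnS leq_eqVlt /update => /predU1P[->|ik].
  by rewrite eqxx.
by rewrite ltn_eqF // C.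
Qed.

Lemma cylinder_meas k y : measurable (cylinder k y).
Proof.
elim: k y => [|k IHk] y; first by rewrite (_ : cylinder 0 y = setT) //; apply/seteqP; split.
have -> : cylinder k.+1 y = cylinder k.+1 (update y k (y k)).
  by apply/seteqP; split=> w C i /C; rewrite /update; case: eqP => // ->.
by rewrite cylinderS; apply: measurableI.
Qed.

Lemma cylinder_finitary n Q y : finitary n Q ->
  cylinder n.+1 y `&` event Q = if `[< Q y >] then cylinder n.+1 y else set0.
Proof.
move=> finQ; case: asboolP => Qy; apply/seteqP; split=> w //; first by case.
  by move=> C; split=> //; apply: finQ Qy => i ik; rewrite C.
by case=> C Qw; case: Qy; apply: finQ Qw => i ik; rewrite C.
Qed.

Lemma cylinder_split k y E :
  cylinder k y `&` E = \bigcup_(v in [set: X]) (cylinder k.+1 (update y k v) `&` E).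
Proof.
apply/seteqP; split=> w.
  by move=> [C Ew]; exists (Y k w) => //; rewrite cylinderS.
by case=> v _; rewrite cylinderS => -[[C _] Ew].
Qed.

(** A cylinder fixing [n + 1] coordinates decides [Q], and one fixing fewer is a finite union over
    the next coordinate. *)
Lemma event_meas n Q : finitary n Q -> measurable (event Q).
Proof.
move=> finQ; suff all m y : measurable (cylinder (n.+1 - m) y `&` event Q).
  have [->//|/set0P[w Ew]] := eqVneq (event Q) set0.
  have := all n.+1 (fun i => Y i w); rewrite subnn.
  by rewrite (_ : cylinder 0 _ `&` _ = event Q) //; apply/seteqP; split=> [u []//|u Eu]; split.
elim: m y => [|m IHm] y.
  rewrite subn0 cylinder_finitary //; case: ifP => _ //; exact: cylinder_meas.
have [m_le|m_gt] := leqP m n; last first.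
  (* Truncated subtraction: both sides are 0. *)
  by rewrite (_ : n.+1 - m.+1 = n.+1 - m)%N //; lia.
rewrite cylinder_split; apply: fin_bigcup_measurable => [|v _]; first exact: finite_finset.
by rewrite (_ : (n.+1 - m.+1).+1 = n.+1 - m)%N //; lia.
Qed.

Variables (p : X -> X -> R) (s : X).
Hypothesis p_ge0 : forall x x', 0 <= p x x'.
Hypothesis P_cylinder : forall n y, P (cylinder n.+1 y) =
  ((y 0%N == s)%:R * \prod_(i < n) p (y i) (y i.+1))%:E.

(* Downward induction on the number of coordinates fixed by a cylinder. *)
Lemma markov_property n Q x z : finitary n Q -> (forall y, Q y -> y n = x) ->
  pr (event Q `&` Y n.+1 @^-1` [set z]) = pr (event Q) * p x z.
Proof.
move=> finQ Qx.
have mQ := event_meas finQ; have mQz := measurableI _ _ mQ (Y_meas n.+1 z).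
suff all m y : (m <= n.+1)%N ->
    pr (cylinder (n.+1 - m) y `&` (event Q `&` Y n.+1 @^-1` [set z])) =
    pr (cylinder (n.+1 - m) y `&` event Q) * p x z.
  have := all n.+1 (fun=> x) (leqnn _); rewrite subnn.
  have -> : cylinder 0 (fun=> x) = setT by apply/seteqP; split.
  by rewrite !setTI.
elim: m y => [|m IHm] y m_le.
  rewrite subn0 setIA cylinder_finitary //; case: asboolP => Qy; last by rewrite set0I pr_set0 mul0r.
  have -> : cylinder n.+1 y `&` Y n.+1 @^-1` [set z] = cylinder n.+2 (update y n.+1 z).
    by rewrite cylinderS.
  have u_lt i : (i <= n)%N -> update y n.+1 z i = y i.
    by move=> i_le; rewrite /update ltn_eqF.
  have u_last : update y n.+1 z n.+1 = z by rewrite /update eqxx.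
  rewrite /pr !P_cylinder /= big_ord_recr /= u_last !u_lt // (Qx _ Qy) mulrA.
  congr (_ * _ * _); apply: eq_bigr => i _; rewrite !u_lt //; exact: ltnW.
have E : (n.+1 - m.+1).+1 = (n.+1 - m)%N by lia.
rewrite (pr_total (n.+1 - m.+1)); last by apply: measurableI => //; apply: cylinder_meas.
rewrite [X in _ = X * _](pr_total (n.+1 - m.+1)); last by apply: measurableI => //; apply: cylinder_meas.
rewrite mulr_suml; apply: eq_bigr => v _.
rewrite ![_ `&` _ `&` Y (n.+1 - m.+1) @^-1` _]setIAC -!cylinderS E.
by apply: IHm; apply: ltnW.
Qed.

Variables (D A B : {set X}).
Hypothesis s_D : s \in D.
Hypothesis A_out : forall x, x \in A = (x \notin D) && (x \notin B).
Hypothesis B_out : forall x, x \in D -> x \notin B.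

(** Positivity of the jump probabilities is built in so that trajectories in the event are genuine
    paths; by [pr_null] this costs no probability. *)
Definition stay n y : Prop :=
  [/\ y 0%N = s, forall i, (i <= n)%N -> y i \in D &
      forall i, (i < n)%N -> 0 < p (y i) (y i.+1)].

Definition success y : Prop := exists n,
  [/\ stay n y, y n.+1 \in A & 0 < p (y n) (y n.+1)].

Lemma stay_finitary n : finitary n (stay n).
Proof.
move=> y y' yy' [y0 yD yp]; split.
- by rewrite -yy'.
- by move=> i i_le; rewrite -yy' //; apply: yD.
- by move=> i i_lt; rewrite -!yy' //; [apply: yp | apply: ltnW].
Qed.

(** Law at time [n] of the chain killed on leaving [D]. *)
Let mass n x : R := pr (event (fun y => stay n y /\ y n = x)).

Lemma mass_finitary n x : finitary n (fun y => stay n y /\ y n = x).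
Proof.
by move=> y y' yy' [st yn]; split; [apply: stay_finitary st | rewrite -yy'].
Qed.

Lemma mass_total n : pr (event (stay n)) = \sum_x mass n x.
Proof. exact/pr_total/event_meas/stay_finitary. Qed.

Lemma mass_ge0 n x : 0 <= mass n x. Proof. exact: pr_ge0. Qed.

Lemma mass_out n x : x \notin D -> mass n x = 0.
Proof.
move=> xD; rewrite /mass (_ : event _ = set0) ?pr_set0 //.
apply/seteqP; split=> // w [[_ yD _] yn]; move: (yD n (leqnn n)).
by rewrite yn (negbTE xD).
Qed.

Lemma mass_step n x z :
  pr (event (fun y => stay n y /\ y n = x) `&` Y n.+1 @^-1` [set z]) = mass n x * p x z.
Proof. by apply: markov_property; [apply: mass_finitary | move=> y []]. Qed.

Lemma pr_next n z :
  pr (event (stay n) `&` Y n.+1 @^-1` [set z]) = \sum_x mass n x * p x z.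
Proof.
have mS := event_meas (@stay_finitary n).
rewrite (pr_total n); last exact: measurableI.
by apply: eq_bigr => x _; rewrite setIAC -mass_step.
Qed.

Lemma mass_next n z : mass n.+1 z <= (z \in D)%:R * \sum_x mass n x * p x z.
Proof.
have [zD|zD] := boolP (z \in D); last by rewrite mul0r mass_out.
rewrite mul1r -pr_next; apply: pr_le.
- by apply: event_meas; apply: mass_finitary.
- by apply: measurableI => //; apply: event_meas; apply: stay_finitary.
move=> w [[y0 yD yp] yn]; split=> //; split=> //.
  by move=> i i_le; apply: yD; apply: leqW.
by move=> i i_lt; apply: yp; apply: leqW.
Qed.

Let bad n : R := \sum_(z in B) \sum_x mass n x * p x z.

(** The mass that lands outside [D] leaves the killed chain and is kept as a separate term. A
    harmonic [f] then bounds the loss to [B], an exit-time [f] the duration. *)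
Lemma mass_superharmonic n (f : X -> R) : (forall x, 0 <= f x) ->
  \sum_z mass n.+1 z * f z + \sum_z (\sum_x mass n x * p x z) * ((z \notin D)%:R * f z) <=
  \sum_x mass n x * (\sum_z p x z * f z).
Proof.
move=> f_ge0; rewrite -big_split /=.
have -> : \sum_x mass n x * (\sum_z p x z * f z) = \sum_z (\sum_x mass n x * p x z) * f z.
  under eq_bigr do rewrite mulr_sumr.
  rewrite exchange_big /=; apply: eq_bigr => z _; rewrite mulr_suml.
  by apply: eq_bigr => x _; rewrite mulrA.
apply: ler_sum => z _; have := ler_wpM2r (f_ge0 z) (mass_next n z).
by case: (z \in D) => /=; rewrite ?mul0r ?mul1r ?mulr0 ?addr0 //; lra.
Qed.

Lemma mass_init f : (forall x, 0 <= f x) -> \sum_x mass 0 x * f x <= f s.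
Proof.
move=> f_ge0; rewrite (bigD1 s) //= [X in _ + X]big1 ?addr0 => [|x x_neq].
  rewrite -[leRHS]mul1r; apply: ler_wpM2r => //.
  by apply: pr_le1; apply: event_meas; apply: mass_finitary.
rewrite /mass (_ : event _ = set0) ?pr_set0 ?mul0r //.
by apply/seteqP; split=> // w [[y0 _ _] yx]; move: x_neq; rewrite -y0 -yx eqxx.
Qed.

Lemma success_meas : measurable (event success).
Proof.
rewrite (_ : event success = \bigcup_n event (fun y => [/\ stay n y, y n.+1 \in A & 0 < p (y n) (y n.+1)])).
  apply: bigcupT_measurable => n; apply: (@event_meas n.+1) => y y' yy' [st yA yp].
  split; rewrite -?yy' //; apply: stay_finitary st => i i_le; apply: yy'; exact: leqW.
by apply/seteqP; split=> w [n]; [exists n | exists n].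
Qed.

Lemma bad_meas n : measurable (event (fun y => stay n y /\ y n.+1 \in B)).
Proof.
apply: (@event_meas n.+1) => y y' yy' [st yB]; split; last by rewrite -yy'.
by apply: stay_finitary st => i i_le; apply: yy'; apply: leqW.
Qed.

Lemma null_meas n : measurable (event (fun y => stay n y /\ ~~ (0 < p (y n) (y n.+1)))).
Proof.
apply: (@event_meas n.+1) => y y' yy' [st yp]; split; last by rewrite -!yy'.
by apply: stay_finitary st => i i_le; apply: yy'; apply: leqW.
Qed.

Lemma pr_bad n : pr (event (fun y => stay n y /\ y n.+1 \in B)) <= bad n.
Proof.
have mE := bad_meas n.
rewrite (pr_total n.+1 mE) /bad [leRHS]big_mkcond; apply: ler_sum => z _.
case: ifP => zB.
  rewrite -pr_next; apply: pr_le; first exact: measurableI.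
    by apply: measurableI => //; apply: event_meas; apply: stay_finitary.
  by move=> w [[]].
rewrite (_ : _ `&` _ = set0) ?pr_set0 //; apply/seteqP; split=> // w [[_ yB] /= yz].
by move: yB; rewrite yz zB.
Qed.

Lemma pr_null n : pr (event (fun y => stay n y /\ ~~ (0 < p (y n) (y n.+1)))) = 0.
Proof.
have mE := null_meas n.
rewrite (pr_total n mE) big1 // => x _.
have mEx := measurableI _ _ mE (Y_meas n x).
rewrite (pr_total n.+1 mEx) big1 // => z _; apply/le_anti; rewrite pr_ge0 andbT.
have [p_gt0|p_le0] := ltP 0 (p x z).
  rewrite (_ : _ `&` _ = set0) ?pr_set0 //; apply/seteqP; split=> // w [[[_ np] /= yx] /= yz].
  by move: np; rewrite yx yz p_gt0.
have p0 : p x z = 0 by apply/le_anti; rewrite p_le0 p_ge0.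
apply: (@le_trans _ _ (mass n x * p x z)); last by rewrite p0 mulr0.
rewrite -mass_step; apply: pr_le.
- exact: measurableI.
- by apply: measurableI => //; apply: event_meas; apply: mass_finitary.
- by move=> w [[[st _] yx] yz].
Qed.

(** Without success the chain is still in [D], or has left it into [B], or has started wrongly or
    made a jump of probability zero. *)
Lemma failure_le n : pr (~` event success) <= pr (event (stay n)) + \sum_(j < n) bad j.
Proof.
have mF := measurableC success_meas.
have mS k := event_meas (@stay_finitary k).
suff : pr (~` event success) <= pr (~` event success `&` event (stay n)) + \sum_(j < n) bad j.
  move/le_trans; apply; rewrite lerD2r.
  by apply: (pr_le (measurableI _ _ mF (mS n)) (mS n)) => u [].
elim: n => [|n IHn].
  rewrite big_ord0 addr0.
  have m0 : measurable (event (fun y => y 0%N != s)).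
    by apply: (@event_meas 0) => y y' yy'; rewrite yy'.
  have pr0 : pr (event (fun y => y 0%N != s)) = 0.
    rewrite (_ : event _ = ~` cylinder 1 (fun=> s)).
      rewrite pr_setC; last exact: cylinder_meas.
      by rewrite /pr P_cylinder eqxx big_ord0 mulr1 /= subrr.
    apply/seteqP; split=> w; first by move=> /eqP y0 C; apply: y0; apply: C.
    by move=> nC; apply/eqP => y0; apply: nC => -[].
  rewrite -[leRHS]add0r -pr0; apply: le_trans (pr_setU m0 (measurableI _ _ mF (mS 0%N))).
  apply: pr_le => //; first by apply: measurableU => //; apply: measurableI.
  move=> w Fw; have [y0|] := eqVneq (Y 0 w) s; last by left.
  right; split=> //; split=> // i.
  by rewrite leqn0 => /eqP ->; rewrite y0.
rewrite big_ord_recr /=; apply: (le_trans IHn).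
have mB := bad_meas n.
have mN := null_meas n.
have mFS := measurableI _ _ mF (mS n.+1).
have sub : ~` event success `&` event (stay n) `<=` (~` event success `&` event (stay n.+1)) `|`
    (event (fun y => stay n y /\ y n.+1 \in B) `|`
     event (fun y => stay n y /\ ~~ (0 < p (y n) (y n.+1)))).
  move=> w [Fw st]; have [p_gt0|p_le0] := boolP (0 < p (Y n w) (Y n.+1 w)); last by right; right.
  have [yB|yB] := boolP (Y n.+1 w \in B); first by right; left.
  have [yD|yD] := boolP (Y n.+1 w \in D).
    left; split=> //; case: st => y0 st1 st2; split=> // i.
      by rewrite leq_eqVlt => /predU1P[->//|]; apply: st1.
    by rewrite ltnS leq_eqVlt => /predU1P[->//|]; apply: st2.
  by case: Fw; exists n; split=> //; rewrite A_out yD yB.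
have le1 := pr_le (measurableI _ _ mF (mS n)) (measurableU _ _ mFS (measurableU _ _ mB mN)) sub.
have le2 := pr_setU mFS (measurableU _ _ mB mN).
have le3 := pr_setU mB mN; have := pr_bad n; have := pr_null n; lra.
Qed.

(** The total flow into [B] telescopes below [h s], and the sum of the probabilities of [stay n]
    below [w s]. The latter decrease in [n], so they tend to 0 and the chain almost surely leaves
    [D]. *)
Lemma pr_success (h w : X -> R) : (forall x, 0 <= h x) -> (forall x, 0 <= w x) ->
  (forall x, x \in B -> h x = 1) ->
  (forall x, x \in D -> h x = \sum_z p x z * h z) ->
  (forall x, x \in D -> w x = 1 + \sum_z p x z * w z) ->
  1 - h s <= pr (event success).
Proof.
move=> h_ge0 w_ge0 hB h_harm w_harm.
have bad_le n : \sum_(j < n) bad j + \sum_x mass n x * h x <= h s.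
  elim: n => [|n IHn]; first by rewrite big_ord0 add0r mass_init.
  rewrite big_ord_recr /=; apply: le_trans IHn; rewrite -addrA lerD2l.
  have -> : \sum_x mass n x * h x = \sum_x mass n x * (\sum_z p x z * h z).
    apply: eq_bigr => x _; have [xD|xD] := boolP (x \in D); first by rewrite -h_harm.
    by rewrite mass_out // !mul0r.
  apply: le_trans (mass_superharmonic n h_ge0); rewrite addrC lerD2l /bad big_mkcond.
  apply: ler_sum => z _; case: ifP => zB.
    rewrite hB // mulr1; case: (boolP (z \in D)) => [zD|_]; last by rewrite mulr1.
    by have := B_out zD; rewrite zB.
  by rewrite mulr_ge0 ?mulr_ge0 ?ler0n // sumr_ge0 // => x _; rewrite mulr_ge0 ?mass_ge0.
have stay_le n : \sum_(j < n) pr (event (stay j)) + \sum_x mass n x * w x <= w s.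
  elim: n => [|n IHn]; first by rewrite big_ord0 add0r mass_init.
  rewrite big_ord_recr /=; apply: le_trans IHn; rewrite -addrA lerD2l.
  have -> : \sum_x mass n x * w x =
      pr (event (stay n)) + \sum_x mass n x * (\sum_z p x z * w z).
    rewrite mass_total -big_split; apply: eq_bigr => x _ /=.
    have [xD|xD] := boolP (x \in D); first by rewrite {1}w_harm // mulrDr mulr1.
    by rewrite mass_out // !mul0r addr0.
  rewrite lerD2l; apply: le_trans (mass_superharmonic n w_ge0); rewrite lerDl.
  apply: sumr_ge0 => z _; rewrite mulr_ge0 ?mulr_ge0 ?ler0n // sumr_ge0 // => x _.
  by rewrite mulr_ge0 ?mass_ge0.
have stay_anti j n : (j <= n)%N -> pr (event (stay n)) <= pr (event (stay j)).
  move=> jn; apply: pr_le; [exact/event_meas/stay_finitary|exact/event_meas/stay_finitary|].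
  move=> u [y0 yD yp]; split=> // i i_le; first by apply: yD; apply: leq_trans jn.
  by apply: yp; apply: leq_trans jn.
have stay_small n : n%:R * pr (event (stay n)) <= w s.
  apply: le_trans (stay_le n); rewrite -[leLHS]addr0 lerD //; last first.
    by apply: sumr_ge0 => x _; rewrite mulr_ge0 ?mass_ge0.
  rewrite mulr_natl -[X in _ *+ X]card_ord -sumr_const; apply: ler_sum => j _.
  by apply: stay_anti; apply: ltnW.
have bad_h n : \sum_(j < n) bad j <= h s.
  by apply: le_trans (bad_le n); rewrite lerDl sumr_ge0 // => x _; rewrite mulr_ge0 ?mass_ge0.
rewrite lerBlDr -lerBlDl -(pr_setC success_meas).
apply/ler_addgt0Pl => eps eps_gt0.
pose n := (Num.truncn (w s / eps)).+1.
have n_gt : w s < n%:R * eps by rewrite -ltr_pdivrMr // /n truncnS_gt.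
have st_lt : pr (event (stay n)) <= eps.
  have n_gt0 : 0 < n%:R :> R by rewrite ltr0n.
  by rewrite -(ler_pM2l n_gt0); apply: le_trans (stay_small n) (ltW n_gt).
by apply: le_trans (failure_le n) _; apply: lerD.
Qed.

End JumpChain.

(** * The Metropolis jump chain as a network *)

Section Metropolis.
Variables (R : realType) (V : finType) (q : nat) (e : rel V) (beta : R).
Hypotheses (q_gt1 : (1 < q)%N) (v0 : V) (beta_gt0 : 0 < beta).
Local Notation config := {ffun V -> 'I_q}.
Local Notation H := (hamiltonian e).
Implicit Types s z : config.

Definition conductance s z : R :=
  if config_adj s z then expR (- (beta * (maxn (H s) (H z))%:R)) else 0.

Local Notation rate := (metropolis_rate e beta).
Local Notation total_rate := (exit_rate rate).

Lemma conductance_sym s z : conductance s z = conductance z s.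
Proof. by rewrite /conductance config_adj_sym maxnC. Qed.

Lemma conductance_ge0 s z : 0 <= conductance s z.
Proof. by rewrite /conductance; case: ifP => // _; apply: expR_ge0. Qed.

(** Detailed balance: adding [H s] to the positive part of [H z - H s] gives the maximum of the
    two. *)
Lemma conductance_rate s z : conductance s z = expR (- (beta * (H s)%:R)) * rate s z.
Proof.
rewrite /conductance /metropolis_rate; case: ifP => _; last by rewrite mulr0.
rewrite -expRD -opprD -mulrDr; congr (expR (- (beta * _))).
case: (leqP (H s) (H z)) => [le|/ltnW le].
  by rewrite max_l ?subr_ge0 ?ler_nat // addrCA subrr addr0.
by rewrite max_r ?addr0 // subr_le0 ler_nat.
Qed.

(** An arbitrary change of spin at [x]; it supplies a neighbour and so a positive exit rate. *)
Definition recolour s x : config :=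
  [ffun y => if y == x then (if val (s x) == 0%N then Ordinal q_gt1 else Ordinal (ltnW q_gt1)) else s y].

Lemma recolour_adj s x : config_adj s (recolour s x).
Proof.
apply/config_adjP; exists x => [|y /negbTE y_neq]; rewrite ffunE ?y_neq // eqxx.
by apply/negP => /eqP E; have := congr1 val E; case: eqP => [-> //|sx E0]; apply: sx.
Qed.

Lemma conductance_adj s z : config_adj s z -> 0 < conductance s z.
Proof. by rewrite /conductance => ->; apply: expR_gt0. Qed.

(** Induction on the number of sites where the two configurations differ. *)
Lemma conductance_connected (f : config -> R) :
  (forall s z, 0 < conductance s z -> f s = f z) -> forall s z, f s = f z.
Proof.
move=> fc s z; move: {2}#|_|%SET (leqnn #|[set x | s x != z x]%SET|) => n.
elim: n s => [|n IHn] s le_n.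
  suff -> : s = z by [].
  apply/ffunP => x; apply/eqP; move: le_n; rewrite leqn0 => /eqP/card0_eq/(_ x).
  by rewrite !inE => /negbFE.
case: (pickP (fun x => s x != z x)) => [x x_neq|same]; last first.
  by congr f; apply/ffunP => x; apply/eqP; have /negbFE := same x.
pose s' : config := [ffun y => if y == x then z x else s y].
rewrite (fc s s'); last first.
  apply/conductance_adj/config_adjP; exists x; first by rewrite ffunE eqxx.
  by move=> y /negbTE y_neq; rewrite ffunE y_neq.
apply: IHn; rewrite -ltnS; apply: leq_trans le_n; apply: proper_card; apply/properP; split.
  apply/fintype.subsetP => y; rewrite !inE ffunE; case: (eqVneq y x) => [->|//]; by rewrite eqxx.
by exists x; rewrite !inE ?ffunE ?eqxx.
Qed.

Lemma metropolis_rate_ge0 s z : 0 <= rate s z.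
Proof. by rewrite /metropolis_rate; case: ifP => // _; apply: expR_ge0. Qed.

Lemma exit_rate_gt0 s : 0 < total_rate s.
Proof.
rewrite /exit_rate (bigD1 (recolour s v0)) //=; apply: ltr_pwDl.
  by rewrite /metropolis_rate recolour_adj expR_gt0.
by apply: sumr_ge0 => z _; apply: metropolis_rate_ge0.
Qed.

Definition jump_prob s z : R := rate s z / total_rate s.

Lemma jump_prob_ge0 s z : 0 <= jump_prob s z.
Proof. by rewrite divr_ge0 ?metropolis_rate_ge0 // ltW // exit_rate_gt0. Qed.

Lemma jump_prob_adj s z : 0 < jump_prob s z -> config_adj s z.
Proof. by rewrite /jump_prob /metropolis_rate; case: ifP => // _; rewrite mul0r ltxx. Qed.

(** Reversible measure of the jump chain: the Gibbs weight times the exit rate, because the jump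
    chain does not see the holding times. *)
Let weight s : R := expR (- (beta * (H s)%:R)) * total_rate s.

Lemma weight_gt0 s : 0 < weight s.
Proof. by rewrite mulr_gt0 ?expR_gt0 ?exit_rate_gt0. Qed.

Lemma conductance_jump s z : conductance s z = weight s * jump_prob s z.
Proof.
rewrite conductance_rate /weight /jump_prob -mulrA; congr (_ * _).
by rewrite mulrCA divff ?mulr1 // gt_eqF // exit_rate_gt0.
Qed.

Lemma jump_prob_sum s : \sum_z jump_prob s z = 1.
Proof. by rewrite -mulr_suml divff // gt_eqF // exit_rate_gt0. Qed.

Lemma laplacian_jump (f : config -> R) s :
  laplacian conductance f s = weight s * (f s - \sum_z jump_prob s z * f z).
Proof.
rewrite -{1}[f s]mul1r -(jump_prob_sum s) mulr_suml -sumrB mulr_sumr.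
by apply: eq_bigr => z _; rewrite conductance_jump; ring.
Qed.

Lemma metropolis_success (d : measure_display) (Omega : measurableType d)
    (P : probability Omega R) (Y : nat -> Omega -> config) (s : config)
    (Gam : nat) (target : {set config}) (w : nat -> config) (T : nat) :
  (forall n y, measurable (Y n @^-1` [set y])) ->
  (forall n y, P (cylinder Y n.+1 y) =
     ((y 0%N == s)%:R * \prod_(i < n) jump_prob (y i) (y i.+1))%:E) ->
  s \notin target -> w 0%N = s -> w T \in target -> is_path w T ->
  (forall i, (i <= T)%N -> (H (w i) <= Gam)%N) ->
  1 - 2 * T%:R ^+ 2 * #|{: config}|%:R ^+ 2 * expR (- beta) <=
  pr P (event Y (success jump_prob s
    [set x | (H x <= Gam)%N && (x \notin target)]%SET
    [set x | (H x <= Gam)%N && (x \in target)]%SET)).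
Proof.
move=> Y_meas P_cyl s_out w0 wT w_path w_le.
set D := [set x | _ && (x \notin target)]%SET; set A := [set x | _ && (x \in target)]%SET.
pose B := [set x : config | (Gam < H x)%N]%SET.
have B_out x : x \in D -> x \notin B by rewrite !inE -leqNgt => /andP[].
have A_out x : (x \in A) = (x \notin D) && (x \notin B).
  by rewrite !inE -leqNgt; case: (H x <= Gam)%N; rewrite ?andbF //= negbK andbT.
have sD : s \in D by rewrite !inE s_out -w0 w_le.
have wTD : w T \notin D by rewrite !inE wT andbF.
have [h [h_out h_in]] := dirichlet_problem conductance_sym conductance_ge0
  conductance_connected (fun x => (x \in B)%:R) wTD.
(* Since [laplacian_jump] carries the factor [weight], this source makes [u] the mean number of
   jumps before leaving [D]; [h] is the probability of leaving through [B]. *)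
have [u [u_out u_in]] := dirichlet_problem conductance_sym conductance_ge0
  conductance_connected (fun x => if x \in D then weight x else 0) wTD.
have h_lap x : x \in D -> laplacian conductance h x = 0.
  by move=> xD; rewrite h_in // (negbTE (B_out x xD)).
have h_ge0 x : 0 <= h x.
  by apply: (comparison conductance_sym conductance_ge0 conductance_connected wTD) => z zD;
    rewrite ?h_lap ?h_out ?ler0n.
have u_ge0 x : 0 <= u x.
  apply: (comparison conductance_sym conductance_ge0 conductance_connected wTD) => z zD.
    by rewrite u_in // zD ltW // weight_gt0.
  by rewrite u_out // (negbTE zD).
have lap_eq (f : config -> R) x (v : R) : laplacian conductance f x = weight x * v ->
    f x = v + \sum_z jump_prob x z * f z.
  rewrite laplacian_jump => /(mulfI (lt0r_neq0 (weight_gt0 x))) <-; by rewrite subrK.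
have := @pr_success _ _ _ P _ Y Y_meas jump_prob s jump_prob_ge0 P_cyl D A B sD A_out B_out h u
  h_ge0 u_ge0.
move=> succ; apply: le_trans (succ _ _ _); last 3 first.
- move=> x xB; have xD : x \notin D by apply: contraL xB; apply: B_out.
  by rewrite h_out // xB.
- by move=> x xD; rewrite [LHS](lap_eq _ _ 0) ?add0r // mulr0 h_lap.
- by move=> x xD; rewrite [LHS](lap_eq _ _ 1) // mulr1 u_in // xD.
rewrite lerD2l lerN2.
have c_ge i : (i < T)%N -> expR (- (beta * Gam%:R)) <= conductance (w i) (w i.+1).
  move=> iT; rewrite /conductance w_path // ler_expR lerN2 ler_pM2l // ler_nat geq_max.
  by rewrite !w_le // ltnW.
have B_flux : \sum_(x in B) \sum_y conductance x y <=
    #|{: config}|%:R ^+ 2 * expR (- (beta * (Gam.+1)%:R)).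
  have c_le x y : x \in B -> conductance x y <= expR (- (beta * (Gam.+1)%:R)).
    rewrite inE => xB; rewrite /conductance; case: ifP => _; last exact: expR_ge0.
    by rewrite ler_expR lerN2 ler_pM2l // ler_nat leq_max xB.
  apply: (@le_trans _ _ (\sum_(x : config) \sum_(y : config) expR (- (beta * (Gam.+1)%:R)))).
    rewrite [leLHS]big_mkcond; apply: ler_sum => x _; case: ifP => xB.
      by apply: ler_sum => y _; apply: c_le.
    by apply: sumr_ge0 => y _; apply: expR_ge0.
  by rewrite !sumr_const -mulrnA -[leLHS]mulr_natl natrM expr2.
have := hitting_bound conductance_sym conductance_ge0 conductance_connected sD B_out h_lap h_out
  w0 wTD (expR_gt0 _) c_ge B_flux.
move/le_trans; apply; rewrite -expRN opprK.
rewrite [leLHS](_ : _ = 2 * T%:R ^+ 2 * #|{: config}|%:R ^+ 2 *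
  (expR (beta * Gam%:R) * expR (- (beta * (Gam.+1)%:R)))); last by ring.
have -> : beta * Gam.+1%:R = beta * Gam%:R + beta by rewrite -natr1 mulrDr mulr1.
by rewrite -expRD opprD addrA subrr add0r.
Qed.

End Metropolis.

(** * Trajectories of the process *)

Section Trajectory.
Variables (R : realType) (Omega : Type) (q K L M : nat) (a : 'I_q).
Local Notation config := {ffun 'I_K * 'I_L * 'I_M -> 'I_q}.
Variables (sigma : R -> Omega -> config) (Y : nat -> Omega -> config) (S : nat -> Omega -> R).
Let J (n : nat) (o : Omega) : R := \sum_(i < n) S i o.
Hypothesis S_gt0 : forall n o, 0 < S n o.
Hypothesis J_cvg : forall o, J n o @[n --> \oo] --> +oo.
Hypothesis sigmaE : forall n o t, J n o <= t < J n.+1 o -> sigma t o = Y n o.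
Implicit Types (o : Omega) (y : nat -> config).

Local Notation other := (grounds [set~ a]%SET).
Local Notation transition := (@transition_path K L M q [set a]%SET [set~ a]%SET).

(** The jump-chain form of the event: avoiding the other ground states up to index [n T] expresses
    that the last sampled time precedes the hitting time. *)
Definition visits y : Prop := exists (T : nat) (n : nat -> nat),
  [/\ forall i, (i < T)%N -> (n i < n i.+1)%N,
      forall j, (j <= n T)%N -> ~ other (y j) &
      transition (fun i => y (n i)) T].

Lemma jump_time0 o : J 0 o = 0. Proof. exact: big_ord0. Qed.

Lemma jump_time_lt o n : J n o < J n.+1 o.
Proof. by rewrite /J big_ord_recr /= ltrDl. Qed.

Lemma jump_time_le o m n : (m <= n)%N -> J m o <= J n o.
Proof.
elim: n => [|n IHn]; first by rewrite leqn0 => /eqP ->.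
rewrite leq_eqVlt => /predU1P[-> //|]; rewrite ltnS => /IHn le.
exact: le_trans le (ltW (jump_time_lt o n)).
Qed.

Lemma jump_time_ge0 o n : 0 <= J n o.
Proof. by rewrite -(jump_time0 o) jump_time_le. Qed.

Lemma jump_index o t : 0 <= t -> exists n, J n o <= t < J n.+1 o.
Proof.
move=> t_ge0; have /cvgryPgt/(_ t)[N _ N_gt] := @J_cvg o.
have ex : exists n, t < J n o by exists N; apply: N_gt => /=.
case: (ex_minnP ex) => -[|n] n_gt n_min; first by move: n_gt; rewrite jump_time0 ltNge t_ge0.
exists n; rewrite n_gt andbT leNgt; apply/negP => /n_min; by rewrite ltnn.
Qed.

Lemma transition_path_ext (w w' : nat -> config) T :
  (forall i, (i <= T)%N -> w i = w' i) -> transition w T -> transition w' T.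
Proof.
move=> ww' [path w0 wT mid]; split.
- by move=> i iT; rewrite -!ww' //; [apply: path | apply: ltnW].
- by rewrite -ww'.
- by rewrite -ww'.
- by move=> i i_bd; rewrite -ww'; [apply: mid | lia].
Qed.

(** An equality of sets, so measurability transfers too. Each sampled time lies in one holding
    interval, and consecutive configurations are adjacent, hence distinct, which makes the indices
    strictly increasing. *)
Lemma followsE : follows_transition_path sigma a = [set o | visits (fun i => Y i o)].
Proof.
apply/seteqP; split=> o.
  move=> [T [t [t0 t_incr t_hit trans]]].
  have t_gt0 i : (i <= T)%N -> 0 < t i.
    elim: i => [//|i IHi] lt; apply: lt_trans (t_incr i lt); apply: IHi; exact: ltnW.
  have /choice[n nP] : forall i, exists n, (i <= T)%N -> J n o <= t i < J n.+1 o.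
    move=> i; case: (leqP i T) => [iT|_]; last by exists 0%N.
    by have [n ?] := jump_index o (ltW (t_gt0 i iT)); exists n.
  have sE i : (i <= T)%N -> sigma (t i) o = Y (n i) o.
    by move=> iT; apply: sigmaE; apply: nP.
  have trans' : transition (fun i => Y (n i) o) T by apply: transition_path_ext trans.
  exists T, n; split=> //.
    move=> i iT; have [path _ _ _] := trans'; have := path i iT => adj.
    rewrite ltn_neqAle; apply/andP; split.
      by apply: contraTneq adj => ->; apply/config_adjP => -[x]; rewrite eqxx.
    rewrite leqNgt; apply/negP => lt.
    have /andP[_ lt1] := nP i.+1 iT; have /andP[le2 _] := nP i (ltnW iT).
    have := lt_trans (le_lt_trans le2 (t_incr i iT)) lt1.
    by rewrite ltNge jump_time_le.
  move=> j j_le oth; move: t_hit; rewrite ltNge => /negP; apply.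
  apply: ge_ereal_inf; exists (J j o)%:E.
    exists (J j o) => //; split; first exact: jump_time_ge0.
    by rewrite (@sigmaE j) // lexx jump_time_lt.
  rewrite lee_fin; have /andP[le _] := nP T (leqnn T).
  by apply: le_trans le; apply: jump_time_le.
move=> [T [n [n_incr n_out trans]]].
(* Midpoints of the holding intervals: the first time is positive even if [n 0 = 0], and the last
   one is strictly before the next jump. *)
pose t i := (J (n i) o + J (n i).+1 o) / 2.
have t_mid i : J (n i) o < t i < J (n i).+1 o.
  by have := jump_time_lt o (n i); rewrite /t => lt; apply/andP; split; lra.
have sE i : sigma (t i) o = Y (n i) o.
  by apply: sigmaE; have /andP[/ltW -> ->] := t_mid i.
exists T, t; split.
- have /andP[lt _] := t_mid 0%N; exact: le_lt_trans (jump_time_ge0 _ _) lt.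
- move=> i iT; have /andP[_ lt1] := t_mid i; have /andP[lt2 _] := t_mid i.+1.
  by apply: lt_trans lt1 (le_lt_trans _ lt2); apply: jump_time_le; apply: n_incr.
- have /andP[_ lt] := t_mid T.
  apply: (@lt_le_trans _ _ (J (n T).+1 o)%:E); first by rewrite lte_fin.
  apply: le_ereal_inf_tmp => _ [u [u_ge0 oth] <-]; rewrite lee_fin.
  have [k k_bd] := jump_index o u_ge0; rewrite (sigmaE k_bd) in oth.
  have k_gt : (n T < k)%N by rewrite ltnNge; apply/negP => /n_out.
  by have /andP[le _] := k_bd; apply: le_trans le; apply: jump_time_le.
by apply: transition_path_ext trans => i _; rewrite sE.
Qed.

End Trajectory.

Section VisitsMeasurable.
Variables (q K L M : nat) (a : 'I_q).
Local Notation config := {ffun 'I_K * 'I_L * 'I_M -> 'I_q}.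
Variables (d : measure_display) (Omega : measurableType d) (Y : nat -> Omega -> config).
Hypothesis Y_meas : forall n y, measurable (Y n @^-1` [set y]).

(** Index sequences form an uncountable type, but finitely many values matter: coded by lists, they
    give a countable union of finitary events. *)
Lemma visits_meas : measurable (event Y (@visits q K L M a)).
Proof.
(* A list holds [T + 1] indices; the empty list counts as [T = 0] with the default index 0. *)
pose along (l : seq nat) (y : nat -> config) := let T := (size l).-1 in
  [/\ forall i, (i < T)%N -> (nth 0 l i < nth 0 l i.+1)%N,
      forall j, (j <= nth 0 l T)%N -> ~ grounds [set~ a]%SET (y j) &
      transition_path [set a]%SET [set~ a]%SET (fun i => y (nth 0 l i)) T].
have -> : event Y (@visits q K L M a) = \bigcup_l event Y (along l).
  apply/seteqP; split=> o; last by move=> [l _ [H1 H2 H3]]; exists (size l).-1, (nth 0 l).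
  move=> [T [n [n_incr n_out trans]]]; exists (mkseq n T.+1) => //.
  have nthE i : (i <= T)%N -> nth 0 (mkseq n T.+1) i = n i by move=> iT; rewrite nth_mkseq.
  change (along (mkseq n T.+1) (fun i => Y i o)); rewrite /along size_mkseq; split.
  - by move=> i iT; rewrite !nthE //; [apply: n_incr | apply: ltnW].
  - by rewrite nthE.
  - by apply: transition_path_ext trans => i iT; rewrite nthE.
apply: countable_bigcupT_measurable => [|l]; first exact: countableP.
apply: (@event_meas _ _ _ _ Y_meas (\max_(i < (size l).-1.+1) nth 0%N l i)%N).
move=> y y' yy' [H1 H2 H3].
have l_le i : (i <= (size l).-1)%N -> (nth 0 l i <= \max_(i < (size l).-1.+1) nth 0%N l i)%N.
  move=> i_le; have i_lt : (i < (size l).-1.+1)%N by [].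
  exact: (@leq_bigmax _ (fun i : 'I_(size l).-1.+1 => nth 0%N l i) (Ordinal i_lt)).
split=> //.
  by move=> j j_le; rewrite -yy'; [apply: H2 | apply: leq_trans j_le (l_le _ _)].
by apply: transition_path_ext H3 => i iT; rewrite yy' // l_le.
Qed.

End VisitsMeasurable.

Theorem theorem2p9 (R : realType) (q K L M : nat)
  (hq : (2 <= q)%N) (hK : (2829 <= K)%N) (hKL : (K <= L)%N) (hLM : (L <= M)%N)
  (a : 'I_q)
  (d : R -> measure_display) (Omega : forall beta : R, measurableType (d beta))
  (P : forall beta : R, probability (Omega beta) R)
  (sigma : forall beta : R, R -> Omega beta -> {ffun 'I_K * 'I_L * 'I_M -> 'I_q})
  (hsigma : forall beta : R, 0 < beta ->
     is_markov_chain (P beta) (metropolis_rate (@adj3 K L M) beta)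
       (monochromatic _ a) (sigma beta)) :
  (forall beta : R, 0 < beta ->
     measurable (follows_transition_path (sigma beta) a)) /\
  P beta (follows_transition_path (sigma beta) a) @[beta --> +oo] --> 1%E.
Proof.
have K_gt5 : (5 < K)%N by apply: leq_trans hK.
have K_gt2 : (2 < K)%N by apply: leq_trans K_gt5.
have L_gt2 : (2 < L)%N by apply: leq_trans hKL.
have M_gt2 : (2 < M)%N by apply: leq_trans hLM.
have M_gt0 : (0 < M)%N by apply: leq_trans M_gt2.
pose l0 : 'I_M := Ordinal M_gt0.
have v0 : 'I_K * 'I_L * 'I_M.
  by split; [split; [apply: (Ordinal (m := 0) (n := K)) | apply: (Ordinal (m := 0) (n := L))]|exact: l0]; lia.
have [b neq] : exists b : 'I_q, a != b.
  exists (if val a == 0%N then Ordinal hq else Ordinal (ltnW hq)).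
  by apply/negP => /eqP E; have := congr1 val E; case: eqP => [-> //|a0 E0]; apply: a0.
pose config := {ffun 'I_K * 'I_L * 'I_M -> 'I_q}.
pose T := (K * L * M)%N.
pose C : R := 2 * T%:R ^+ 2 * #|{: config}|%:R ^+ 2.
have main beta : 0 < beta -> measurable (follows_transition_path (sigma beta) a) /\
    1 - C * expR (- beta) <= pr (P beta) (follows_transition_path (sigma beta) a).
  move=> beta_gt0.
  have [Y [S /= [[mY mS] S_gt0 J_cvg sigmaE law]]] := hsigma beta beta_gt0.
  rewrite (followsE a S_gt0 J_cvg sigmaE).
  have mV : measurable (event Y (@visits q K L M a)) by apply: visits_meas.
  split=> //.
  pose target : {set config} := [set monochromatic _ c | c in [set~ a]%SET]%SET.
  have targetP s : reflect (grounds [set~ a]%SET s) (s \in target).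
    by apply: (iffP imsetP) => [[c ca ->]|[c ca <-]]; exists c.
  have P_cyl n y : P beta (cylinder Y n.+1 y) = ((y 0%N == monochromatic _ a)%:R *
      \prod_(i < n) jump_prob (@adj3 K L M) beta (y i) (y i.+1))%:E.
    (* With all [u i = 0] the holding-time factors are 1, and the constraints [0 < S i] hold
       everywhere. *)
    have := law n y (fun=> 0) (fun=> lexx 0).
    rewrite [X in _ * X](_ : _ = 1) ?mulr1; last first.
      by rewrite big1 // => i _; rewrite mulr0 oppr0 expR0.
    move=> <-; congr (P beta _); apply/seteqP; split=> o.
      by move=> C' i i_le; split; [apply: C' | apply: S_gt0].
    by move=> C' i i_lt; have [] := C' i i_lt.
  have a_out : monochromatic _ a \notin target.
    apply/negP => /imsetP[c]; rewrite !inE => ca E.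
    have := congr1 (fun s : config => s v0) E; rewrite !ffunE => ac.
    by rewrite ac eqxx in ca.
  have fillT : fill K L a b l0 T \in target.
    by rewrite fill_full //; apply/imsetP; exists b; rewrite // !inE eq_sym.
  have fill_path : is_path (fill K L a b l0) T by move=> i iT; apply: fill_adj.
  have fill_le i : (i <= T)%N -> (hamiltonian (@adj3 K L M) (fill K L a b l0 i) <= Gamma K L)%N.
    by move=> _; apply: hamiltonian3_fill.
  have := metropolis_success hq v0 beta_gt0 mY P_cyl a_out (fill0 K L a b l0) fillT fill_path fill_le.
  move/le_trans; apply; apply: pr_le => //; first exact: success_meas.
  (* Up to jump [n + 1] this trajectory is a path of energy at most [Gamma] that meets the other
     ground states only at its end. *)
  move=> o [n [[Y0 YD Yp] YA p_gt0]].
  have Y_adj : is_path (fun i => Y i o) n.+1.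
    move=> i; rewrite ltnS leq_eqVlt => /predU1P[->|/Yp/jump_prob_adj //].
    exact: jump_prob_adj p_gt0.
  move: YA; rewrite inE => /andP[YA_le /imsetP[c]]; rewrite !inE eq_sym => ca Yc.
  have Y_le i : (i <= n.+1)%N -> (hamiltonian3 (Y i o) <= Gamma K L)%N.
    rewrite leq_eqVlt => /predU1P[-> //|]; rewrite ltnS => /YD; by rewrite inE => /andP[].
  have [i [j [ij jn trans]]] := exists_transition_path K_gt5 hKL hLM ca Y0 Yc Y_le Y_adj.
  exists (j - i)%N, (fun t => (i + t)%N); split=> //; first by move=> t _; rewrite addnS.
  (* Since [j < n + 1], all indices up to [j] are spent in the set that excludes the other ground
     states. *)
  move=> k; rewrite subnKC // => kj /targetP; apply/negP.
  have /YD : (k <= n)%N by lia.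
  by rewrite inE => /andP[].
split=> [beta /main[]//|].
apply: cvg_EFin.
  near=> beta; have beta_gt0 : 0 < beta by near: beta; apply: nbhs_pinfty_gt.
  by have [mF _] := main beta beta_gt0; apply: fin_num_measure.
apply: (squeeze_cvgr (f := fun beta : R => 1 - C * expR (- beta)) (h := fun=> 1)).
- near=> beta; have beta_gt0 : 0 < beta by near: beta; apply: nbhs_pinfty_gt.
  have [mF le] := main beta beta_gt0; rewrite /= le /=; exact: pr_le1.
- rewrite -[X in _ --> X]subr0 -[X in _ - X](mulr0 C).
  by apply: cvgB; [apply: cvg_cst | apply: cvgMr; apply: cvgr_expR].
- exact: cvg_cst.
Unshelve. all: by end_near.
Qed.
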